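(* Let $P=\sum_{k=1}^K B_k+\sum_{l=1}^L R_l$ be a sum of $K$ breathers and $L$ solitons of (mKdV) whose $J=K+L$ velocities $v_k^b=\beta_k^2-3\alpha_k^2$ ($1\le k\le K$) and $v_l^s=c_l$ ($1\le l\le L$) are pairwise distinct. There exist $T^*>0$, $\theta>0$, constants $A_s\ge1$ (for $s\ge 2$) and a solution $p$ of (mKdV) such that for any $s\ge 2$ one has $p\in\mathcal C([T^*,+\infty),H^s(\mathbb R))$ and $$\forall t\ge T^*,\qquad \|p(t)-P(t)\|_{H^s}\le A_s e^{-\theta t}.$$
   Context: The modified Korteweg-de Vries equation (mKdV) is $u_t+(u_{xx}+u^3)_x=0$ for real-valued $u(t,x)$, $(t,x)\in\mathbb R^2$. Its Cauchy problem is globally well-posed in $H^2(\mathbb R)$. For $c>0$ let $Q_c(x)=\left(\frac{2c}{\cosh^2(\sqrt c\,x)}\right)^{1/2}$. The soliton with parameters $c>0$, $\kappa\in\{-1,1\}$, $x_0\in\mathbb R$ is $R_{c,\kappa}(t,x;x_0)=\kappa Q_c(x-x_0-ct)$. The breather with parameters $\alpha,\beta>0$, $x_1,x_2\in\mathbb R$ is $$B_{\alpha,\beta}(t,x;x_1,x_2)=2\sqrt2\,\partial_x\left[\arctan\left(\frac{\beta}{\alpha}\frac{\sin(\alpha y_1)}{\cosh(\beta y_2)}\right)\right],\quad y_1=x+(\alpha^2-3\beta^2)t+x_1,\ \ y_2=x+(3\alpha^2-\beta^2)t+x_2.$$ Let $K,L\in\mathbb N$, $J=K+L$. Given breather parameters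 $\alpha_k,\beta_k>0$, $x_{1,k}^0,x_{2,k}^0\in\mathbb R$ ($1\le k\le K$) and soliton parameters $c_l>0$, $\kappa_l\in\{-1,1\}$, $x_{0,l}^0\in\mathbb R$ ($1\le l\le L$), set $B_k(t,x)=B_{\alpha_k,\beta_k}(t,x;x_{1,k}^0,x_{2,k}^0)$ and $R_l(t,x)=R_{c_l,\kappa_l}(t,x;x_{0,l}^0)$. *)

(* Defs.v *)
From HB Require Import structures.
From mathcomp Require Import all_boot all_order all_algebra.
From mathcomp Require Import all_classical all_reals all_analysis.

Set Implicit Arguments.
Unset Strict Implicit.
Unset Printing Implicit Defensive.

Import Order.TTheory GRing.Theory Num.Theory.
Import numFieldNormedType.Exports.

Local Open Scope classical_set_scope.
Local Open Scope ring_scope.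

Definition cosh {R : realType} (y : R) : R := (expR y + expR (- y)) / 2.

Definition Qprofile {R : realType} (c x : R) : R :=
  Num.sqrt (2 * c / cosh (Num.sqrt c * x) ^+ 2).

Definition soliton {R : realType} (c kappa x0 t x : R) : R :=
  kappa * Qprofile c (x - x0 - c * t).

Definition breather {R : realType} (alpha beta x1 x2 t x : R) : R :=
  let y1 z := z + (alpha ^+ 2 - 3 * beta ^+ 2) * t + x1 in
  let y2 z := z + (3 * alpha ^+ 2 - beta ^+ 2) * t + x2 in
  2 * Num.sqrt 2 *
  derive1
    (fun z => atan (beta / alpha * (sin (alpha * y1 z) / cosh (beta * y2 z)))) x.

Definition velocity {R : realType} {K L : nat}
    (alpha beta : 'I_K -> R) (c : 'I_L -> R) (j : 'I_K + 'I_L) : R :=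
  match j with
  | inl k => beta k ^+ 2 - 3 * alpha k ^+ 2
  | inr l => c l
  end.

(* Classical solutions of u_t + (u_xx + u^3)_x = 0 for t in I. The derivability
   clauses are needed because the derivative operator is total. *)
Definition mKdV_solution_on {R : realType} (I : set R) (u : R -> R -> R) : Prop :=
  forall t x : R, I t ->
    [/\ derivable (fun r => u r x) t 1,
        forall n : nat, (n < 3)%N -> derivable (derive1n n (u t)) x 1
      & derive1 (fun r => u r x) t
        + derive1 (fun y => derive1n 2 (u t) y + u t y ^+ 3) x = 0].

Definition square_integrable {R : realType} (f : R -> R) : Prop :=
  f \in Lfun (@lebesgue_measure R) 2%:E.

Definition L2norm {R : realType} (f : R -> R) : \bar R :=
  Lnorm (@lebesgue_measure R) 2%:E (EFin \o f).

(* Real and imaginary parts of the truncated unitary Fourier transform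
   (2 pi)^(-1/2) * \int_(-n)^n f(x) exp(- i x xi) dx. *)
Definition trunc_fourier_re {R : realType} (f : R -> R) (n : nat) (xi : R) : R :=
  (Num.sqrt (2 * pi))^-1 *
  \int[@lebesgue_measure R]_(x in `[- n%:R, n%:R]) (f x * cos (x * xi)).

Definition trunc_fourier_im {R : realType} (f : R -> R) (n : nat) (xi : R) : R :=
  - ((Num.sqrt (2 * pi))^-1 *
  \int[@lebesgue_measure R]_(x in `[- n%:R, n%:R]) (f x * sin (x * xi))).

(* a + i b is (a representative of) the Fourier-Plancherel transform of the
   square-integrable function f: the L^2 limit of the truncated transforms. *)
Definition is_fourier {R : realType} (f a b : R -> R) : Prop :=
  [/\ square_integrable f, square_integrable a, square_integrable b,
      (fun n => L2norm (trunc_fourier_re f n \- a)) @ \oo --> 0%E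
    & (fun n => L2norm (trunc_fourier_im f n \- b)) @ \oo --> 0%E].

(* The H^s norm, || (1 + xi^2)^(s/2) \hat f ||_{L^2}. The pair (a, b) is unique
   up to null sets, so the infimum ranges over at most one value; it is +oo when
   f is not in L^2 (empty set) or f is in L^2 but not in H^s. *)
Definition Hnorm {R : realType} (s : R) (f : R -> R) : \bar R :=
  ereal_inf [set N : \bar R | exists a b : R -> R, is_fourier f a b /\
    N = ((\int[@lebesgue_measure R]_xi
            ((1 + xi ^+ 2) `^ s * (a xi ^+ 2 + b xi ^+ 2))%:E) `^ 2^-1)%E].

Definition continuous_Hs_on {R : realType} (s : R) (I : set R)
    (u : R -> R -> R) : Prop :=
  forall t : R, I t ->
    (Hnorm s (u t) < +oo)%E /\
    Hnorm s (u r \- u t) @[r --> within I (nbhs t)] --> 0%E.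

(* Main.v *)
Require Import Defs.
From HB Require Import structures.
From mathcomp Require Import all_boot all_order all_algebra.
From mathcomp Require Import all_classical all_reals all_analysis.
From mathcomp Require Import measurable_realfun ring lra.

Set Implicit Arguments.
Unset Strict Implicit.
Unset Printing Implicit Defensive.

Import Order.TTheory GRing.Theory Num.Theory.
Import numFieldNormedType.Exports.

Local Open Scope classical_set_scope.
Local Open Scope ring_scope.

(** The solution p is written down in closed form, as the reflectionless
    solution with prescribed spectrum and norming constants, so that no Cauchy
    problem has to be solved.

    The formula. Let K be a real square matrix, a a vector, G a positive
    definite matrix with K G + G K^T = a a^T, and D (t, x) a symmetric matrix
    with K D = D K^T, D_x = - K D and D_t = K^3 D. The linear system
      D xi + G eta = a,   G xi = D eta
    is the real form of (D - i G) (xi + i eta) = a. Pairing its equations with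
    eta and xi eliminates D, hence it is uniquely solvable with bounds that do
    not depend on D ([coercive]). Differentiating it gives xi and eta an
    evolution in x and in t ([spec_dx], [spec_dt]) which is the Lax pair of the
    equation: v = a^T xi satisfies v_t + v_xxx + 6 v^2 v_x = 0, and Num.sqrt 2 *
    v solves mKdV ([mkdv_wave_solution]).

    The blocks. A soliton of velocity be^2 is the 1 x 1 block K = be; a breather
    is the 2 x 2 block of multiplication by the complex number be - i al. For a
    direct sum of blocks G consists of integrals of products of damped sines and
    cosines. It is positive definite because the quadratic form decreases along
    the flow of - K^T at the rate of a squared observation, and only the zero
    vector is never observed ([Gmx_posdef]). The block j of D has the size of
    exp (- be_j (x - v_j t)), where v_j is the velocity. One block alone gives
    the soliton or the breather ([single_pot_soliton], [single_pot_breather]).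

    Superposition. Fix (t, x) and let m be the object nearest to x. As the
    velocities differ, the blocks of D of the slower objects are exponentially
    small in t, and those of the faster objects have exponentially small
    inverse. In the limit the faster components of xi and eta vanish, and the
    slower ones are eliminated by a Schur complement of G. The complement again
    satisfies a Lyapunov equation, with a new vector in the place of a; by
    uniqueness for that equation it is mu G mu^T on the block m, where mu
    commutes with K and maps a to the new vector. So the object m is seen as a
    single object whose data are conjugated by mu: this is its phase shift.
    Taking for D the given data conjugated by all the mu at once cancels the
    shifts ([decoupling], [Dtot], [superposition]), and v differs from the sum
    of the single objects by at most C exp (- d t), uniformly in x.

    Sobolev norms. All the x-derivatives of p are polynomials in xi and eta
    without a term free of xi ([dpoly]); hence they are bounded, and bounded by
    a multiple of exp (W t - d |x|). Interpolating this with the uniform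
    estimate makes p - P exponentially small in t with exponential decay in x.
    The estimate [Hnorm_le] of the H^s norm needs smallness of the function
    only, and mere bounds on its derivatives, at the cost of a square root;
    therefore the rate theta is the same for all s. Continuity in time follows
    in the same way from the Lipschitz bound [wave_lipschitz]. *)

(** * Derivatives of real functions *)

(** Rules of differentiation for explicit lambda terms. They are used with
    [isd_eq], which replaces the computed derivative by an equal expression. *)
Section RealCalculus.
Context {R : realType}.
Implicit Types (f g : R -> R) (x a b c : R).

Lemma isd_eq f x a b : is_derive x 1 f a -> a = b -> is_derive x 1 f b.
Proof. by move=> + <-. Qed.

Lemma isd_cst c x : is_derive x 1 (fun=> c) 0.
Proof. exact: is_derive_cst. Qed.

Lemma isd_id x : is_derive x 1 (fun y : R => y) 1.
Proof. exact: is_derive_id. Qed.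

Lemma isdD f g x a b : is_derive x 1 f a -> is_derive x 1 g b ->
  is_derive x 1 (fun y => f y + g y) (a + b).
Proof. by move=> fa gb; apply: is_deriveD. Qed.

Lemma isdN f x a : is_derive x 1 f a -> is_derive x 1 (fun y => - f y) (- a).
Proof. by move=> fa; apply: is_deriveN. Qed.

Lemma isdB f g x a b : is_derive x 1 f a -> is_derive x 1 g b ->
  is_derive x 1 (fun y => f y - g y) (a - b).
Proof. by move=> fa gb; apply: is_deriveB. Qed.

Lemma isdM f g x a b : is_derive x 1 f a -> is_derive x 1 g b ->
  is_derive x 1 (fun y => f y * g y) (a * g x + f x * b).
Proof.
move=> fa gb; apply: isd_eq (is_deriveM fa gb) _.
by rewrite /GRing.scale/= addrC; congr (_ + _); rewrite mulrC.
Qed.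

Lemma isdZ f c x a : is_derive x 1 f a -> is_derive x 1 (fun y => c * f y) (c * a).
Proof.
move=> fa; apply: isd_eq (isdM (isd_cst c x) fa) _.
by rewrite mul0r add0r.
Qed.

Lemma isd_comp f g x a b : is_derive (g x) 1 f a -> is_derive x 1 g b ->
  is_derive x 1 (fun y => f (g y)) (a * b).
Proof. by move=> fa gb; apply: (@is_derive1_comp _ f g). Qed.

Lemma isdX2 f x a : is_derive x 1 f a ->
  is_derive x 1 (fun y => f y ^+ 2) (2 * f x * a).
Proof.
move=> fa; have -> : (fun y => f y ^+ 2) = (fun y => f y * f y).
  by apply/funext => y; rewrite expr2.
by apply: isd_eq (isdM fa fa) _; ring.
Qed.

Lemma isdX3 f x a : is_derive x 1 f a ->
  is_derive x 1 (fun y => f y ^+ 3) (3 * f x ^+ 2 * a).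
Proof.
move=> fa; have -> : (fun y => f y ^+ 3) = (fun y => f y ^+ 2 * f y).
  by apply/funext => y; rewrite exprSr.
by apply: isd_eq (isdM (isdX2 fa) fa) _; ring.
Qed.

Lemma isdV f x a : f x != 0 -> is_derive x 1 f a ->
  is_derive x 1 (fun y => (f y)^-1) (- a / f x ^+ 2).
Proof.
move=> fx0 fa; apply: isd_eq (is_deriveV fx0 fa) _.
by rewrite /GRing.scale/= !mulNr mulrC.
Qed.

Lemma isd_sum n (F : 'I_n -> R -> R) (dF : 'I_n -> R) x :
  (forall i, is_derive x 1 (F i) (dF i)) ->
  is_derive x 1 (fun y => \sum_(i < n) F i y) (\sum_(i < n) dF i).
Proof.
move=> FdF; have := is_derive_sum FdF.
by congr (is_derive x 1 _ _); apply/funext => y; rewrite fct_sumE.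
Qed.

Lemma isd_expR f x a : is_derive x 1 f a ->
  is_derive x 1 (fun y => expR (f y)) (expR (f x) * a).
Proof. by move=> fa; apply: isd_comp. Qed.

Lemma isd_sin f x a : is_derive x 1 f a ->
  is_derive x 1 (fun y => sin (f y)) (cos (f x) * a).
Proof. by move=> fa; apply: isd_comp. Qed.

Lemma isd_cos f x a : is_derive x 1 f a ->
  is_derive x 1 (fun y => cos (f y)) (- sin (f x) * a).
Proof. by move=> fa; apply: isd_comp. Qed.

Lemma isd_ext f g x a : (forall y, f y = g y) -> is_derive x 1 f a ->
  is_derive x 1 g a.
Proof. by move=> /funext ->. Qed.

Lemma isd_derivable f x a : is_derive x 1 f a -> derivable f x 1.
Proof. by move=> fa; apply: ex_derive. Qed.

Lemma isd_derive1 f x a : is_derive x 1 f a -> derive1 f x = a.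
Proof. by move=> fa; rewrite derive1E derive_val. Qed.

Lemma isd_continuous f x a : is_derive x 1 f a -> continuous_at x f.
Proof.
by move=> /isd_derivable /derivable1_diffP; exact: differentiable_continuous.
Qed.

Lemma derivable_isd f x : derivable f x 1 -> is_derive x 1 f (derive1 f x).
Proof. by move=> fx; rewrite derive1E; apply/derivableP. Qed.

Lemma derivable_continuous f : (forall x : R, derivable f x 1) -> continuous f.
Proof. by move=> df x; exact: isd_continuous (derivable_isd (df x)). Qed.

Lemma bounded_derive_lipschitz f (df : R -> R) (C x y : R) :
  (forall z : R, is_derive z 1 f (df z)) -> (forall z : R, `|df z| <= C) ->
  `|f y - f x| <= C * `|y - x|.
Proof.
move=> fdf dfC; wlog xy : x y / x <= y.
  move=> H; have [/H//|/ltW/H] := leP x y.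
  by rewrite distrC (distrC x).
have [|c _ ->] := MVT_segment xy (fun z _ => fdf z).
  by apply: continuous_subspaceT => z; exact: isd_continuous (fdf z).
by rewrite normrM ler_wpM2r.
Qed.

End RealCalculus.

(** * Sobolev norms of smooth functions with quartic decay *)

Section WeightedIntegrals.
Context {R : realType}.
Notation mu := (@lebesgue_measure R).
Implicit Types (f phi chi : R -> R) (D : set R).

(** The basic weight, 1 / (1 + x^2). Decay is measured by its square: one factor
    is spent on integrability, the other one on the size of tails and on a
    factor |x| from differentiating the Fourier integral. *)
Definition wt (x : R) : R := (oneDsqr x)^-1.

Lemma wt_gt0 x : 0 < wt x.
Proof. by rewrite invr_gt0 (lt_le_trans ltr01 (oneDsqr_ge1 x)). Qed.

Lemma wt_ge0 x : 0 <= wt x. Proof. exact/ltW/wt_gt0. Qed.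

Lemma wt_le1 x : wt x <= 1. Proof. exact: oneDsqrV_le1. Qed.

Lemma wtN x : wt (- x) = wt x. Proof. by rewrite /wt /oneDsqr sqrrN. Qed.

Lemma decay_ge0 f (M : R) : (forall x : R, `|f x| <= M * wt x ^+ 2) -> 0 <= M.
Proof.
move=> /(_ 0); rewrite /wt /oneDsqr expr0n/= addr0 invr1 expr1n mulr1.
exact: le_trans (normr_ge0 _).
Qed.

Lemma continuous_wt : continuous wt. Proof. exact: continuous_oneDsqrV. Qed.

Lemma measurable_wt : measurable_fun setT wt.
Proof. exact: continuous_measurable_fun continuous_wt. Qed.

Lemma integral_wt : (\int[mu]_x (wt x)%:E = pi%:E)%E.
Proof.
rewrite ge0_symfun_integralT; last 3 first.
- exact: wt_ge0.
- exact: continuous_wt.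
- by move=> x; rewrite /= wtN.
rewrite -set_itvcy integral0y_oneDsqr -EFinM mulrC divfK ?pnatr_eq0//.
Qed.

Lemma integrable_wt D : measurable D -> mu.-integrable D (EFin \o wt).
Proof.
move=> mD; apply: (@integrableS _ _ _ _ setT) => //.
apply/integrableP; split; first by apply/measurable_EFinP; exact: measurable_wt.
under eq_integral do rewrite /= ger0_norm ?wt_ge0//.
by rewrite integral_wt ltry.
Qed.

Lemma integrable_dom f (M : R) D : measurable D -> measurable_fun setT f ->
  (forall x, `|f x| <= M * wt x) -> mu.-integrable D (EFin \o f).
Proof.
move=> mD mf fM; apply: (@le_integrable _ _ _ mu _ mD _ (EFin \o (fun x => M * wt x))).
- apply/measurable_EFinP; exact: measurable_funS mf.
- move=> x _ /=; rewrite lee_fin; apply: le_trans (fM x) _; exact: ler_norm.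
- rewrite (_ : _ \o _ = (fun x => M%:E * (EFin \o wt) x)%E); last first.
    by apply/funext => x /=; rewrite EFinM.
  exact: integrableZl (integrable_wt mD).
Qed.

Lemma Rintegral_wt : \int[mu]_x wt x = pi.
Proof. by rewrite /Rintegral integral_wt. Qed.

Lemma le_Rintegral_wt f (M : R) : measurable_fun setT f ->
  (forall x, `|f x| <= M * wt x) -> `|\int[mu]_x f x| <= M * pi.
Proof.
move=> mf fM; have intf := integrable_dom measurableT mf fM.
apply: le_trans (le_normr_Rintegral measurableT intf) _.
rewrite -Rintegral_wt -RintegralZl//; last exact: integrable_wt.
apply: le_Rintegral => //.
- by apply: integrable_abse intf.
- apply: (@integrable_dom _ M) => //.
    by apply: measurable_funM => //; exact: measurable_wt.
  move=> x; rewrite normrM (ger0_norm (wt_ge0 x)) ler_wpM2r ?wt_ge0//.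
  rewrite ger0_norm// -(pmulr_lge0 _ (wt_gt0 x)).
  exact: le_trans (normr_ge0 _) (fM x).
Qed.

Lemma Rintegral_tail f (M n : R) : 0 <= n -> measurable_fun setT f ->
  (forall x, `|f x| <= M * wt x ^+ 2) ->
  `|\int[mu]_(x in `[- n, n]) f x - \int[mu]_x f x| <= M * pi * wt n.
Proof.
move=> n0 mf fM.
have M0 := decay_ge0 fM.
have fM1 x : `|f x| <= M * wt x.
  apply: le_trans (fM x) _; rewrite ler_wpM2l// expr2 ler_piMl ?wt_ge0//.
  exact: wt_le1.
have mg : measurable_fun setT (f \_ `[- n, n]).
  by apply/(measurable_restrictT f) => //; exact: measurable_funS mf.
have gM x : `|(f \_ `[- n, n]) x| <= M * wt x.
  rewrite patchE; case: ifPn => // _.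
  by rewrite normr0 mulr_ge0// wt_ge0.
rewrite Rintegral_mkcond -RintegralB//; last 2 first.
- exact: integrable_dom gM.
- exact: integrable_dom fM1.
rewrite -mulrA (mulrC pi) mulrA; apply: le_Rintegral_wt.
  exact: measurable_funB.
move=> x; rewrite patchE; case: ifPn => [_|].
  by rewrite subrr normr0 mulr_ge0 ?wt_ge0// mulr_ge0// wt_ge0.
rewrite notin_setE/= in_itv/= => /negP xn; rewrite sub0r normrN.
apply: le_trans (fM x) _; rewrite -mulrA ler_wpM2l// expr2 ler_wpM2r ?wt_ge0//.
rewrite lef_pV2 ?posrE ?(lt_le_trans ltr01 (oneDsqr_ge1 _))//.
rewrite lerD2l -[n ^+ 2]real_normK ?num_real// -[x ^+ 2]real_normK ?num_real//.
rewrite lerXn2r ?nnegrE//.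
move: xn; rewrite -ler_norml -ltNge => /ltW; rewrite (ger0_norm n0); exact.
Qed.

Lemma cvg_wt_nat : wt (n%:R) @[n --> \oo] --> (0 : R).
Proof.
apply: (@squeeze_cvgr _ _ _ _ (fun=> 0) (fun n => n.+1%:R^-1)); last 2 first.
- exact: cvg_cst.
- exact: cvg_harmonic.
near=> n; have n0 : (0 < n)%N by near: n; exists 1%N.
rewrite wt_ge0/= lef_pV2 ?posrE ?ltr0n//.
  rewrite /oneDsqr -natrX -nat1r lerD2l ler_nat -[leqLHS]muln1 leq_mul//.
Unshelve. all: by end_near. Qed.

End WeightedIntegrals.

(** Here phi is a primitive of xi * chi, where chi and phi are, up to sign, the
    cosine and the sine of x * xi; treating them together halves the
    integrations by parts. *)
Section Parts.
Context {R : realType}.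
Notation mu := (@lebesgue_measure R).
Variables (f phi chi : R -> R) (M xi : R).
Hypothesis df : forall x : R, derivable f x 1.
Hypothesis cf' : continuous (derive1 f).
Hypothesis fM : forall x : R, `|f x| <= M * wt x ^+ 2.
Hypothesis f'M : forall x : R, `|derive1 f x| <= M * wt x ^+ 2.
Hypothesis dphi : forall x : R, is_derive x 1 phi (xi * chi x).
Hypothesis cchi : continuous chi.
Hypothesis phi1 : forall x, `|phi x| <= 1.
Hypothesis chi1 : forall x, `|chi x| <= 1.

Let cf : continuous f := derivable_continuous df.

Let cphi : continuous phi.
Proof. by move=> x; exact: isd_continuous (dphi x). Qed.

Let M0 : 0 <= M := decay_ge0 fM.

Lemma mul_bounded_decay g h : (forall x : R, `|g x| <= M * wt x ^+ 2) ->
  (forall x : R, `|h x| <= 1) -> forall x : R, `|g x * h x| <= M * wt x ^+ 2.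
Proof.
move=> gM h1 x; rewrite normrM -[leRHS]mulr1; apply: ler_pM => //.
Qed.

Lemma parts_segment (n : R) : 0 < n ->
  xi * \int[mu]_(x in `[- n, n]) (f x * chi x) =
  f n * phi n - f (- n) * phi (- n) -
  \int[mu]_(x in `[- n, n]) (derive1 f x * phi x).
Proof.
move=> n0; rewrite -RintegralZl//; last first.
  apply: continuous_compact_integrable; first exact: segment_compact.
  by apply: continuous_subspaceT => x; apply: continuousM; [exact: cf|exact: cchi].
have lrc (g : R -> R) : (forall x : R, derivable g x 1) ->
    derivable_oo_LRcontinuous g (- n) n.
  move=> dg; have cg := derivable_continuous dg.
  split; first by move=> x _; exact: dg.
  - exact: cvg_at_right_filter (cg _).
  - exact: cvg_at_left_filter (cg _).
rewrite -(@Rintegration_by_parts _ f phi (derive1 f) (fun x => xi * chi x)).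
- by apply: eq_Rintegral => x _; ring.
- lra.
- exact: continuous_subspaceT.
- exact: lrc.
- by [].
- apply: continuous_subspaceT => x; apply: continuousM; first exact: cvg_cst.
  exact: cchi.
- by apply: lrc => x; exact: isd_derivable (dphi x).
- by move=> x _; exact: isd_derive1 (dphi x).
Qed.

Let mfchi : measurable_fun setT (fun x => f x * chi x).
Proof. by apply: measurable_funM; exact: continuous_measurable_fun. Qed.

Let mf'phi : measurable_fun setT (fun x => derive1 f x * phi x).
Proof. by apply: measurable_funM; exact: continuous_measurable_fun. Qed.

Let bd n : `|f n * phi n - f (- n) * phi (- n)| <= M * 2 * wt n.
Proof.
have fw x : `|f x * phi x| <= M * wt x.
  apply: le_trans (mul_bounded_decay fM phi1 x) _.
  by rewrite ler_wpM2l// expr2 ler_piMl ?wt_ge0// wt_le1.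
apply: le_trans (ler_normB _ _) _.
have := fw n; have := fw (- n); rewrite wtN.
set A := `| _ |; set B := `| _ |; set c := M * wt n => *.
by rewrite -mulrA (mulrC 2) mulrA -/c; lra.
Qed.

Lemma parts_line :
  xi * \int[mu]_x (f x * chi x) = - \int[mu]_x (derive1 f x * phi x).
Proof.
apply/eqP; rewrite -subr_eq0 opprK -normr_eq0 eq_le normr_ge0 andbT.
set X := `| _ |; pose C := `|xi| * (M * pi) + M * pi + M * 2.
have XC n : (0 < n)%N -> X <= C * wt (n%:R).
  move=> n0; have n0' : 0 < n%:R :> R by rewrite ltr0n.
  have := parts_segment n0'.
  have := Rintegral_tail (ltW n0') mfchi (mul_bounded_decay fM chi1).
  have := Rintegral_tail (ltW n0') mf'phi (mul_bounded_decay f'M phi1).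
  have := bd n%:R; rewrite /X.
  set b := f _ * _ - _; set i1 := Rintegral _ _ _; set i2 := Rintegral _ _ _.
  set j1 := Rintegral _ _ _; set j2 := Rintegral _ _ _ => hb h1 h2 e.
  have -> : xi * j2 + i2 = - (xi * (j1 - j2)) - (i1 - i2) + b.
    by rewrite mulrBr e; ring.
  rewrite !mulrDl; apply: le_trans (ler_normD _ _) _; apply: lerD => //.
  apply: le_trans (ler_normB _ _) _; apply: lerD => //.
  by rewrite normrN normrM -mulrA ler_wpM2l.
have : C * wt (n%:R) @[n --> \oo] --> C * (0 : R).
  by apply: cvgM; [exact: cvg_cst|exact: cvg_wt_nat].
rewrite mulr0 => /cvgr_to_ge; apply; near=> n; apply: XC.
by near: n; exists 1%N.
Unshelve. all: by end_near. Qed.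

(** The factor xi on the truncation error is what makes the error square
    integrable in xi; integration by parts moves it to f at the price of
    boundary terms, which decay in n. *)
Lemma parts_tail (n : nat) : (0 < n)%N ->
  `|xi * (\int[mu]_(x in `[- n%:R, n%:R]) (f x * chi x)
          - \int[mu]_x (f x * chi x))| <= M * (2 + pi) * wt n%:R.
Proof.
move=> n0; have n0' : 0 < n%:R :> R by rewrite ltr0n.
rewrite mulrBr parts_line (parts_segment n0') opprK -addrA.
have := Rintegral_tail (ltW n0') mf'phi (mul_bounded_decay f'M phi1).
have := bd n%:R.
set b := f _ * _ - _; set i1 := Rintegral _ _ _; set i2 := Rintegral _ _ _ => hb h.
rewrite mulrDr mulrDl; apply: le_trans (ler_normD _ _) _; apply: lerD => //.
by rewrite -normrN opprD opprK.
Qed.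

End Parts.

Section Fourier.
Context {R : realType}.
Notation mu := (@lebesgue_measure R).
Implicit Types (f g : R -> R) (M xi : R).

Definition fourier_cos f (xi : R) : R := \int[mu]_x (f x * cos (x * xi)).
Definition fourier_sin f (xi : R) : R := \int[mu]_x (f x * sin (x * xi)).

Lemma isd_cosx xi (x : R) :
  is_derive x 1 (fun x => cos (x * xi)) (xi * - sin (x * xi)).
Proof.
apply: isd_eq (isd_cos (isdM (isd_id x) (isd_cst xi x))) _; ring.
Qed.

Lemma isd_sinx xi (x : R) :
  is_derive x 1 (fun x => sin (x * xi)) (xi * cos (x * xi)).
Proof.
apply: isd_eq (isd_sin (isdM (isd_id x) (isd_cst xi x))) _; ring.
Qed.

Lemma continuous_cosx xi : continuous (fun x : R => cos (x * xi)).
Proof. by move=> x; exact: isd_continuous (isd_cosx xi x). Qed.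

Lemma continuous_sinx xi : continuous (fun x : R => sin (x * xi)).
Proof. by move=> x; exact: isd_continuous (isd_sinx xi x). Qed.

Lemma cos_lip (a b : R) : `|cos a - cos b| <= `|a - b|.
Proof.
rewrite -[leRHS]mul1r; apply: (bounded_derive_lipschitz (df := fun x => - sin x)).
by move=> z; rewrite normrN; exact: sin_max.
Qed.

Lemma sin_lip (a b : R) : `|sin a - sin b| <= `|a - b|.
Proof.
rewrite -[leRHS]mul1r; apply: (bounded_derive_lipschitz (df := @cos R)).
by move=> z; exact: cos_max.
Qed.

(** The factor of the weight left after integration pays for the Lipschitz
    constant |x| of the kernel in xi. It is applied with cos and sin for trig. *)
Lemma continuous_transform f M (trig : R -> R) :
  measurable_fun setT f -> (forall x : R, `|f x| <= M * wt x ^+ 2) ->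
  continuous trig -> (forall a, `|trig a| <= 1) ->
  (forall a b, `|trig a - trig b| <= `|a - b|) ->
  continuous (fun xi => \int[mu]_x (f x * trig (x * xi))).
Proof.
move=> mf fM ctrig trig1 triglip.
have M0 := decay_ge0 fM.
have ct xi : continuous (fun x : R => trig (x * xi)).
  move=> x; apply: (@continuous_comp _ _ _ (fun x : R => x * xi)); last exact: ctrig.
  exact: mulrr_continuous.
have mt xi : measurable_fun setT (fun x => f x * trig (x * xi)).
  by apply: measurable_funM => //; exact: continuous_measurable_fun.
have ib xi : mu.-integrable setT (EFin \o (fun x => f x * trig (x * xi))).
  apply: (@integrable_dom _ _ M) => // x.
  apply: le_trans (mul_bounded_decay fM (h := fun x => trig (x * xi)) _ x) _ => //.
  by rewrite ler_wpM2l// expr2 ler_piMl ?wt_ge0// wt_le1.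
have lip a b : `|\int[mu]_x (f x * trig (x * a)) - \int[mu]_x (f x * trig (x * b))|
    <= M * pi * `|a - b|.
  rewrite -RintegralB// -mulrA (mulrC pi) mulrA; apply: le_Rintegral_wt.
    exact: measurable_funB.
  move=> x; rewrite -mulrBr normrM.
  apply: le_trans (ler_pM (normr_ge0 _) (normr_ge0 _) (fM x) (triglip _ _)) _.
  rewrite -mulrBr normrM expr2 [leRHS]mulrAC -!mulrA ler_wpM2l// ler_wpM2l ?wt_ge0//.
  rewrite mulrA ler_piMl//.
  rewrite mulrC ler_pdivrMr ?mul1r ?(lt_le_trans ltr01 (oneDsqr_ge1 _))//.
  rewrite /oneDsqr -[x ^+ 2]real_normK ?num_real//.
  have := sqr_ge0 (`|x| - 1); have := normr_ge0 x; nra.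
move=> a; apply/cvgrPdist_lt => e e0.
pose d := e / (M * pi + 1).
have D0 : 0 < M * pi + 1 by rewrite ltr_wpDl// mulr_ge0// pi_ge0.
near=> b.
apply: le_lt_trans (lip _ _) _.
apply: (@le_lt_trans _ _ ((M * pi + 1) * `|a - b|)).
  by rewrite ler_wpM2r// lerDl.
rewrite mulrC -ltr_pdivlMr//.
near: b; apply: cvgr_dist_lt; [exact: cvg_id|exact: divr_gt0].
Unshelve. all: by end_near. Qed.

Lemma Lnorm2_bound (h : R -> R) (B : R) : measurable_fun setT h ->
  (forall x, h x ^+ 2 <= B * wt x) ->
  (L2norm h <= (Num.sqrt (B * pi))%:E)%E.
Proof.
move=> mh hB.
have B0 : 0 <= B.
  have := hB 0; rewrite /wt /oneDsqr expr0n/= addr0 invr1 mulr1.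
  exact: le_trans (sqr_ge0 _).
rewrite /L2norm unlock /Lnorm -powR12_sqrt ?mulr_ge0 ?pi_ge0// -poweR_EFin.
apply: gt0_ler_poweR; rewrite ?in_itv/= ?leey ?andbT ?lee_fin ?mulr_ge0 ?pi_ge0//.
  by apply: integral_ge0 => x _; rewrite lee_fin powR_ge0.
rewrite EFinM -integral_wt -ge0_integralZl_EFin//; last 2 first.
- by move=> x _; rewrite lee_fin wt_ge0.
- by apply/measurable_EFinP; exact: measurable_wt.
apply: ge0_le_integral => //.
- apply/measurable_EFinP.
  apply: (@measurableT_comp _ _ _ _ _ _ (fun x : R => x `^ 2)) => //.
  exact: measurableT_comp.
- apply/measurable_EFinP; apply: measurable_funM => //; exact: measurable_wt.
- move=> x _ /=; rewrite -EFinM lee_fin powR_mulrn//.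
  by rewrite real_normK ?num_real.
Qed.

Lemma sqint_bound (h : R -> R) (B : R) : measurable_fun setT h ->
  (forall x, h x ^+ 2 <= B * wt x) -> square_integrable h.
Proof.
move=> mh hB; rewrite /square_integrable inE; apply/andP; split.
  by rewrite inE.
rewrite inE/= /finite_norm; apply: le_lt_trans (Lnorm2_bound mh hB) _.
exact: ltry.
Qed.

End Fourier.

Section SobolevBound.
Context {R : realType}.
Notation mu := (@lebesgue_measure R).
Implicit Types (f g : R -> R) (M xi : R).

Definition smooth f := forall n (x : R), derivable (derive1n n f) x 1.

Lemma smooth_derive1 f : smooth f -> smooth (derive1 f).
Proof. by move=> sf n x; rewrite -derive1Sn; exact: sf. Qed.

Lemma smooth_continuous f n : smooth f -> continuous (derive1n n f).
Proof. by move=> sf; exact: derivable_continuous (sf n). Qed.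

Lemma trunc_sub (f : R -> R) M (trig : R -> R) (n : nat) xi :
  measurable_fun setT f -> (forall x : R, `|f x| <= M * wt x ^+ 2) ->
  continuous trig -> (forall a, `|trig a| <= 1) ->
  `|\int[mu]_(x in `[- n%:R, n%:R]) (f x * trig (x * xi))
    - \int[mu]_x (f x * trig (x * xi))| <= M * pi * wt n%:R.
Proof.
move=> mf fM ctrig trig1; apply: Rintegral_tail => //.
- apply: measurable_funM => //; apply: continuous_measurable_fun.
  move=> x; apply: (@continuous_comp _ _ _ (fun x : R => x * xi)); last exact: ctrig.
  exact: mulrr_continuous.
- by apply: (mul_bounded_decay (h := fun x => trig (x * xi))).
Qed.

(** Bounding d and xi * d together gives decay of d^2 like 1 / (1 + xi^2). *)
Lemma sq_weight_bound (d A w xi : R) : `|d| <= A -> `|xi * d| <= A ->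
  d ^+ 2 <= 2 * A ^+ 2 * wt xi.
Proof.
move=> h1 h2; rewrite ler_pdivlMr ?(lt_le_trans ltr01 (oneDsqr_ge1 _))//.
have e1 : d ^+ 2 <= A ^+ 2.
  by rewrite -[d ^+ 2]real_normK ?num_real// lerXn2r ?nnegrE// (le_trans _ h1).
have e2 : (xi * d) ^+ 2 <= A ^+ 2.
  by rewrite -[leLHS]real_normK ?num_real// lerXn2r ?nnegrE// (le_trans _ h1).
move: e1 e2; rewrite /oneDsqr exprMn; lra.
Qed.

Section Transform.
Variables (f : R -> R) (M : R).
Hypothesis sf : smooth f.
Hypothesis fM : forall x : R, `|f x| <= M * wt x ^+ 2.
Hypothesis f'M : forall x : R, `|derive1 f x| <= M * wt x ^+ 2.

Let cf : continuous f := smooth_continuous (n := 0) sf.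
Let cf' : continuous (derive1 f) := smooth_continuous (n := 1) sf.
Let mf : measurable_fun setT f := continuous_measurable_fun cf.
Let df : forall x : R, derivable f x 1. Proof. by move=> x; exact: (@sf 0%N x). Qed.
Let M0 : 0 <= M := decay_ge0 fM.

Lemma fourier_cos_derive xi : xi * fourier_cos f xi = - fourier_sin (derive1 f) xi.
Proof.
rewrite /fourier_cos (parts_line df cf' fM f'M (@isd_sinx _ xi)) //.
- exact: continuous_cosx.
- by move=> x; exact: sin_max.
- by move=> x; exact: cos_max.
Qed.

Let isd_cosx' xi (x : R) :
  is_derive x 1 (fun x => - cos (x * xi)) (xi * sin (x * xi)).
Proof. by apply: isd_eq (isdN (isd_cosx xi x)) _; ring. Qed.

Lemma fourier_sin_derive xi : xi * fourier_sin f xi = fourier_cos (derive1 f) xi.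
Proof.
rewrite /fourier_sin (parts_line df cf' fM f'M (@isd_cosx' xi)) //.
- rewrite /fourier_cos -[RHS]opprK; congr (- _); rewrite -mulN1r -RintegralZl//.
    by apply: eq_Rintegral => x _; ring.
  apply: (@integrable_dom _ _ M) => //.
    exact: measurable_funM (continuous_measurable_fun cf')
             (continuous_measurable_fun (@continuous_cosx _ xi)).
  move=> x; apply: le_trans (mul_bounded_decay f'M (h := fun x => cos (x * xi)) _ x) _ => //.
    by move=> y; exact: cos_max.
  by rewrite ler_wpM2l// expr2 ler_piMl ?wt_ge0// wt_le1.
- exact: continuous_sinx.
- by move=> x; rewrite normrN; exact: cos_max.
- by move=> x; exact: sin_max.
Qed.

Let c0 : R := (Num.sqrt (2 * pi))^-1.

Lemma c0_ge0 : 0 <= c0. Proof. by rewrite invr_ge0 sqrtr_ge0. Qed.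

Lemma c0_le1 : c0 <= 1.
Proof.
have h : (1 : R) <= 2 * pi by have := @pi_ge2 R; lra.
have h0 := lt_le_trans ltr01 h.
rewrite invf_le1 ?sqrtr_gt0// -[leLHS]sqrtr1; exact: ler_wsqrtr.
Qed.

Let A (n : nat) : R := M * (2 + pi) * wt n%:R.

Lemma trunc_cos_sub (n : nat) xi : (0 < n)%N ->
  (trunc_fourier_re f n xi - c0 * fourier_cos f xi) ^+ 2 <= 2 * A n ^+ 2 * wt xi.
Proof.
move=> n0; rewrite /trunc_fourier_re -/c0 -mulrBr; apply: sq_weight_bound => //.
- rewrite normrM ger0_norm ?c0_ge0// -[leRHS]mul1r ler_pM ?c0_ge0 ?c0_le1//.
  apply: le_trans (trunc_sub n xi mf fM (@continuous_cos _) (@cos_max _)) _.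
  by rewrite ler_wpM2r ?wt_ge0// ler_wpM2l// lerDr.
- rewrite mulrCA normrM ger0_norm ?c0_ge0// -[leRHS]mul1r ler_pM ?c0_ge0 ?c0_le1//.
  apply: (parts_tail df cf' fM f'M (@isd_sinx _ xi) _ _ _ n0).
  + exact: continuous_cosx.
  + by move=> x; exact: sin_max.
  + by move=> x; exact: cos_max.
Qed.

Lemma trunc_sin_sub (n : nat) xi : (0 < n)%N ->
  (trunc_fourier_im f n xi + c0 * fourier_sin f xi) ^+ 2 <= 2 * A n ^+ 2 * wt xi.
Proof.
move=> n0; rewrite /trunc_fourier_im -/c0 addrC -mulrBr; apply: sq_weight_bound => //.
- rewrite normrM ger0_norm ?c0_ge0// -[leRHS]mul1r ler_pM ?c0_ge0 ?c0_le1//.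
  rewrite distrC; apply: le_trans (trunc_sub n xi mf fM (@continuous_sin _) (@sin_max _)) _.
  by rewrite ler_wpM2r ?wt_ge0// ler_wpM2l// lerDr.
- rewrite mulrCA normrM ger0_norm ?c0_ge0// -[leRHS]mul1r ler_pM ?c0_ge0 ?c0_le1//.
  rewrite -opprB mulrN normrN.
  apply: (parts_tail df cf' fM f'M (@isd_cosx' xi) _ _ _ n0).
  + exact: continuous_sinx.
  + by move=> x; rewrite normrN; exact: cos_max.
  + by move=> x; exact: sin_max.
Qed.

Let cFc : continuous (fourier_cos f).
Proof. exact: continuous_transform mf fM (@continuous_cos _) (@cos_max _) (@cos_lip _). Qed.

Let cFs : continuous (fourier_sin f).
Proof. exact: continuous_transform mf fM (@continuous_sin _) (@sin_max _) (@sin_lip _). Qed.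

Lemma measurable_trunc (trig : R -> R) (n : nat) :
  continuous trig -> (forall a, `|trig a| <= 1) ->
  (forall a b, `|trig a - trig b| <= `|a - b|) ->
  measurable_fun setT
    (fun xi => \int[mu]_(x in `[- n%:R, n%:R]) (f x * trig (x * xi))).
Proof.
move=> ct t1 tl; apply: continuous_measurable_fun.
have -> : (fun xi : R => \int[mu]_(x in `[- n%:R, n%:R]) (f x * trig (x * xi))) =
    (fun xi => \int[mu]_x ((f \_ `[- n%:R, n%:R]) x * trig (x * xi))).
  apply/funext => xi; rewrite Rintegral_mkcond; apply: eq_Rintegral => x _.
  by rewrite !patchE; case: ifPn => // _; rewrite mul0r.
apply: (@continuous_transform _ _ M) => //.
- by apply/(measurable_restrictT f) => //; exact: measurable_funS mf.
- move=> x; rewrite patchE; case: ifPn => // _.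
  by rewrite normr0 mulr_ge0// exprn_ge0// wt_ge0.
Qed.

Let cvgA (h : nat -> R -> R) : (forall n, measurable_fun setT (h n)) ->
  (forall n xi, (0 < n)%N -> (h n xi) ^+ 2 <= 2 * A n ^+ 2 * wt xi) ->
  (fun n => L2norm (h n)) @ \oo --> 0%E.
Proof.
move=> mh hA.
apply: (@squeeze_cvge _ _ _ _ (fun=> 0%E) _ (fun n => (Num.sqrt (2 * A n ^+ 2 * pi))%:E)).
- near=> n; rewrite Lnorm_ge0/=; apply: Lnorm2_bound => // xi; apply: hA.
  by near: n; exists 1%N.
- exact: cvg_cst.
- apply: cvg_EFin; first by apply: nearW.
  have -> : (fine \o (fun n => (Num.sqrt (2 * A n ^+ 2 * pi))%:E)) =
     (fun n : nat => Num.sqrt (2 * pi) * (M * (2 + pi)) * wt n%:R).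
    apply/funext => n /=.
    rewrite mulrAC sqrtrM ?mulr_ge0 ?pi_ge0// sqrtr_sqr ger0_norm ?mulrA//.
    by rewrite /A !mulr_ge0 ?wt_ge0// addr_ge0// pi_ge0.
  rewrite -(mulr0 (Num.sqrt (2 * pi) * (M * (2 + pi)))).
  by apply: cvgM; [exact: cvg_cst|exact: cvg_wt_nat].
Unshelve. all: by end_near. Qed.

(** The truncated transforms converge pointwise at the rate wt n, and so do they
    after multiplication by xi; by [sq_weight_bound] the convergence holds in
    L^2. *)
Lemma is_fourier_transform (B : R) :
  (forall xi, fourier_cos f xi ^+ 2 <= B * wt xi) ->
  (forall xi, fourier_sin f xi ^+ 2 <= B * wt xi) ->
  is_fourier f (fun xi => c0 * fourier_cos f xi) (fun xi => - (c0 * fourier_sin f xi)).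
Proof.
move=> cB sB.
have mc : measurable_fun setT (fun xi => c0 * fourier_cos f xi).
  by apply: measurable_funM => //; exact: continuous_measurable_fun.
have ms : measurable_fun setT (fun xi => - (c0 * fourier_sin f xi)).
  apply: measurableT_comp => //.
  by apply: measurable_funM => //; exact: continuous_measurable_fun.
have le1 (y z : R) : y ^+ 2 <= z -> (c0 * y) ^+ 2 <= z.
  move=> yz; rewrite exprMn; apply: le_trans yz; rewrite ler_piMl ?sqr_ge0//.
  by rewrite expr_le1 ?c0_ge0 ?c0_le1.
split.
- apply: (@sqint_bound _ _ (M ^+ 2)) => // x.
  rewrite -[leLHS]real_normK ?num_real//.
  apply: (@le_trans _ _ ((M * wt x ^+ 2) ^+ 2)).
    by rewrite lerXn2r ?nnegrE// mulr_ge0// exprn_ge0// wt_ge0.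
  rewrite exprMn ler_wpM2l ?sqr_ge0// -exprM.
  by rewrite -[leRHS]expr1 ler_wiXn2l ?wt_ge0 ?wt_le1.
- by apply: (@sqint_bound _ _ B) => // x; apply: le1.
- by apply: (@sqint_bound _ _ B) => // x; rewrite sqrrN; apply: le1.
- apply: cvgA => [n|n xi n0]; last exact: trunc_cos_sub.
  apply: measurable_funB => //; apply: measurable_funM => //.
  by apply: measurable_trunc; [exact: continuous_cos|exact: cos_max|exact: cos_lip].
- apply: cvgA => [n|n xi n0]; last by rewrite /= opprK; exact: trunc_sin_sub.
  apply: measurable_funB => //; apply: measurableT_comp => //; apply: measurable_funM => //.
  by apply: measurable_trunc; [exact: continuous_sin|exact: sin_max|exact: sin_lip].
Qed.

End Transform.
End SobolevBound.

Section SobolevNorm.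
Context {R : realType}.
Notation mu := (@lebesgue_measure R).
Implicit Types (f g : R -> R) (M eps xi : R).

Lemma fourier_sup f M xi : continuous f ->
  (forall x : R, `|f x| <= M * wt x ^+ 2) ->
  `|fourier_cos f xi| <= M * pi /\ `|fourier_sin f xi| <= M * pi.
Proof.
move=> cf fM; have M0 := decay_ge0 fM.
have fw (trig : R -> R) : (forall x, `|trig x| <= 1) -> forall x, `|f x * trig x| <= M * wt x.
  move=> t1 x; apply: le_trans (mul_bounded_decay fM t1 x) _.
  by rewrite ler_wpM2l// expr2 ler_piMl ?wt_ge0// wt_le1.
split; apply: le_Rintegral_wt.
- exact: measurable_funM (continuous_measurable_fun cf)
             (continuous_measurable_fun (@continuous_cosx _ xi)).
- by apply: (fw (fun x => cos (x * xi))) => x; exact: cos_max.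
- exact: measurable_funM (continuous_measurable_fun cf)
             (continuous_measurable_fun (@continuous_sinx _ xi)).
- by apply: (fw (fun x => sin (x * xi))) => x; exact: sin_max.
Qed.

(** Each power of xi becomes a derivative of f. *)
Lemma fourier_pow n f M xi : smooth f ->
  (forall j, (j <= n)%N -> forall x : R, `|derive1n j f x| <= M * wt x ^+ 2) ->
  `|xi| ^+ n * `|fourier_cos f xi| <= M * pi /\
  `|xi| ^+ n * `|fourier_sin f xi| <= M * pi.
Proof.
elim: n f => [|n IHn] f sf fM.
  rewrite expr0 !mul1r; apply: fourier_sup; first exact: (smooth_continuous (n := 0%N) sf).
  exact: (fM 0%N).
have fM0 := fM 0%N (leq0n _); have fM1 := fM 1%N (ltn0Sn _).
have [|ihc ihs] := IHn (derive1 f) (smooth_derive1 sf).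
  by move=> j jn x; rewrite -derive1Sn; exact: fM.
rewrite !exprSr -!mulrA -!normrM.
rewrite (fourier_cos_derive sf fM0 fM1) (fourier_sin_derive sf fM0 fM1).
by rewrite normrN.
Qed.

Lemma expD1_le (y : R) P : 0 <= y -> (1 + y) ^+ P <= 2 ^+ P * (1 + y ^+ P).
Proof.
move=> y0; have [y1|/ltW y1] := leP y 1.
  apply: (@le_trans _ _ (2 ^+ P * 1)).
    by rewrite mulr1 lerXn2r ?nnegrE//; lra.
  by rewrite ler_wpM2l ?exprn_ge0// lerDl exprn_ge0.
apply: (@le_trans _ _ ((2 * y) ^+ P)).
  by rewrite lerXn2r ?nnegrE//; lra.
by rewrite exprMn ler_wpM2l ?exprn_ge0// lerDr.
Qed.

(** In F^2 one factor is bounded by eps without weight, and the other one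
    absorbs the whole weight, which the derivatives of order up to 2 P pay for. *)
Lemma weighted_transform_bound (F E eps M xi : R) P :
  0 <= F -> eps <= M -> F <= eps -> `|xi| ^+ (2 * P) * F <= M ->
  (1 + xi ^+ 2) ^+ P * F ^+ 2 <= 2 ^+ P.+1 * (eps * M).
Proof.
move=> F0 eM Fe FM.
have e0 := le_trans F0 Fe; have M0 := le_trans e0 eM.
rewrite exprM real_normK ?num_real// in FM.
have x20 := sqr_ge0 xi.
apply: (@le_trans _ _ (2 ^+ P * (1 + (xi ^+ 2) ^+ P) * F ^+ 2)).
  by rewrite ler_wpM2r ?sqr_ge0// expD1_le.
rewrite [2 ^+ P.+1]exprSr -!mulrA ler_wpM2l ?exprn_ge0//.
rewrite mulrDl mul1r expr2 mulrA (mulrDl 1 1) mul1r; apply: lerD.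
  by apply: ler_pM => //; exact: le_trans eM.
by rewrite mulrC; apply: ler_pM => //; rewrite mulr_ge0// exprn_ge0.
Qed.

(** An interpolation inequality: smallness is required of f alone, and the order
    of the derivatives affects only the constants. *)
Lemma Hnorm_le (s : R) : exists (N : nat) (C : R), 0 <= C /\
  forall f eps M, smooth f -> eps <= M ->
    (forall x : R, `|f x| <= eps * wt x ^+ 2) ->
    (forall j, (j <= N)%N -> forall x : R, `|derive1n j f x| <= M * wt x ^+ 2) ->
    (Hnorm s f <= (C * Num.sqrt (eps * M))%:E)%E.
Proof.
have [P0 sP0] : exists P : nat, s <= P%:R.
  exists (Num.truncn `|s|).+1; apply: le_trans (ler_norm s) _.
  by apply: ltW; have /andP[] := truncn_itv (normr_ge0 s).
(* One power of 1 + xi^2 beyond the weight of H^s makes the integral converge. *)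
pose P := P0.+1.
pose B0 : R := 2 ^+ P.+1 * pi ^+ 2.
have B00 : 0 <= B0 by rewrite mulr_ge0 ?exprn_ge0// pi_ge0.
exists (2 * P)%N, (Num.sqrt (2 * B0 * pi)); split; first exact: sqrtr_ge0.
move=> f eps M sf eM fe fM.
have fM0 := fM 0%N (leq0n _); have fM1 := fM 1%N (leq_trans (ltn0Sn _) (leq_pmulr _ (ltn0Sn _))).
have e0 := decay_ge0 fe; have M0 := decay_ge0 fM0.
have cf : continuous f by exact: (smooth_continuous (n := 0%N) sf).
have key xi F : `|F| <= eps * pi -> `|xi| ^+ (2 * P) * `|F| <= M * pi ->
    (1 + xi ^+ 2) ^+ P * F ^+ 2 <= B0 * (eps * M).
  move=> h1 h2; rewrite -[F ^+ 2]real_normK ?num_real//.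
  apply: le_trans (weighted_transform_bound _ _ _ h1 h2) _ => //.
    by rewrite ler_wpM2r// pi_ge0.
  by rewrite /B0 le_eqVlt; apply/orP; left; apply/eqP; ring.
clearbody B0.
have D0 (xi : R) : 0 < 1 + xi ^+ 2 := lt_le_trans ltr01 (oneDsqr_ge1 xi).
have keyc xi : (1 + xi ^+ 2) ^+ P * fourier_cos f xi ^+ 2 <= B0 * (eps * M).
  apply: key; first by have [] := fourier_sup xi cf fe.
  by have [] := fourier_pow xi sf fM.
have keys xi : (1 + xi ^+ 2) ^+ P * fourier_sin f xi ^+ 2 <= B0 * (eps * M).
  apply: key; first by have [] := fourier_sup xi cf fe.
  by have [] := fourier_pow xi sf fM.
have toB (F xi : R) : (1 + xi ^+ 2) ^+ P * F ^+ 2 <= B0 * (eps * M) ->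
    F ^+ 2 <= B0 * (eps * M) * wt xi.
  move=> h; rewrite /wt ler_pdivlMr ?D0//; apply: le_trans h.
  rewrite mulrC ler_wpM2r ?sqr_ge0// /oneDsqr -[leLHS]expr1 ler_weXn2l//.
  by rewrite lerDl sqr_ge0.
have isf := is_fourier_transform sf fM0 fM1 (fun xi => toB _ _ (keyc xi))
  (fun xi => toB _ _ (keys xi)).
set c0 := (Num.sqrt (2 * pi))^-1 in isf.
have c01 : c0 ^+ 2 <= 1 by rewrite expr_le1 ?c0_ge0 ?c0_le1//.
apply: (@le_trans _ _ ((\int[mu]_xi
            ((1 + xi ^+ 2) `^ s * ((c0 * fourier_cos f xi) ^+ 2
              + (- (c0 * fourier_sin f xi)) ^+ 2))%:E) `^ 2^-1)%E).
  by apply: ereal_inf_lbound; exists (fun xi => c0 * fourier_cos f xi),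
    (fun xi => - (c0 * fourier_sin f xi)).
have -> : Num.sqrt (2 * B0 * pi) * Num.sqrt (eps * M) =
    (2 * B0 * (eps * M) * pi) `^ 2^-1.
  have pi0 := pi_ge0 R.
  rewrite powR12_sqrt; last by rewrite !mulr_ge0.
  rewrite -sqrtrM; last by rewrite !mulr_ge0.
  by congr Num.sqrt; ring.
have pt xi : (1 + xi ^+ 2) `^ s * ((c0 * fourier_cos f xi) ^+ 2
              + (- (c0 * fourier_sin f xi)) ^+ 2) <= 2 * B0 * (eps * M) * wt xi.
  apply: (@le_trans _ _ ((1 + xi ^+ 2) ^+ P0 * (fourier_cos f xi ^+ 2 + fourier_sin f xi ^+ 2))).
    rewrite sqrrN !exprMn -mulrDr; apply: ler_pM.
    - exact: powR_ge0.
    - by rewrite mulr_ge0 ?sqr_ge0 ?addr_ge0 ?sqr_ge0.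
    - rewrite -[leRHS]powR_mulrn; last exact: ltW.
      apply: ler_powR => //.
      by rewrite lerDl sqr_ge0.
    - by rewrite ler_piMl// addr_ge0 ?sqr_ge0.
  rewrite /wt ler_pdivlMr ?D0// /oneDsqr mulrAC -exprSr mulrDr.
  by have := keyc xi; have := keys xi; rewrite -/P; lra.
rewrite -poweR_EFin; apply: gt0_ler_poweR; rewrite ?in_itv/= ?leey ?andbT ?lee_fin ?mulr_ge0 ?pi_ge0//.
  apply: integral_ge0 => xi _; rewrite lee_fin mulr_ge0 ?powR_ge0// addr_ge0 ?sqr_ge0//.
rewrite EFinM -integral_wt -ge0_integralZl_EFin//; last 3 first.
- by move=> x _; rewrite lee_fin wt_ge0.
- by apply/measurable_EFinP; exact: measurable_wt.
- by rewrite !mulr_ge0.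
have mtr (trig : R -> R) : continuous trig -> (forall a, `|trig a| <= 1) ->
  (forall a b, `|trig a - trig b| <= `|a - b|) ->
  measurable_fun setT (fun xi => \int[mu]_x (f x * trig (x * xi))).
  move=> ct t1 tl; apply: continuous_measurable_fun.
  exact: continuous_transform (continuous_measurable_fun cf) fM0 ct t1 tl.
have mc := mtr _ (@continuous_cos _) (@cos_max _) (@cos_lip _).
have ms := mtr _ (@continuous_sin _) (@sin_max _) (@sin_lip _).
apply: ge0_le_integral => //.
- move=> xi _; rewrite lee_fin mulr_ge0 ?powR_ge0// addr_ge0 ?sqr_ge0//.
- apply/measurable_EFinP; apply: measurable_funM.
    apply: (@measurableT_comp _ _ _ _ _ _ (fun x : R => x `^ s)) => //.
    exact: continuous_measurable_fun (@continuous_oneDsqr _).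
  apply: measurable_funD; apply: measurable_funX.
    exact: measurable_funM.
  by apply: measurableT_comp => //; exact: measurable_funM.
- by apply/measurable_EFinP; apply: measurable_funM => //; exact: measurable_wt.
- by move=> xi _; rewrite -EFinM lee_fin.
Qed.

End SobolevNorm.

(** * Positive definite matrices and the linear system *)

(** The sum of the absolute values of the entries: a submultiplicative norm that
    makes sense for rectangular matrices. *)
Section MatrixNorm.
Context {R : realType}.

Definition mnrm m n (A : 'M[R]_(m, n)) : R := \sum_i \sum_j `|A i j|.

Lemma mnrm_ge0 m n (A : 'M[R]_(m, n)) : 0 <= mnrm A.
Proof. by apply: sumr_ge0 => i _; apply: sumr_ge0. Qed.

Lemma mnrm0 m n : mnrm (0 : 'M[R]_(m, n)) = 0.
Proof. by rewrite /mnrm big1// => i _; rewrite big1// => j _; rewrite mxE normr0. Qed.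

Lemma mnrmN m n (A : 'M[R]_(m, n)) : mnrm (- A) = mnrm A.
Proof. by apply: eq_bigr => i _; apply: eq_bigr => j _; rewrite mxE normrN. Qed.

Lemma mnrmD m n (A B : 'M[R]_(m, n)) : mnrm (A + B) <= mnrm A + mnrm B.
Proof.
rewrite /mnrm -big_split/=; apply: ler_sum => i _.
by rewrite -big_split/=; apply: ler_sum => j _; rewrite mxE ler_normD.
Qed.

Lemma mnrmB m n (A B : 'M[R]_(m, n)) : mnrm (A - B) <= mnrm A + mnrm B.
Proof. by rewrite -(mnrmN B) mnrmD. Qed.

Lemma mnrm_tr m n (A : 'M[R]_(m, n)) : mnrm A^T = mnrm A.
Proof.
rewrite /mnrm exchange_big; apply: eq_bigr => i _.
by apply: eq_bigr => j _; rewrite mxE.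
Qed.

Lemma le_mnrm m n (A : 'M[R]_(m, n)) i j : `|A i j| <= mnrm A.
Proof.
rewrite /mnrm (bigD1 i)//= (bigD1 j)//= -addrA lerDl addr_ge0//.
  exact: sumr_ge0.
by apply: sumr_ge0 => ? _; apply: sumr_ge0.
Qed.

Lemma mnrmM m n p (A : 'M[R]_(m, n)) (B : 'M[R]_(n, p)) :
  mnrm (A *m B) <= mnrm A * mnrm B.
Proof.
apply: (@le_trans _ _ (\sum_i \sum_j \sum_k `|A i k| * `|B k j|)).
  apply: ler_sum => i _; apply: ler_sum => j _; rewrite mxE.
  apply: le_trans (ler_norm_sum _ _ _) _.
  by apply: ler_sum => k _; rewrite normrM.
rewrite [leRHS]mulr_suml; apply: ler_sum => i _.
rewrite exchange_big/= mulr_suml; apply: ler_sum => k _.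
rewrite -mulr_sumr ler_wpM2l//.
rewrite /mnrm (bigD1 k)//= lerDl.
by apply: sumr_ge0 => ? _; apply: sumr_ge0.
Qed.

Lemma mnrmM_le m n p (A : 'M[R]_(m, n)) (B : 'M[R]_(n, p)) a b :
  mnrm A <= a -> mnrm B <= b -> mnrm (A *m B) <= a * b.
Proof.
by move=> Aa Bb; apply: le_trans (mnrmM _ _) _; apply: ler_pM => //; exact: mnrm_ge0.
Qed.

Lemma mnrmD_le m n (A B : 'M[R]_(m, n)) a b :
  mnrm A <= a -> mnrm B <= b -> mnrm (A + B) <= a + b.
Proof. by move=> Aa Bb; apply: le_trans (mnrmD _ _) _; exact: lerD. Qed.

Lemma mnrmB_le m n (A B : 'M[R]_(m, n)) a b :
  mnrm A <= a -> mnrm B <= b -> mnrm (A - B) <= a + b.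
Proof. by move=> Aa Bb; apply: le_trans (mnrmB _ _) _; exact: lerD. Qed.

Lemma mnrm_le_entries m n (A : 'M[R]_(m, n)) (c : R) :
  (forall i j, `|A i j| <= c) -> mnrm A <= (m * n)%:R * c.
Proof.
move=> Ac; apply: (@le_trans _ _ (\sum_(i < m) \sum_(j < n) c)).
  by apply: ler_sum => i _; apply: ler_sum => j _.
by rewrite !sumr_const !card_ord -mulrnA mulr_natl mulnC.
Qed.

End MatrixNorm.

Lemma addmxE (R : nmodType) m n (A B : 'M[R]_(m, n)) i j : (A + B) i j = A i j + B i j.
Proof. by rewrite mxE. Qed.

Lemma submxE (R : zmodType) m n (A B : 'M[R]_(m, n)) i j : (A - B) i j = A i j - B i j.
Proof. by rewrite !mxE. Qed.

Section PositiveDefinite.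
Context {R : realType} {n : nat}.
Implicit Types (G D : 'M[R]_n) (y z xi eta f g : 'cV[R]_n).

Definition bform G y z : R := (y^T *m G *m z) 0 0.

Definition posdef G := G^T = G /\ forall y, y != 0 -> 0 < bform G y y.

Lemma tr11 (A : 'M[R]_1) : A^T = A.
Proof. by apply/matrixP => i j; rewrite mxE !ord1. Qed.

Lemma bformC G y z : G^T = G -> bform G y z = bform G z y.
Proof.
by move=> Gs; rewrite /bform -[in LHS](tr11 (_ *m z)) !trmx_mul trmxK Gs mulmxA.
Qed.

Lemma bformBr G y z t : bform G y (z - t) = bform G y z - bform G y t.
Proof. by rewrite /bform mulmxBr !mxE. Qed.

Lemma bformBl G y z t : bform G (y - z) t = bform G y t - bform G z t.
Proof. by rewrite /bform linearB/= !mulmxBl !mxE. Qed.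

Lemma bformZr G y z c : bform G y (c *: z) = c * bform G y z.
Proof. by rewrite /bform -scalemxAr mxE. Qed.

Lemma bformZl G y z c : bform G (c *: y) z = c * bform G y z.
Proof. by rewrite /bform linearZ/= -!scalemxAl mxE. Qed.

Lemma posdef_ge0 G y : posdef G -> 0 <= bform G y y.
Proof.
move=> [_ pG]; have [->|/pG/ltW//] := eqVneq y 0.
by rewrite /bform mulmx0 mxE.
Qed.

Lemma cauchy_schwarz G y z : posdef G ->
  bform G y z ^+ 2 <= bform G y y * bform G z z.
Proof.
move=> pG; have [->|y0] := eqVneq y 0.
  by rewrite /bform trmx0 !mul0mx mxE expr0n/= mul0r.
have q0 : 0 < bform G y y by case: pG => _; apply.
have := posdef_ge0 (bform G y y *: z - bform G y z *: y) pG.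
rewrite !(bformBr, bformBl, bformZr, bformZl) (bformC z y (proj1 pG)) => h.
rewrite -subr_ge0 -(pmulr_rge0 _ q0); apply: le_trans h _.
by rewrite le_eqVlt; apply/orP; left; apply/eqP; ring.
Qed.

Lemma inj_unitmx (A : 'M[R]_n) : (forall y, A *m y = 0 -> y = 0) -> A \in unitmx.
Proof.
move=> Ainj; rewrite -unitmx_tr -row_free_unit -kermx_eq0; apply/eqP/eqP/rowV0P.
move=> v /sub_kermxP vA; apply: trmx_inj; rewrite trmx0; apply: Ainj.
by rewrite -[A]trmxK -trmx_mul vA trmx0.
Qed.

Lemma posdef_unit G : posdef G -> G \in unitmx.
Proof.
move=> [Gs pG]; apply: inj_unitmx => y Gy; apply/eqP/negP => /negP /pG.
by rewrite /bform -mulmxA Gy mulmx0 mxE ltxx.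
Qed.

Lemma posdef_norm G : posdef G ->
  exists2 C : R, 0 <= C & forall y, mnrm y ^+ 2 <= C * bform G y y.
Proof.
move=> pG; have Gu := posdef_unit pG.
pose u (i : 'I_n) := invmx G *m delta_mx i (0 : 'I_1).
pose c := \sum_i bform G (u i) (u i).
have c0 : 0 <= c by apply: sumr_ge0 => i _; exact: posdef_ge0.
exists ((n * 1)%:R ^+ 2 * c); first by rewrite mulr_ge0.
move=> y; have q0 := posdef_ge0 y pG.
have : mnrm y <= (n * 1)%:R * Num.sqrt (c * bform G y y).
  apply: mnrm_le_entries => i j; rewrite ord1 {j}.
  have -> : y i 0 = bform G (u i) y.
    rewrite /bform /u trmx_mul trmx_delta trmx_inv (proj1 pG) mulmxKV//.
    by rewrite -rowE mxE.
  rewrite -sqrtr_sqr; apply: ler_wsqrtr.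
  apply: le_trans (cauchy_schwarz _ _ pG) _; rewrite ler_wpM2r//.
  by rewrite /c (bigD1 i)//= lerDl sumr_ge0// => j _; exact: posdef_ge0.
rewrite -ler_sqr ?nnegrE ?mnrm_ge0 ?mulr_ge0 ?sqrtr_ge0// => /le_trans; apply.
by rewrite exprMn sqr_sqrtr ?mulr_ge0// mulrA.
Qed.

(** The pairing of the first equation with eta and of the second with xi gives
      bform G xi xi + bform G eta eta = eta^T f + xi^T g,
    in which the contributions of the symmetric matrix D cancel. *)
Lemma coercive G : posdef G -> exists2 C : R, 0 <= C &
  forall D xi eta f g, D^T = D ->
    D *m xi + G *m eta = f -> G *m xi - D *m eta = g ->
    mnrm xi + mnrm eta <= C * (mnrm f + mnrm g).
Proof.
move=> pG; have [C C0 hC] := posdef_norm pG.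
exists (2 * C); first by rewrite mulr_ge0.
move=> D xi eta f g Ds ef eg.
have e : bform G xi xi + bform G eta eta = (eta^T *m f) 0 0 + (xi^T *m g) 0 0.
  rewrite -ef -eg mulmxDr mulmxBr !mulmxA addmxE submxE.
  rewrite -/(bform D _ _) -/(bform D _ _) -/(bform G _ _) -/(bform G _ _).
  by rewrite (bformC eta xi Ds); ring.
have le1 (a b : 'cV[R]_n) : (a^T *m b) 0 0 <= mnrm a * mnrm b.
  apply: le_trans (ler_norm _) _; apply: le_trans (le_mnrm _ _ _) _.
  by apply: le_trans (mnrmM _ _) _; rewrite mnrm_tr.
have := hC xi; have := hC eta; have := le1 eta f; have := le1 xi g; move: e.
have := mnrm_ge0 xi; have := mnrm_ge0 eta; have := mnrm_ge0 f; have := mnrm_ge0 g.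
set a := mnrm xi; set b := mnrm eta; set F := mnrm f; set H := mnrm g.
set q1 := bform _ _ _; set q2 := bform _ _ _; set s := (_ *m _) 0 0; set t := (_ *m _) 0 0.
move=> H0 F0 b0 a0 e ht hs h2 h1.
have h : (a + b) ^+ 2 <= 2 * C * ((a + b) * (F + H)).
  have d0 : (a + b) ^+ 2 <= 2 * (a ^+ 2 + b ^+ 2).
    rewrite -subr_ge0; have -> : 2 * (a ^+ 2 + b ^+ 2) - (a + b) ^+ 2 = (a - b) ^+ 2 by ring.
    exact: sqr_ge0.
  have d1 : q1 + q2 <= (a + b) * (F + H).
    have -> : (a + b) * (F + H) = (b * F + a * H) + (a * F + b * H) by ring.
    by rewrite e; apply: ler_wpDr; [rewrite addr_ge0 ?mulr_ge0|exact: lerD].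
  apply: le_trans d0 _; rewrite -mulrA ler_wpM2l//.
  by apply: le_trans (lerD h1 h2) _; rewrite -mulrDr ler_wpM2l.
have [<-|ab0] := eqVneq 0 (a + b).
  by rewrite !mulr_ge0// addr_ge0.
have {}ab0 : 0 < a + b by rewrite lt_neqAle ab0 addr_ge0.
rewrite -(ler_pM2l ab0); apply: le_trans (le_trans h _); first by rewrite expr2.
by rewrite le_eqVlt; apply/orP; left; apply/eqP; ring.
Qed.

End PositiveDefinite.

Section SpectralSystem.
Context {R : realType} {n : nat}.
Implicit Types (G D : 'M[R]_n) (xi eta f g : 'cV[R]_n).

Definition sysmx G D : 'M[R]_(n + n) := block_mx D G G (- D).

Lemma sysmx_unit G D : posdef G -> D^T = D -> sysmx G D \in unitmx.
Proof.
move=> pG Ds; apply: inj_unitmx => y; rewrite -[y]vsubmxK.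
set xi := usubmx y; set eta := dsubmx y.
rewrite /sysmx mul_block_col -[0]vsubmxK => /eq_col_mx [e1 e2].
have [C C0 hC] := coercive pG.
have := hC D xi eta 0 0 Ds.
rewrite mulNmx in e2; rewrite {}e1 {}e2 !linear0 mnrm0 addr0 mulr0 => /(_ erefl erefl) h.
suff z0 (u : 'cV[R]_n) : mnrm u <= 0 -> u = 0.
  have := mnrm_ge0 xi; have := mnrm_ge0 eta => *.
  have -> : xi = 0 by apply: z0; lra.
  have -> : eta = 0 by apply: z0; lra.
  by [].
move=> u0; apply/matrixP => i j; rewrite mxE; apply/eqP; rewrite -normr_le0.
exact: le_trans (le_mnrm _ _ _) u0.
Qed.

Definition sys_sol G D f g := invmx (sysmx G D) *m col_mx f g.
Definition sys_xi G D f g : 'cV[R]_n := usubmx (sys_sol G D f g).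
Definition sys_eta G D f g : 'cV[R]_n := dsubmx (sys_sol G D f g).

Lemma sys_solP G D f g : posdef G -> D^T = D ->
  D *m sys_xi G D f g + G *m sys_eta G D f g = f /\
  G *m sys_xi G D f g - D *m sys_eta G D f g = g.
Proof.
move=> pG Ds; have := mulKVmx (sysmx_unit pG Ds) (col_mx f g).
rewrite -/(sys_sol G D f g) -[X in _ *m X = _]vsubmxK.
by rewrite /sysmx mul_block_col mulNmx => /eq_col_mx.
Qed.

End SpectralSystem.

Ltac mx_expand :=
  rewrite ?(mulmxDl, mulmxDr, mulmxBl, mulmxBr, mulNmx, mulmxN, =^~ scalemxAl, =^~ scalemxAr, mulmxA).

Ltac mx_entries :=
  repeat match goal with |- context [@mulmx ?S ?m ?n ?p ?A ?B] =>
    let v := fresh "v" in set v := (@mulmx S m n p A B); clearbody v end;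
  apply/matrixP => ? ?; rewrite !mxE.

(** Proves identities that hold in every module over a commutative ring once
    matrix products are distributed over sums and treated as atoms. *)
Ltac mx_ring := mx_expand; mx_entries; ring.

Section ParameterDerivative.
Context {R : realType}.

Lemma isd_of_bound (f e : R -> R) (x a : R) : e h @[h --> 0^'] --> (0 : R) ->
  (forall h, h != 0 -> `|h^-1 * (f (h + x) - f x) - a| <= e h) ->
  is_derive x 1 f a.
Proof.
move=> e0 fe.
have cv : (fun h : R => h^-1 *: ((f \o shift x) (h *: (1 : R)) - f x)) @ 0^' --> a.
  have -> : (fun h : R => h^-1 *: ((f \o shift x) (h *: (1 : R)) - f x)) =
      (fun h => h^-1 * (f (h + x) - f x)).
    by apply/funext => h; rewrite /= /GRing.scale/= mulr1.
  apply/cvgrPdist_le => eps eps0.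
  near=> h; rewrite distrC; have h0 : h != 0 by near: h; exact: nbhs_dnbhs_neq.
  apply: le_trans (fe h h0) _; apply: le_trans (ler_norm _) _.
  near: h; move/cvgr0_norm_le : e0; exact.
by apply: DeriveDef; [apply/cvg_ex; exists a|exact: cvg_lim].
Unshelve. all: by end_near. Qed.

Lemma isd_quotient (f : R -> R) (x a : R) : is_derive x 1 f a ->
  h^-1 * (f (h + x) - f x) @[h --> 0^'] --> a.
Proof.
move=> fa; have : derivable f x 1 by exact: isd_derivable fa.
have -> : (fun h : R => h^-1 * (f (h + x) - f x)) =
    (fun h : R => h^-1 *: ((f \o shift x) (h *: (1 : R)) - f x)).
  by apply/funext => h; rewrite /= /GRing.scale/= mulr1.
by move=> /cvg_ex[l lim]; rewrite -(@derive_val _ _ _ _ _ _ _ fa) /derive (cvg_lim _ lim).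
Qed.

Lemma cvg_sum_ord p (g : 'I_p -> R -> R) (l : 'I_p -> R) :
  (forall i, g i h @[h --> 0^'] --> l i) ->
  (\sum_(i < p) g i h) @[h --> 0^'] --> \sum_(i < p) l i.
Proof.
elim: p g l => [|p IHp] g l gl.
  by rewrite big_ord0; under eq_cvg do rewrite big_ord0; exact: cvg_cst.
rewrite big_ord_recr; under eq_cvg do rewrite big_ord_recr.
by apply: cvgD; [apply: IHp|].
Qed.

Lemma cvg_mnrm m n (F : R -> 'M[R]_(m, n)) :
  (forall i j, F h i j @[h --> 0^'] --> (0 : R)) -> mnrm (F h) @[h --> 0^'] --> (0 : R).
Proof.
move=> F0; rewrite /mnrm.
have E : \sum_(i < m) \sum_(j < n) `|0 : R| = 0.
  by rewrite big1// => i _; rewrite big1// => j _; rewrite normr0.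
rewrite -[X in _ --> X]E.
apply: (@cvg_sum_ord m (fun i h => \sum_j `|F h i j|) (fun=> \sum_(j < n) `|0 : R|)) => i.
apply: (@cvg_sum_ord n (fun j h => `|F h i j|) (fun=> `|0 : R|)) => j.
by apply: cvg_norm; exact: F0.
Qed.

Lemma cvg_mulr0 (g : R -> R) (c : R) : g h @[h --> 0^'] --> (0 : R) ->
  c * g h @[h --> 0^'] --> (0 : R).
Proof. by move=> g0; rewrite -[X in _ --> X](mulr0 c); apply: cvgM => //; exact: cvg_cst. Qed.

(** Implicit differentiation. The difference quotient minus the candidate
    derivative solves the system at the shifted parameter with a small
    right-hand side, and [coercive] bounds it uniformly in the parameter. *)
Lemma sys_sol_derive n (G : 'M[R]_n) (a : 'cV[R]_n) (D : R -> 'M[R]_n)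
    (D' : 'M[R]_n) (x : R) (dxi deta : 'cV[R]_n) :
  posdef G -> (forall s, (D s)^T = D s) ->
  (forall i j, is_derive x 1 (fun s => D s i j) (D' i j)) ->
  let xi s := sys_xi G (D s) a 0 in let eta s := sys_eta G (D s) a 0 in
  D x *m dxi + G *m deta = - (D' *m xi x) ->
  G *m dxi - D x *m deta = D' *m eta x ->
  (forall i, is_derive x 1 (fun s => xi s i 0) (dxi i 0)) /\
  (forall i, is_derive x 1 (fun s => eta s i 0) (deta i 0)).
Proof.
move=> pG Ds DD' xi eta e1 e2.
have solP s : D s *m xi s + G *m eta s = a /\ G *m xi s - D s *m eta s = 0.
  exact: sys_solP.
clearbody xi eta.
have [C C0 coer] := coercive pG.
pose DQ h : 'M[R]_n := h^-1 *: (D (h + x) - D x) - D'.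
pose DE h : 'M[R]_n := D (h + x) - D x.
pose Z := mnrm (xi x) + mnrm (eta x); pose dZ := mnrm dxi + mnrm deta.
pose err h := C * (Z * mnrm (DQ h) + dZ * mnrm (DE h)).
have err0 : err h @[h --> 0^'] --> (0 : R).
  apply: cvg_mulr0; rewrite -[X in _ --> X](addr0 0); apply: cvgD; apply: cvg_mulr0.
    apply: cvg_mnrm => i j; rewrite /DQ -[X in _ --> X](subrr (D' i j)).
    under eq_cvg do rewrite !mxE.
    apply: cvgB; last exact: cvg_cst.
    exact: (isd_quotient (DD' i j)).
  apply: cvg_mnrm => i j; rewrite /DE -[X in _ --> X](subrr (D x i j)).
  under eq_cvg do rewrite !mxE.
  apply: cvgB; last exact: cvg_cst.
  have cD := isd_continuous (DD' i j).
  have sh : h + x @[h --> 0^'] --> x.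
    rewrite -[X in _ --> X]add0r; apply: cvgD; last exact: cvg_cst.
    exact: cvg_within.
  exact: (@cvg_comp _ _ _ (fun h => h + x) (fun s => D s i j) _ _ _ sh cD).
have key h : h != 0 ->
    mnrm (h^-1 *: (xi (h + x) - xi x) - dxi) +
    mnrm (h^-1 *: (eta (h + x) - eta x) - deta) <= err h.
  move=> h0.
  have [a1 a2] := solP x; have [b1 b2] := solP (h + x).
  apply: le_trans (coer (D (h + x)) _ _ (- (DQ h *m xi x) - DE h *m dxi)
     (DQ h *m eta x + DE h *m deta) (Ds _) _ _) _; last first.
  - rewrite /err ler_wpM2l//.
    apply: (@le_trans _ _ ((mnrm (DQ h) * mnrm (xi x) + mnrm (DE h) * mnrm dxi) +
       (mnrm (DQ h) * mnrm (eta x) + mnrm (DE h) * mnrm deta))).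
      apply: lerD; last by apply: mnrmD_le; exact: mnrmM.
      by apply: mnrmB_le; [rewrite mnrmN|]; exact: mnrmM.
    by rewrite /Z /dZ le_eqVlt; apply/orP; left; apply/eqP; ring.
  - rewrite /DQ /DE; mx_expand.
    have -> : G *m xi (h + x) = D (h + x) *m eta (h + x) by apply/eqP; rewrite -subr_eq0 b2.
    have -> : G *m xi x = D x *m eta x by apply/eqP; rewrite -subr_eq0 a2.
    have -> : G *m dxi = D' *m eta x + D x *m deta by rewrite -e2 subrK.
    by mx_ring.
  - rewrite /DQ /DE; mx_expand.
    have -> : D (h + x) *m xi (h + x) = a - G *m eta (h + x) by rewrite -b1 addrK.
    have -> : D x *m dxi = - (D' *m xi x) - G *m deta by rewrite -e1 addrK.
    have -> : D x *m xi x = a - G *m eta x by rewrite -a1 addrK.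
    by mx_ring.
have quot (z : R -> 'cV[R]_n) (dz : 'cV[R]_n) (i : 'I_n) :
    (forall h, h != 0 -> mnrm (h^-1 *: (z (h + x) - z x) - dz) <= err h) ->
    is_derive x 1 (fun s => z s i 0) (dz i 0).
  move=> zerr; apply: (isd_of_bound err0) => h h0.
  by apply: le_trans (zerr h h0); have := le_mnrm (h^-1 *: (z (h + x) - z x) - dz) i 0; rewrite !mxE.
split=> i; apply: quot => h h0; apply: le_trans (key h h0).
- by rewrite lerDl mnrm_ge0.
- by rewrite lerDr mnrm_ge0.
Qed.

End ParameterDerivative.

(** * The solution formula *)

Section SpectralFlow.
Context {R : realType} {n : nat}.

(** The matrix D carries the norming constants: it evolves linearly, and all the
    nonlinearity of the equation comes from solving the system. The rank one
    right-hand side in the Lyapunov equation is what turns K G into - G K^T up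
    to a multiple of a. *)
Record spectral_data (K : 'M[R]_n) (a : 'cV[R]_n) (G : 'M[R]_n)
    (D : R -> R -> 'M[R]_n) : Prop := SpectralData {
  sd_posdef : posdef G;
  sd_lyapunov : K *m G + G *m K^T = a *m a^T;
  sd_sym : forall t x, (D t x)^T = D t x;
  sd_comm : forall t x, K *m D t x = D t x *m K^T;
  sd_dx : forall (t x : R) i j, is_derive x 1 (fun y => D t y i j) ((- (K *m D t x)) i j);
  sd_dt : forall (t x : R) i j, is_derive t 1 (fun s => D s x i j)
            ((K *m (K *m (K *m D t x))) i j) }.

Definition spec_xi (a : 'cV[R]_n) (G : 'M[R]_n) (D : R -> R -> 'M[R]_n) (t x : R) : 'cV[R]_n :=
  sys_xi G (D t x) a 0.
Definition spec_eta (a : 'cV[R]_n) (G : 'M[R]_n) (D : R -> R -> 'M[R]_n) (t x : R) : 'cV[R]_n :=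
  sys_eta G (D t x) a 0.
Definition potential (a : 'cV[R]_n) (G : 'M[R]_n) (D : R -> R -> 'M[R]_n) (t x : R) : R :=
  (a^T *m spec_xi a G D t x) 0 0.

Variables (K : 'M[R]_n) (a : 'cV[R]_n) (G : 'M[R]_n) (D : R -> R -> 'M[R]_n).
Hypothesis sd : spectral_data K a G D.

Local Notation xi := (spec_xi a G D).
Local Notation eta := (spec_eta a G D).
Local Notation v := (potential a G D).

Let pG := sd_posdef sd.

Lemma spec_eq1 t x : D t x *m xi t x + G *m eta t x = a.
Proof. by have [] := sys_solP a 0 pG (sd_sym sd t x). Qed.

Lemma spec_eq2 t x : G *m xi t x = D t x *m eta t x.
Proof.
by have [_ /eqP] := sys_solP a 0 pG (sd_sym sd t x); rewrite subr_eq0 => /eqP.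
Qed.

Lemma outer_mul (z : 'cV[R]_n) : a *m a^T *m z = (a^T *m z) 0 0 *: a.
Proof.
rewrite -mulmxA [a^T *m z]mx11_scalar mul_mx_scalar; congr (_ *: _).
by rewrite !mxE eqxx mulr1n.
Qed.

Lemma GKt (z : 'cV[R]_n) : G *m (K^T *m z) = (a^T *m z) 0 0 *: a - K *m (G *m z).
Proof.
by rewrite -outer_mul -(sd_lyapunov sd) mulmxDl !mulmxA addrAC subrr add0r.
Qed.

Lemma DKt t x (z : 'cV[R]_n) : D t x *m (K^T *m z) = K *m (D t x *m z).
Proof. by rewrite !mulmxA (sd_comm sd). Qed.

(** The spatial half of the Lax pair. Both right-hand sides are checked against
    the differentiated system; the terms in v come from the rank one defect of
    the Lyapunov equation. *)
Lemma spec_dx (t x : R) :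
  (forall i, is_derive x 1 (fun y => xi t y i 0)
     ((K^T *m xi t x - v t x *: eta t x) i 0)) /\
  (forall i, is_derive x 1 (fun y => eta t y i 0) ((v t x *: xi t x) i 0)).
Proof.
apply: (@sys_sol_derive R n G a (D t) (- (K *m D t x)) x
  (K^T *m xi t x - v t x *: eta t x) (v t x *: xi t x)) => //.
- exact: sd_sym sd t.
- exact: sd_dx sd t x.
- have e1 := spec_eq1 t x; have e2 := spec_eq2 t x.
  rewrite -/(spec_xi a G D t x) mulmxBr DKt -!scalemxAr e2 subrK.
  by rewrite mulNmx opprK mulmxA.
- have e1 := spec_eq1 t x; have e2 := spec_eq2 t x.
  rewrite -/(spec_eta a G D t x) mulmxBr GKt -!scalemxAr e2 -/(potential a G D t x).
  have -> : G *m eta t x = a - D t x *m xi t x by rewrite -[X in X - _]e1 addrAC subrr add0r.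
  by mx_ring.
Qed.

Lemma isd_row (r : 'rV[R]_n) (z : R -> 'cV[R]_n) (dz : 'cV[R]_n) (x : R) :
  (forall i, is_derive x 1 (fun s => z s i 0) (dz i 0)) ->
  is_derive x 1 (fun s => (r *m z s) 0 0) ((r *m dz) 0 0).
Proof.
move=> zdz; rewrite mxE; apply: isd_ext (fun s => esym (mxE _ _ _ _)) _.
by apply: isd_sum => i; apply: isdZ.
Qed.

(** Moments of xi and eta against a^T (K^T)^j. An x-derivative raises the moment
    by one up to terms of lower order, so the derivatives of v are polynomials
    in the moments. *)
Definition mom (j : nat) : 'rV[R]_n := iter j (fun r => r *m K^T) a^T.
Definition mxi j t x : R := (mom j *m xi t x) 0 0.
Definition meta j t x : R := (mom j *m eta t x) 0 0.

Lemma mxi_dx j (t x : R) :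
  is_derive x 1 (mxi j t) (mxi j.+1 t x - v t x * meta j t x).
Proof.
have [dxi deta] := spec_dx t x; apply: isd_eq (isd_row (mom j) dxi) _.
by rewrite mulmxBr -scalemxAr mulmxA submxE [X in _ - X]mxE.
Qed.

Lemma meta_dx j (t x : R) : is_derive x 1 (meta j t) (v t x * mxi j t x).
Proof.
have [dxi deta] := spec_dx t x; apply: isd_eq (isd_row (mom j) deta) _.
by rewrite -scalemxAr mxE.
Qed.

Let v_mxi t x : v t x = mxi 0 t x. Proof. by []. Qed.

(** The x-derivatives of v of order 1, 2 and 3. *)
Definition pot1 t x := mxi 1 t x - v t x * meta 0 t x.
Definition pot2 t x := mxi 2 t x - v t x * meta 1 t x - pot1 t x * meta 0 t x - v t x ^+ 3.
Definition pot3 t x := mxi 3 t x - v t x * meta 2 t x - pot1 t x * meta 1 t x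
  - v t x ^+ 2 * mxi 1 t x - pot2 t x * meta 0 t x - 4 * v t x ^+ 2 * pot1 t x.

Lemma pot_dx (t x : R) : is_derive x 1 (v t) (pot1 t x).
Proof. exact: (mxi_dx 0). Qed.

Lemma pot1_dx (t x : R) : is_derive x 1 (pot1 t) (pot2 t x).
Proof.
apply: isd_eq (isdB (mxi_dx 1 t x) (isdM (pot_dx t x) (meta_dx 0 t x))) _.
by rewrite /pot2 -v_mxi; ring.
Qed.

Lemma pot2_dx (t x : R) : is_derive x 1 (pot2 t) (pot3 t x).
Proof.
apply: isd_eq (isdB (isdB (isdB (mxi_dx 2 t x) (isdM (pot_dx t x) (meta_dx 1 t x)))
  (isdM (pot1_dx t x) (meta_dx 0 t x))) (isdX3 (pot_dx t x))) _.
by rewrite /pot3 -v_mxi; ring.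
Qed.

(** The coefficient v_xx + 2 v^3 in the evolution of the system in time. *)
Definition potq t x := pot2 t x + 2 * v t x ^+ 3.

Definition xi_t t x : 'cV[R]_n :=
  - (K^T *m (K^T *m (K^T *m xi t x))) + v t x *: (K^T *m (K^T *m eta t x))
  + pot1 t x *: (K^T *m eta t x) - v t x ^+ 2 *: (K^T *m xi t x)
  + potq t x *: eta t x.

Definition eta_t t x : 'cV[R]_n :=
  - (v t x *: (K^T *m (K^T *m xi t x))) + pot1 t x *: (K^T *m xi t x)
  + v t x ^+ 2 *: (K^T *m eta t x) - potq t x *: xi t x.

(** The temporal half of the Lax pair. The right-hand sides are polynomials of
    degree 3 in K^T whose coefficients are found by matching powers of K^T in
    the system differentiated in t. *)
Lemma spec_dt (t x : R) :
  (forall i, is_derive t 1 (fun s => xi s x i 0) (xi_t t x i 0)) /\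
  (forall i, is_derive t 1 (fun s => eta s x i 0) (eta_t t x i 0)).
Proof.
have e1 := spec_eq1 t x; have e2 := spec_eq2 t x.
have e1' : G *m eta t x = a - D t x *m xi t x by rewrite -[X in X - _]e1 addrAC subrr add0r.
have m0 : (a^T *m xi t x) 0 0 = v t x by [].
have n0 : (a^T *m eta t x) 0 0 = meta 0 t x by [].
have m1 : (a^T *m (K^T *m xi t x)) 0 0 = mxi 1 t x by rewrite mulmxA.
have n1 : (a^T *m (K^T *m eta t x)) 0 0 = meta 1 t x by rewrite mulmxA.
have m2 : (a^T *m (K^T *m (K^T *m xi t x))) 0 0 = mxi 2 t x by rewrite !mulmxA.
apply: (@sys_sol_derive R n G a (fun s => D s x) (K *m (K *m (K *m D t x))) t
  (xi_t t x) (eta_t t x)) => //.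
- by move=> s; exact: sd_sym sd s x.
- exact: sd_dt sd t x.
- rewrite -/(spec_xi a G D t x) /xi_t /eta_t.
  rewrite !(mulmxDr, mulmxBr, mulmxN, =^~ scalemxAr).
  rewrite !(DKt, GKt, e2, e1', m0, n0, m1, n1, m2, mulmxBr, =^~ scalemxAr) /potq /pot2 /pot1.
  by mx_ring.
- rewrite -/(spec_eta a G D t x) /xi_t /eta_t.
  rewrite !(mulmxDr, mulmxBr, mulmxN, =^~ scalemxAr).
  rewrite !(DKt, GKt, e2, e1', m0, n0, m1, n1, m2, mulmxBr, =^~ scalemxAr) /potq /pot2 /pot1.
  by mx_ring.
Qed.

Definition pot_t t x : R := - (pot3 t x + 6 * v t x ^+ 2 * pot1 t x).

(** The equation v_t + v_xxx + 6 v^2 v_x = 0, as an identity between polynomials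
    in the moments. *)
Lemma pot_dt (t x : R) : is_derive t 1 (fun s => v s x) (pot_t t x).
Proof.
have [dxi _] := spec_dt t x; apply: isd_eq (isd_row a^T dxi) _.
rewrite /xi_t !(mulmxDr, mulmxBr, mulmxN, =^~ scalemxAr) !mulmxA.
have -> (A B C E F : 'M[R]_1) (p q r s : R) :
    (- A + p *: B + q *: C - r *: E + s *: F) 0 0 =
    - A 0 0 + p * B 0 0 + q * C 0 0 - r * E 0 0 + s * F 0 0 by rewrite !mxE.
rewrite -[a^T *m K^T *m K^T *m K^T]/(mom 3) -[a^T *m K^T *m K^T]/(mom 2).
rewrite -[a^T *m K^T]/(mom 1) -[a^T]/(mom 0).
rewrite -!/(mxi _ _ _) -!/(meta _ _ _) /pot_t /pot3 /potq /pot2 /pot1; ring.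
Qed.

End SpectralFlow.

Section SpectralSolution.
Context {R : realType} {n : nat}.
Variables (K : 'M[R]_n) (a : 'cV[R]_n) (G : 'M[R]_n) (D : R -> R -> 'M[R]_n).
Hypothesis sd : spectral_data K a G D.

Local Notation xi := (spec_xi a G D).
Local Notation eta := (spec_eta a G D).
Local Notation v := (potential a G D).

Definition mkdv_wave (t x : R) : R := Num.sqrt 2 * v t x.

Theorem mkdv_wave_solution (I : set R) : mKdV_solution_on I mkdv_wave.
Proof.
move=> t x _.
have d0 (y : R) : is_derive y 1 (mkdv_wave t) (Num.sqrt 2 * pot1 K a G D t y).
  exact: isdZ (pot_dx sd t y).
have d1 (y : R) : is_derive y 1 (fun z => Num.sqrt 2 * pot1 K a G D t z)
    (Num.sqrt 2 * pot2 K a G D t y) by exact: isdZ (pot1_dx sd t y).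
have d2 (y : R) : is_derive y 1 (fun z => Num.sqrt 2 * pot2 K a G D t z)
    (Num.sqrt 2 * pot3 K a G D t y) by exact: isdZ (pot2_dx sd t y).
have e1 : derive1n 1 (mkdv_wave t) = (fun z => Num.sqrt 2 * pot1 K a G D t z).
  by apply/funext => y; exact: isd_derive1 (d0 y).
have e2 : derive1n 2 (mkdv_wave t) = (fun z => Num.sqrt 2 * pot2 K a G D t z).
  by rewrite derive1nS e1; apply/funext => y; exact: isd_derive1 (d1 y).
have dt : is_derive t 1 (fun r => mkdv_wave r x) (Num.sqrt 2 * pot_t K a G D t x).
  exact: isdZ (pot_dt sd t x).
split.
- exact: isd_derivable dt.
- case=> [|[|[|//]]] _.
  + exact: isd_derivable (d0 x).
  + by rewrite e1; exact: isd_derivable (d1 x).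
  + by rewrite e2; exact: isd_derivable (d2 x).
- rewrite (isd_derive1 dt) e2 (isd_derive1 (isdD (d2 x) (isdX3 (d0 x)))).
  rewrite /pot_t /mkdv_wave exprMn.
  have -> : Num.sqrt 2 ^+ 2 = 2 :> R by rewrite sqr_sqrtr.
  ring.
Qed.

(** Polynomials in the entries of xi and eta without a term free of xi. The
    class is stable under x-derivatives, and the factor xi gives all its members
    the decay of xi in x. *)
Inductive dpoly : (R -> R -> R) -> Prop :=
| dpoly0 : dpoly (fun _ _ => 0)
| dpoly_xi i : dpoly (fun t x => xi t x i 0)
| dpolyD f g : dpoly f -> dpoly g -> dpoly (fun t x => f t x + g t x)
| dpolyZ c f : dpoly f -> dpoly (fun t x => c * f t x)
| dpolyM f g : dpoly f -> dpoly g -> dpoly (fun t x => f t x * g t x)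
| dpolyMeta f i : dpoly f -> dpoly (fun t x => f t x * eta t x i 0).

Lemma dpoly_ext f g : (forall t x, f t x = g t x) -> dpoly f -> dpoly g.
Proof. by move=> fg; have -> // : f = g by do 2 apply/funext => ?. Qed.

Lemma dpoly_sum p (F : 'I_p -> R -> R -> R) : (forall i, dpoly (F i)) ->
  dpoly (fun t x => \sum_(i < p) F i t x).
Proof.
elim: p F => [|p IHp] F dF.
  by apply: dpoly_ext dpoly0 => t x; rewrite big_ord0.
apply: dpoly_ext (dpolyD (IHp (fun i => F (widen_ord (leqnSn p) i)) _) (dF ord_max)).
  by move=> t x; rewrite big_ord_recr.
by move=> i; exact: dF.
Qed.

Lemma dpoly_row (r : 'rV[R]_n) : dpoly (fun t x => (r *m xi t x) 0 0).
Proof.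
apply: (@dpoly_ext (fun t x => \sum_i r 0 i * xi t x i 0)).
  by move=> t x; rewrite mxE.
by apply: dpoly_sum => i; apply: dpolyZ; exact: dpoly_xi.
Qed.

Lemma dpoly_dx f : dpoly f -> exists2 g, dpoly g &
  forall t x : R, is_derive x 1 (f t) (g t x).
Proof.
have dxi i : exists2 g, dpoly g & forall t x : R, is_derive x 1 (fun y => xi t y i 0) (g t x).
  exists (fun t x => (row i K^T *m xi t x) 0 0 + -1 * (v t x * eta t x i 0)).
    apply: dpolyD; first exact: dpoly_row.
    by apply: dpolyZ; apply: dpolyMeta; exact: dpoly_row.
  move=> t x; have [h _] := spec_dx sd t x; apply: isd_eq (h i) _.
  by rewrite -row_mul [row _ _ _ _]mxE submxE mulN1r; congr (_ - _); rewrite mxE.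
have deta i (t x : R) : is_derive x 1 (fun y => eta t y i 0) (v t x * xi t x i 0).
  by have [_ h] := spec_dx sd t x; apply: isd_eq (h i) _; rewrite mxE.
elim=> {f} [|i|f g _ [f' df ff'] _ [g' dg gg']|c f _ [f' df ff']
  |f g dpf [f' df ff'] dpg [g' dg gg']|f i dpf [f' df ff']].
- by exists (fun _ _ => 0); [exact: dpoly0|move=> t x; exact: isd_cst].
- exact: dxi.
- exists (fun t x => f' t x + g' t x); first exact: dpolyD.
  by move=> t x; exact: isdD.
- exists (fun t x => c * f' t x); first exact: dpolyZ.
  by move=> t x; exact: isdZ.
- exists (fun t x => f' t x * g t x + f t x * g' t x).
    by apply: dpolyD; exact: dpolyM.
  by move=> t x; exact: isdM.
- exists (fun t x => f' t x * eta t x i 0 + f t x * (v t x * xi t x i 0)).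
    apply: dpolyD; first exact: dpolyMeta.
    by apply: dpolyM => //; apply: dpolyM; [exact: dpoly_row|exact: dpoly_xi].
  by move=> t x; exact: isdM (ff' t x) (deta i t x).
Qed.

Lemma spec_bounded : exists2 C : R, 0 <= C &
  forall t x, mnrm (xi t x) <= C /\ mnrm (eta t x) <= C.
Proof.
have pG := sd_posdef sd; have [C C0 coer] := coercive pG.
exists (C * mnrm a); first by rewrite mulr_ge0 ?mnrm_ge0.
move=> t x; have := coer (D t x) _ _ _ _ (sd_sym sd t x) (spec_eq1 sd t x) _.
move=> /(_ 0); rewrite (spec_eq2 sd) subrr => /(_ erefl).
rewrite mnrm0 addr0 => h; split; apply: le_trans h.
  by rewrite lerDl mnrm_ge0.
by rewrite lerDr mnrm_ge0.
Qed.

Lemma dpoly_bound f : dpoly f -> exists2 C : R, 0 <= C &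
  forall t x, `|f t x| <= C * mnrm (xi t x).
Proof.
have [C0 C00 xieta] := spec_bounded.
elim=> {f} [|i|f g _ [A A0 fA] _ [B B0 gB]|c f _ [A A0 fA]
  |f g _ [A A0 fA] _ [B B0 gB]|f i _ [A A0 fA]].
- by exists 0 => // t x; rewrite normr0 mul0r.
- by exists 1 => // t x; rewrite mul1r le_mnrm.
- exists (A + B); first exact: addr_ge0.
  move=> t x; apply: le_trans (ler_normD _ _) _.
  by rewrite mulrDl; apply: lerD.
- exists (`|c| * A); first by rewrite mulr_ge0.
  by move=> t x; rewrite normrM -mulrA ler_wpM2l.
- exists (A * (B * C0)); first by rewrite !mulr_ge0.
  move=> t x; rewrite normrM mulrAC; apply: ler_pM => //.
  apply: le_trans (gB t x) _; rewrite ler_wpM2l//.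
  by have [] := xieta t x.
- exists (A * C0); first by rewrite mulr_ge0.
  move=> t x; rewrite normrM mulrAC; apply: ler_pM => //.
  apply: le_trans (le_mnrm _ _ _) _.
  by have [] := xieta t x.
Qed.

Lemma wave_derivs j : exists2 f, dpoly f & forall t, derive1n j (mkdv_wave t) = f t.
Proof.
elim: j => [|j [f df wf]].
  by exists mkdv_wave => //; apply: dpolyZ; exact: dpoly_row.
have [g dg fg] := dpoly_dx df; exists g => // t.
by rewrite derive1nS wf; apply/funext => x; exact: isd_derive1 (fg t x).
Qed.

Lemma smooth_wave t : smooth (mkdv_wave t).
Proof.
move=> j x; have [f df wf] := wave_derivs j; have [g dg fg] := dpoly_dx df.
by rewrite wf; exact: isd_derivable (fg t x).
Qed.

Lemma wave_derivs_bound j : exists2 C : R, 0 <= C &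
  forall t x : R, `|derive1n j (mkdv_wave t) x| <= C * mnrm (xi t x).
Proof.
have [f df wf] := wave_derivs j; have [C C0 fC] := dpoly_bound df.
by exists C => // t x; rewrite wf.
Qed.

(** The derivative in time is expressed by the equation through derivatives in
    x, which are bounded. *)
Lemma wave_lipschitz : exists2 C : R, 0 <= C &
  forall t s x : R, `|mkdv_wave t x - mkdv_wave s x| <= C * `|t - s|.
Proof.
have [A A0 hA] := wave_derivs_bound 3; have [B B0 hB] := wave_derivs_bound 1.
have [V V0 hV] := wave_derivs_bound 0; have [C C0 xieta] := spec_bounded.
have sol := @mkdv_wave_solution setT.
exists (A * C + 3 * (V * C) ^+ 2 * (B * C)).
  by rewrite addr_ge0 ?mulr_ge0 ?exprn_ge0 ?mulr_ge0.
move=> t s x; apply: (@bounded_derive_lipschitz _ (fun r => mkdv_wave r x)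
   (fun r => derive1 (fun r => mkdv_wave r x) r)) => z.
  by have [dz _ _] := sol z x I; exact: derivable_isd.
have [_ dx /eqP] := sol z x I; rewrite addr_eq0 => /eqP ->; rewrite normrN.
have /isd_derive1 -> : is_derive x 1
    (fun y => derive1n 2 (mkdv_wave z) y + mkdv_wave z y ^+ 3)
    (derive1n 3 (mkdv_wave z) x + 3 * mkdv_wave z x ^+ 2 * derive1n 1 (mkdv_wave z) x).
  apply: isdD; first exact: (derivable_isd (@smooth_wave z 2%N x)).
  exact: (isdX3 (derivable_isd (@smooth_wave z 0%N x))).
have [xiC _] := xieta z x.
have up c d : 0 <= c -> `|d| <= c * mnrm (xi z x) -> `|d| <= c * C.
  by move=> c0 /le_trans; apply; rewrite ler_wpM2l.
apply: le_trans (ler_normD _ _) _; apply: lerD; first exact: up (hA z x).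
rewrite normrM [`|3 * _|]normrM normrX (ger0_norm (ler0n _ 3)); apply: ler_pM => //.
- rewrite ler_wpM2l// lerXn2r ?nnegrE ?mulr_ge0//; exact: up (hV z x).
- exact: up (hB z x).
Qed.

End SpectralSolution.

(** * Schur complements and decoupling *)

Section Projections.
Context {R : realType} {n : nat}.
Implicit Types (G P : 'M[R]_n).

Definition is_proj P := P^T = P /\ P *m P = P.

Lemma proj_compl P : is_proj P -> is_proj (1%:M - P).
Proof.
move=> [Ps PP]; split; first by rewrite linearB/= trmx1 Ps.
by rewrite mulmxBl mul1mx mulmxBr mulmx1 PP subrr subr0.
Qed.

Lemma sqnorm_gt0 (y : 'cV[R]_n) : y != 0 -> 0 < (y^T *m y) 0 0.
Proof.
move=> y0; rewrite mxE lt_neqAle; apply/andP; split; last first.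
  by apply: sumr_ge0 => i _; rewrite mxE -expr2 sqr_ge0.
rewrite eq_sym psumr_neq0; last by move=> i _; rewrite mxE -expr2 sqr_ge0.
have [i yi] : exists i, y i 0 != 0.
  apply: contrapT => /forallNP h; move/eqP: y0; apply; apply/matrixP => i j.
  by rewrite ord1 mxE; apply/eqP/negPn/negP; exact: h.
apply/hasP; exists i; first exact: mem_index_enum.
by rewrite mxE -expr2 /= exprn_even_gt0.
Qed.

Lemma proj_posdef G P : posdef G -> is_proj P ->
  posdef (P *m G *m P + (1%:M - P)).
Proof.
move=> [Gs Gp] hP; have [Ps PP] := hP; have [Qs QQ] := proj_compl hP.
split.
  by rewrite linearD/= Qs !trmx_mul Ps Gs mulmxA.
move=> y y0.
have -> : bform (P *m G *m P + (1%:M - P)) y y =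
    bform G (P *m y) (P *m y) + (((1%:M - P) *m y)^T *m ((1%:M - P) *m y)) 0 0.
  rewrite /bform mulmxDr mulmxDl addmxE !trmx_mul Ps Qs; congr (_ + _).
    by rewrite !mulmxA.
  by rewrite !mulmxA -(mulmxA y^T (1%:M - P) (1%:M - P)) QQ.
have [Py0|Py0] := eqVneq (P *m y) 0.
  rewrite Py0 {1}/bform mulmx0 mxE add0r; apply: sqnorm_gt0.
  by rewrite mulmxBl mul1mx Py0 subr0.
apply: ltr_pwDl; first exact: Gp.
have [->|/sqnorm_gt0/ltW//] := eqVneq ((1%:M - P) *m y) 0.
by rewrite mulmx0 mxE.
Qed.

(** The inverse of a compressed positive definite matrix, extended by zero. *)
Definition pinv G P : 'M[R]_n := invmx (P *m G *m P + (1%:M - P)) *m P.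

Lemma pinvP G P : posdef G -> is_proj P ->
  [/\ P *m pinv G P = pinv G P, pinv G P *m P = pinv G P,
      P *m G *m pinv G P = P, pinv G P *m G *m P = P & (pinv G P)^T = pinv G P].
Proof.
move=> pG hP; have pT := proj_posdef pG hP; have [Ps PP] := hP.
have [Qs QQ] := proj_compl hP.
rewrite /pinv; set T := _ + _ in pT *; have uT := posdef_unit pT.
have PT : P *m T = P *m G *m P.
  by rewrite mulmxDr mulmxBr mulmx1 PP subrr addr0 !mulmxA PP.
have TP : T *m P = P *m G *m P.
  by rewrite mulmxDl mulmxBl mul1mx PP subrr addr0 -!mulmxA PP.
have PTi : P *m invmx T = invmx T *m P.
  have := congr1 (fun M => invmx T *m M *m invmx T) (etrans PT (esym TP)).
  by rewrite /= !mulmxA mulVmx// mul1mx -!mulmxA mulmxV// mulmx1.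
have PW : P *m (invmx T *m P) = invmx T *m P by rewrite mulmxA PTi -mulmxA PP.
have TW : T *m (invmx T *m P) = P by rewrite mulKVmx.
have PGW : P *m G *m (invmx T *m P) = P.
  by rewrite -[X in _ *m X]PW mulmxA -PT -mulmxA TW PP.
have Ws : (invmx T *m P)^T = invmx T *m P.
  by rewrite trmx_mul trmx_inv Ps (proj1 pT) PTi.
split => //.
- by rewrite -mulmxA PP.
- have := congr1 trmx PGW; rewrite (trmx_mul (P *m G)) Ws (trmx_mul P) Ps (proj1 pG).
  by rewrite [LHS]mulmxA.
Qed.

End Projections.

(** Elimination of the components in the range of PB from the quadratic form of
    G, as seen on the range of Pm. Here W inverts G on the range of PB. The map
    schur_map corrects a vector of the range of Pm by one of the range of PB so
    that G maps the result into the kernel of PB ([schur_BG]). *)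
Section SchurComplement.
Context {R : realType} {n : nat}.
Variables (K : 'M[R]_n) (a : 'cV[R]_n) (G PB Pm : 'M[R]_n).
Hypothesis pG : posdef G.
Hypothesis lyap : K *m G + G *m K^T = a *m a^T.
Hypothesis hB : is_proj PB.
Hypothesis hm : is_proj Pm.
Hypothesis BPm : PB *m Pm = 0.
Hypothesis KB : K *m PB = PB *m K.
Hypothesis Km : K *m Pm = Pm *m K.

Variable W : 'M[R]_n.
Hypothesis PW : PB *m W = W.
Hypothesis WP : W *m PB = W.
Hypothesis PGW : PB *m G *m W = PB.
Hypothesis Ws : W^T = W.

Definition schur_map : 'M[R]_n := Pm - W *m G *m Pm.
Definition schur_vec : 'cV[R]_n := schur_map^T *m a.
Definition schur_gram : 'M[R]_n := Pm *m G *m schur_map.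

Lemma mPB : Pm *m PB = 0.
Proof. by rewrite -[RHS]trmx0 -BPm trmx_mul (proj1 hB) (proj1 hm). Qed.

Lemma schur_mapPm : schur_map *m Pm = schur_map.
Proof. by rewrite /schur_map mulmxBl -!mulmxA (proj2 hm). Qed.

Lemma schur_PmW : Pm *m W = 0.
Proof. by rewrite -[W]PW mulmxA mPB mul0mx. Qed.

Lemma schur_Pmmap : Pm *m schur_map = Pm.
Proof. by rewrite /schur_map mulmxBr (proj2 hm) !mulmxA schur_PmW !mul0mx subr0. Qed.

Lemma schur_BG : PB *m G *m schur_map = 0.
Proof.
by rewrite /schur_map mulmxBr !mulmxA PGW subrr.
Qed.

Lemma schur_WG : W *m G *m schur_map = 0.
Proof.
by rewrite -[W]WP -(mulmxA W) -(mulmxA W) schur_BG mulmx0.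
Qed.

Lemma schur_mapT : schur_map^T = Pm - Pm *m G *m W.
Proof.
have -> : schur_map^T = Pm^T - (W *m G *m Pm)^T by apply/matrixP => i j; rewrite !mxE.
by rewrite !trmx_mul Ws (proj1 hm) (proj1 pG) mulmxA.
Qed.

Lemma schur_gramE : schur_map^T *m G *m schur_map = schur_gram.
Proof.
rewrite schur_mapT !mulmxBl -[Pm *m G *m W *m G]mulmxA -(mulmxA (Pm *m G)) schur_WG.
by rewrite mulmx0 subr0.
Qed.

Lemma schur_gram_sym : schur_gram^T = schur_gram.
Proof. by rewrite -schur_gramE !trmx_mul trmxK (proj1 pG) mulmxA. Qed.

Lemma schur_vecPm : Pm *m schur_vec = schur_vec.
Proof. by rewrite /schur_vec mulmxA -{1}(proj1 hm) -trmx_mul schur_mapPm. Qed.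

Lemma schur_vecE : schur_vec = Pm *m a - Pm *m G *m W *m a.
Proof.
by rewrite /schur_vec schur_mapT mulmxBl.
Qed.

(** Multiply the Lyapunov equation by schur_map on both sides: as K commutes
    with PB, the correction part of schur_map meets G schur_map only through PB
    and drops out. *)
Lemma schur_lyapunov :
  K *m schur_gram + schur_gram *m K^T = schur_vec *m schur_vec^T.
Proof.
have KL : schur_map^T *m K *m G *m schur_map = K *m schur_gram.
  rewrite schur_mapT !mulmxBl -Km -{1}WP.
  have -> : Pm *m G *m (W *m PB) *m K *m G *m schur_map = 0.
    rewrite -!mulmxA (mulmxA PB) -KB -!mulmxA (mulmxA PB G).
    by rewrite schur_BG !mulmx0.
  by rewrite subr0 /schur_gram !mulmxA.
have LK : schur_map^T *m G *m K^T *m schur_map = schur_gram *m K^T.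
  by apply: trmx_inj; rewrite [RHS]trmx_mul schur_gram_sym trmxK -KL !trmx_mul !trmxK (proj1 pG) !mulmxA.
rewrite -KL -LK [in RHS]/schur_vec trmx_mul trmxK.
rewrite [RHS]mulmxA -[schur_map^T *m a *m a^T]mulmxA -lyap mulmxDr mulmxDl.
by rewrite !mulmxA.
Qed.

(** If the reduced vector were 0, the reduced Gram matrix would solve the
    homogeneous Lyapunov equation and vanish, against definiteness of G. *)
Lemma schur_vec_neq0 : (forall X, K *m X + X *m K^T = 0 -> X = 0) ->
  Pm != 0 -> schur_vec != 0.
Proof.
move=> stable; apply: contraNneq => v0.
have := schur_lyapunov; rewrite v0 mul0mx => /stable g0.
have LG0 : schur_map = 0.
  apply/matrixP => i j; rewrite [RHS]mxE.
  have e0 : schur_map *m delta_mx j (0 : 'I_1) = 0.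
    apply/eqP/negP => /negP /(proj2 pG).
    rewrite /bform trmx_mul -!mulmxA (mulmxA G) (mulmxA schur_map^T).
    by rewrite (mulmxA schur_map^T) schur_gramE g0 mul0mx mulmx0 mxE ltxx.
  by have := congr1 (fun M : 'cV_n => M i 0) e0; rewrite -colE !mxE.
by rewrite -schur_Pmmap LG0 mulmx0.
Qed.

End SchurComplement.

(** PB projects onto the objects whose data are small and PS onto those whose
    data are large. The matrices mu and nu are inverse to one another on the
    range of Pm, and mu conjugates the system of one object into the reduced
    one. *)
Section Decoupling.
Context {R : realType} {n : nat}.
Variables (K : 'M[R]_n) (a : 'cV[R]_n) (G PB Pm W mu nu : 'M[R]_n).
Hypothesis pG : posdef G.
Hypothesis hm : is_proj Pm.
Hypothesis PW : PB *m W = W.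
Hypothesis PGW : PB *m G *m W = PB.
Hypothesis Ws : W^T = W.
Hypothesis mua : mu *m a = schur_vec a G Pm W.
Hypothesis gramE : schur_gram G Pm W = mu *m G *m mu^T.
Hypothesis muPm : mu *m Pm = mu.
Hypothesis Pmnu : Pm *m nu^T = nu^T.
Hypothesis numu : mu^T *m nu^T = Pm.

Local Notation L := (schur_map G Pm W).
Let PS := 1%:M - PB - Pm.

Section AtAPoint.
Variables (D Dinv D1 : 'M[R]_n) (p q : 'cV[R]_n).
Hypothesis DDinv : D *m Dinv = 1%:M.
Hypothesis DB : D *m PB = PB *m D.
Hypothesis DS : D *m PS = PS *m D.
Hypothesis Dm : D *m Pm = mu *m D1 *m mu^T.
Hypothesis pm : Pm *m p = p.
Hypothesis qm : Pm *m q = q.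
Hypothesis eq1 : D1 *m p + Pm *m G *m q = Pm *m a.
Hypothesis eq2 : Pm *m G *m p = D1 *m q.

(** The solution (p, q) of the system of one object, carried over by nu and
    extended to the components in the range of PB. *)
Definition lead_xi := L *m nu^T *m p.
Definition lead_eta := W *m a + L *m nu^T *m q.
(** The leading part leaves a residual in the range of PS which is not small. It
    is removed by applying the inverse of D, which is small there. *)
Definition approx_xi := lead_xi + PS *m Dinv *m (a - G *m lead_eta).
Definition approx_eta := lead_eta + PS *m Dinv *m (G *m lead_xi).

Lemma sum_proj (z : 'cV[R]_n) : z = PB *m z + Pm *m z + PS *m z.
Proof. by rewrite /PS !mulmxBl mul1mx; mx_entries; ring. Qed.

Lemma D_lead (z : 'cV[R]_n) : Pm *m z = z ->
  D *m (L *m nu^T *m z) = mu *m D1 *m z - PB *m D *m W *m G *m nu^T *m z.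
Proof.
move=> zm; rewrite /schur_map !mulmxBl mulmxBr; congr (_ - _).
  rewrite !mulmxA Dm -(mulmxA (mu *m D1)) numu -(mulmxA (mu *m D1)) zm //.
rewrite -{1}PW !mulmxA DB; congr (_ *m z).
by rewrite -(mulmxA _ Pm) Pmnu.
Qed.

Lemma G_lead (z : 'cV[R]_n) : Pm *m z = z ->
  G *m (L *m nu^T *m z) = mu *m (Pm *m G *m z) + PS *m (G *m (L *m nu^T *m z)).
Proof.
move=> zm; rewrite {1}[G *m _]sum_proj; congr (_ + _).
have -> : PB *m (G *m (L *m nu^T *m z)) = 0.
  by rewrite !mulmxA (schur_BG _ PGW) !mul0mx.
rewrite add0r !mulmxA -/(schur_gram G Pm W) gramE muPm.
by rewrite -(mulmxA (mu *m G)) numu -(mulmxA (mu *m G)) zm.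
Qed.

Lemma lead_residual :
  a - G *m lead_eta = mu *m D1 *m p + PS *m (a - G *m lead_eta).
Proof.
rewrite {1}[a - _]sum_proj; congr (_ + _).
have -> : PB *m (a - G *m lead_eta) = 0.
  by rewrite /lead_eta mulmxBr !mulmxDr !mulmxA PGW (schur_BG _ PGW) !mul0mx addr0 subrr.
rewrite add0r /lead_eta mulmxBr !mulmxDr !mulmxA -/(schur_gram G Pm W) gramE.
rewrite -(mulmxA (mu *m G)) numu -(mulmxA (mu *m G)) qm opprD addrA.
rewrite -(schur_vecE a pG hm Ws) -mua -{1}muPm -[mu *m G]/(mu *m G) -{2}muPm.
rewrite -!mulmxA -mulmxBr; congr (mu *m _).
by rewrite -eq1 mulmxA addrK.
Qed.

Lemma approx_residual1 :
  D *m approx_xi + G *m approx_eta =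
  a - PB *m D *m W *m G *m nu^T *m p + G *m (PS *m Dinv *m (G *m lead_xi)).
Proof.
rewrite /approx_xi /approx_eta (mulmxDr D lead_xi) (mulmxDr G lead_eta).
rewrite [D *m lead_xi](D_lead pm).
have -> : D *m (PS *m Dinv *m (a - G *m lead_eta)) = PS *m (a - G *m lead_eta).
  by rewrite !mulmxA DS -(mulmxA PS) DDinv mulmx1.
have := lead_residual; move: (G *m lead_eta) => g.
move: (PS *m (a - g)) (mu *m D1 *m p) => s m e.
have -> : g = a - (m + s) by rewrite -e opprB addrC subrK.
mx_entries; ring.
Qed.

Lemma approx_residual2 :
  G *m approx_xi - D *m approx_eta =
  G *m (PS *m Dinv *m (a - G *m lead_eta)) - PB *m D *m W *m a
    + PB *m D *m W *m G *m nu^T *m q.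
Proof.
rewrite /approx_xi /approx_eta (mulmxDr G lead_xi) (mulmxDr D lead_eta).
rewrite [D *m lead_eta]mulmxDr (D_lead qm) {1}[G *m lead_xi](G_lead pm) eq2.
have -> : D *m (PS *m Dinv *m (G *m lead_xi)) = PS *m (G *m lead_xi).
  by rewrite !mulmxA DS -(mulmxA PS) DDinv mulmx1.
have -> : D *m (W *m a) = PB *m D *m W *m a by rewrite -{1}PW !mulmxA DB.
rewrite -/lead_xi (mulmxA mu).
mx_entries; ring.
Qed.

(** The extension and nu cancel against the reduced vector mu a: the leading
    part contributes exactly the potential of the single object. *)
Lemma lead_value : (a^T *m lead_xi) 0 0 = (a^T *m p) 0 0.
Proof.
rewrite /lead_xi !mulmxA.
have -> : a^T *m L = (mu *m a)^T by rewrite mua /schur_vec trmx_mul trmxK.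
by rewrite trmx_mul -(mulmxA a^T) numu -mulmxA pm.
Qed.

End AtAPoint.

(** The residuals of the approximate solution contain PB D or PS Dinv as a
    factor, and [coercive] turns them into an error estimate. *)
Lemma decoupling (C1 : R) : 0 <= C1 -> exists2 C : R, 0 <= C &
  forall (D Dinv D1 : 'M[R]_n) (p q : 'cV[R]_n) (eps : R),
    D^T = D -> D *m Dinv = 1%:M -> D *m PB = PB *m D -> D *m PS = PS *m D ->
    D *m Pm = mu *m D1 *m mu^T -> Pm *m p = p -> Pm *m q = q ->
    D1 *m p + Pm *m G *m q = Pm *m a -> Pm *m G *m p = D1 *m q ->
    mnrm p <= C1 -> mnrm q <= C1 ->
    mnrm (PB *m D) <= eps -> mnrm (PS *m Dinv) <= eps ->
  `|(a^T *m sys_xi G D a 0) 0 0 - (a^T *m p) 0 0| <= C * eps.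
Proof.
move=> C10; have [Cg Cg0 coer] := coercive pG.
pose c1 := mnrm (W *m G *m nu^T) * C1.
pose c2 := mnrm (L *m nu^T) * C1.
pose c3 := mnrm a + mnrm G * (mnrm (W *m a) + c2).
pose c4 := mnrm G * c2.
pose c5 := mnrm (W *m a).
pose g := mnrm G.
have nn m1 m2 (A : 'M[R]_(m1, m2)) := mnrm_ge0 A.
exists (mnrm a * (Cg * ((c1 + g * c4) + (g * c3 + c5 + c1)) + c3)).
  rewrite /c3 /c4 /c5 /c1 /c2 /g.
  by repeat first [exact: mnrm_ge0 | exact: Cg0 | exact: C10 | apply: mulr_ge0 | apply: addr_ge0].
move=> D Dinv D1 p q eps Ds DDi DB DS Dm pm qm eq1 eq2 pC qC hB' hS'.
have r1 := approx_residual1 DDi DB DS Dm pm qm eq1.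
have r2 := approx_residual2 DDi DB DS Dm pm qm eq2.
have [s1 s2] := sys_solP a 0 pG Ds.
have lv := lead_value pm.
have nx : mnrm (lead_xi p) <= c2 by exact: mnrmM_le (lexx _) pC.
have ny : mnrm (lead_eta q) <= mnrm (W *m a) + c2.
  exact: mnrmD_le (lexx _) (mnrmM_le (lexx _) qC).
have nz : mnrm (PS *m Dinv *m (a - G *m lead_eta q)) <= eps * c3.
  exact: mnrmM_le hS' (mnrmB_le (lexx _) (mnrmM_le (lexx _) ny)).
have nE2 : mnrm (G *m (PS *m Dinv *m (G *m lead_xi p))) <= g * (eps * c4).
  exact: mnrmM_le (lexx _) (mnrmM_le hS' (mnrmM_le (lexx _) nx)).
have nE3 : mnrm (G *m (PS *m Dinv *m (a - G *m lead_eta q))) <= g * (eps * c3).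
  exact: mnrmM_le (lexx _) nz.
have nE4 : mnrm (PB *m D *m W *m a) <= eps * c5.
  by rewrite -mulmxA; exact: mnrmM_le hB' (lexx _).
have nE (z : 'cV[R]_n) : mnrm z <= C1 ->
    mnrm (PB *m D *m W *m G *m nu^T *m z) <= eps * c1.
  move=> zC; have -> : PB *m D *m W *m G *m nu^T *m z =
     PB *m D *m (W *m G *m nu^T *m z) by rewrite !mulmxA.
  exact: mnrmM_le hB' (mnrmM_le (lexx _) zC).
move: (nE p pC) (nE q qC) nE2 nE3 nE4 r1 r2 s1 s2 => {nE}.
move: (_ *m p) (_ *m q) (G *m (_ *m (G *m _))) (G *m (_ *m (a - _))) (_ *m D *m W *m a).
move=> E1 E5 E2 E3 E4 n1 n5 n2 n3 n4 r1 r2 s1 s2.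
set x0 := approx_xi Dinv p q in r1 r2; set y0 := approx_eta Dinv p q in r1 r2.
have := coer D (sys_xi G D a 0 - x0) (sys_eta G D a 0 - y0) (E1 - E2) (E4 - E3 - E5) Ds.
have e1 : D *m (sys_xi G D a 0 - x0) + G *m (sys_eta G D a 0 - y0) = E1 - E2.
  rewrite !mulmxBr addrACA -opprD s1 r1; mx_entries; ring.
have e2 : G *m (sys_xi G D a 0 - x0) - D *m (sys_eta G D a 0 - y0) = E4 - E3 - E5.
  rewrite !mulmxBr.
  have -> (u1 u2 u3 u4 : 'cV[R]_n) : u1 - u3 - (u2 - u4) = (u1 - u2) - (u3 - u4).
    by apply/matrixP => i j; rewrite !mxE; ring.
  by rewrite s2 r2; apply/matrixP => i j; rewrite !mxE; ring.
move=> /(_ e1 e2) h.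
rewrite -lv -submxE -mulmxBr; apply: le_trans (le_mnrm _ _ _) _.
rewrite -mulrA; apply: le_trans (mnrmM _ _) _; rewrite mnrm_tr ler_wpM2l//.
have -> : sys_xi G D a 0 - lead_xi p =
    (sys_xi G D a 0 - x0) + PS *m Dinv *m (a - G *m lead_eta q).
  by rewrite /x0 /approx_xi opprD addrA subrK.
rewrite mulrDl [c3 * _]mulrC; apply: mnrmD_le => //.
apply: (@le_trans _ _ (mnrm (sys_xi G D a 0 - x0) + mnrm (sys_eta G D a 0 - y0))).
  by rewrite lerDl.
apply: le_trans h _; rewrite -mulrA ler_wpM2l//.
have -> : (c1 + g * c4 + (g * c3 + c5 + c1)) * eps =
    (eps * c1 + g * (eps * c4)) + ((eps * c5 + g * (eps * c3)) + eps * c1) by ring.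
by apply: lerD; apply: mnrmB_le => //; exact: mnrmB_le.
Qed.

End Decoupling.

(** * The blocks of solitons and breathers *)

(** Objects are indexed by a finite type J. The object j has the mode (j, false)
    and, when al j <> 0, also the mode (j, true): two modes for a breather, one
    for a soliton. Matrices are described by their entries on modes. *)
Section BlockIndices.
Context {R : realType} {J : finType}.
Variable al : J -> R.

Definition mode_pred (x : J * bool) := ~~ x.2 || (al x.1 != 0).
Definition dim := #|mode_pred|.
Definition idx (i : 'I_dim) : J * bool := enum_val i.

Lemma idxP i : mode_pred (idx i). Proof. exact: (enum_valP i). Qed.

Lemma idx_inj : injective idx. Proof. exact: enum_val_inj. Qed.

Lemma idx_surj x : mode_pred x -> exists i, idx i = x.
Proof.
by move=> mx; exists (enum_rank_in (mx : x \in mode_pred) x); exact: enum_rankK_in.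
Qed.

Lemma sum_idx (f : J * bool -> R) :
  \sum_(i < dim) f (idx i) = \sum_(x | mode_pred x) f x.
Proof. by have := big_enum_val (A := mode_pred) f => <-. Qed.

Definition toM (F : J * bool -> J * bool -> R) : 'M[R]_dim :=
  \matrix_(i, j) F (idx i) (idx j).
Definition toV (f : J * bool -> R) : 'cV[R]_dim := \col_i f (idx i).
(** Coordinates, extended by 0 to the pairs that are not modes. *)
Definition ofV (u : 'cV[R]_dim) (x : J * bool) : R := \sum_i u i 0 * (x == idx i)%:R.

Lemma ofV_idx u i : ofV u (idx i) = u i 0.
Proof.
rewrite /ofV (bigD1 i)//= eqxx mulr1 big1 ?addr0// => j ji.
by rewrite (inj_eq idx_inj) eq_sym (negbTE ji) mulr0.
Qed.

Lemma ofV_out u x : ~~ mode_pred x -> ofV u x = 0.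
Proof.
move=> nx; rewrite /ofV big1// => i _; case: eqP => [e|_]; last by rewrite mulr0.
by move: nx; rewrite e idxP.
Qed.

Lemma toV_ofV u : toV (ofV u) = u.
Proof. by apply/matrixP => i j; rewrite mxE ofV_idx ord1. Qed.

Lemma toM_mulV F f : toM F *m toV f =
  toV (fun x => \sum_(y | mode_pred y) F x y * f y).
Proof.
apply/matrixP => i j; rewrite !mxE -sum_idx.
by apply: eq_bigr => k _; rewrite !mxE.
Qed.

Lemma toM_mul F H : toM F *m toM H =
  toM (fun x y => \sum_(z | mode_pred z) F x z * H z y).
Proof.
apply/matrixP => i j; rewrite !mxE -sum_idx.
by apply: eq_bigr => k _; rewrite !mxE.
Qed.

Lemma eq_toM F H : (forall x y, mode_pred x -> mode_pred y -> F x y = H x y) ->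
  toM F = toM H.
Proof. by move=> FH; apply/matrixP => i j; rewrite !mxE FH ?idxP. Qed.

Lemma eq_toV f g : (forall x, mode_pred x -> f x = g x) -> toV f = toV g.
Proof. by move=> fg; apply/matrixP => i j; rewrite !mxE fg ?idxP. Qed.

Lemma trmx_toM F : (toM F)^T = toM (fun x y => F y x).
Proof. by apply/matrixP => i j; rewrite !mxE. Qed.

Definition cj (x : J * bool) := (x.1, ~~ x.2).
Definition sg (b : bool) : R := if b then -1 else 1.

Lemma cjK : involutive cj. Proof. by case=> j b; rewrite /cj/= negbK. Qed.

Lemma sgN b : sg (~~ b) = - sg b.
Proof. by case: b; rewrite /sg/= ?opprK. Qed.

Lemma sg2 b : sg b * sg b = 1.
Proof. by case: b; rewrite /sg ?mulrNN mulr1. Qed.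

Lemma cj_neq x : (cj x == x) = false.
Proof. by apply/eqP; case: x => j [] []. Qed.

(** The coefficients of the second mode must vanish on solitons for the blocks
    to multiply like complex numbers. *)
Definition vanishing (q : J -> R) := forall j, al j = 0 -> q j = 0.

Lemma mode_cj x : mode_pred x -> al x.1 != 0 -> mode_pred (cj x).
Proof. by move=> _ nx; rewrite /mode_pred /= nx orbT. Qed.

Lemma sum_pair x (c d : R) (f : J * bool -> R) : mode_pred x ->
  (al x.1 = 0 -> d = 0) ->
  \sum_(y | mode_pred y) (c * (x == y)%:R + d * (y == cj x)%:R) * f y =
  c * f x + d * f (cj x).
Proof.
move=> mx dx; under eq_bigr do rewrite mulrDl.
rewrite big_split/=; congr (_ + _).
  rewrite (bigD1 x)//= eqxx mulr1 big1 ?addr0// => y /andP[_ yx].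
  by rewrite eq_sym (negbTE yx) mulr0 mul0r.
have [ax|ax] := eqVneq (al x.1) 0.
  by rewrite dx// mul0r big1// => y _; rewrite !mul0r.
rewrite (bigD1 (cj x))/= ?mode_cj// eqxx mulr1 big1 ?addr0// => y /andP[_ yx].
by rewrite (negbTE yx) mulr0 mul0r.
Qed.

(** On the two modes (c, s) of a breather this is multiplication of c - i s by p
    + i q; a soliton has one mode and only p acts. *)
Definition blk (p q : J -> R) : 'M[R]_dim :=
  toM (fun x y => p x.1 * (x == y)%:R + (q x.1 * sg x.2) * (y == cj x)%:R).

(** Complex conjugation on every block; it makes the data symmetric and turns
    multiplication by a number into that by its conjugate ([blkS]). *)
Definition Smx : 'M[R]_dim := toM (fun x y => sg x.2 * (x == y)%:R).

Lemma blk_mulV p q f : vanishing q ->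
  blk p q *m toV f = toV (fun x => p x.1 * f x + q x.1 * sg x.2 * f (cj x)).
Proof.
move=> vq; rewrite /blk toM_mulV; apply: eq_toV => x mx.
by rewrite sum_pair// => /vq ->; rewrite mul0r.
Qed.

Lemma blk_mulM p q F : vanishing q ->
  blk p q *m toM F = toM (fun x y => p x.1 * F x y + q x.1 * sg x.2 * F (cj x) y).
Proof.
move=> vq; rewrite /blk toM_mul; apply: eq_toM => x y mx my.
by rewrite (@sum_pair x _ _ (fun z => F z y))// => /vq ->; rewrite mul0r.
Qed.

Lemma blk_mul p q p' q' : vanishing q ->
  blk p q *m blk p' q' =
  blk (fun j => p j * p' j - q j * q' j) (fun j => p j * q' j + q j * p' j).
Proof.
move=> vq; rewrite {2}/blk blk_mulM//; apply: eq_toM => x y mx my /=.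
rewrite cjK sgN [cj x == y]eq_sym [y == x]eq_sym.
have := sg2 x.2; set s := sg _ => s2.
have -> : q x.1 * s * (p' x.1 * (y == cj x)%:R + q' x.1 * - s * (x == y)%:R) =
  q x.1 * p' x.1 * s * (y == cj x)%:R - q x.1 * q' x.1 * (s * s) * (x == y)%:R by ring.
rewrite s2; ring.
Qed.

Lemma trmx_blk p q : (blk p q)^T = blk p (fun j => - q j).
Proof.
rewrite /blk trmx_toM; apply: eq_toM => x y mx my.
have [->|xy] := eqVneq x y.
  by rewrite !(eq_sym y) cj_neq !mulr0.
rewrite !mulr0 !add0r.
have -> : (x == cj y) = (y == cj x) by apply/eqP/eqP => ->; rewrite cjK.
case: eqP => [->|_]; last by rewrite !mulr0.
by rewrite /= sgN !mulr1 mulrN mulNr.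
Qed.

Lemma eq_blk p q p' q' : (forall j, p j = p' j) -> (forall j, al j != 0 -> q j = q' j) ->
  blk p q = blk p' q'.
Proof.
move=> pp qq; apply: eq_toM => x y mx my; rewrite pp.
case: (y =P cj x) => [e|_]; last by rewrite !mulr0.
rewrite qq//; move: mx my; rewrite e /mode_pred /=.
by case: x.2 => //= _; rewrite orbF.
Qed.

Lemma blkC p q p' q' : vanishing q -> vanishing q' ->
  blk p q *m blk p' q' = blk p' q' *m blk p q.
Proof. by move=> vq vq'; rewrite !blk_mul//; apply: eq_blk => j *; ring. Qed.

Lemma blk1 : blk (fun=> 1) (fun=> 0) = 1%:M.
Proof.
apply/matrixP => i j; rewrite !mxE /= mul0r mul0r addr0 mul1r.
by rewrite (inj_eq idx_inj).
Qed.

Lemma blkD p q p' q' : blk p q + blk p' q' =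
  blk (fun j => p j + p' j) (fun j => q j + q' j).
Proof. by apply/matrixP => i j; rewrite !mxE; ring. Qed.

Lemma blkN p q : - blk p q = blk (fun j => - p j) (fun j => - q j).
Proof. by apply/matrixP => i j; rewrite !mxE; ring. Qed.

Lemma Smx_mulM F : Smx *m toM F = toM (fun x y => sg x.2 * F x y).
Proof.
rewrite /Smx toM_mul; apply: eq_toM => x y mx my.
rewrite (bigD1 x)//= eqxx mulr1 big1 ?addr0// => z /andP[_ zx].
by rewrite eq_sym (negbTE zx) mulr0 mul0r.
Qed.

Lemma SmxS : Smx *m Smx = 1%:M.
Proof.
rewrite {2}/Smx Smx_mulM -blk1; apply: eq_toM => x y _ _.
by rewrite mulrA sg2 mul0r mul0r addr0.
Qed.

Lemma trmx_Smx : Smx^T = Smx.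
Proof.
rewrite /Smx trmx_toM; apply: eq_toM => x y _ _.
by rewrite eq_sym; case: eqP => [->|]; rewrite ?mulr0.
Qed.

Lemma blkS p q : blk p q *m Smx = Smx *m blk p (fun j => - q j).
Proof.
apply: trmx_inj; rewrite !trmx_mul trmx_Smx !trmx_blk.
rewrite {1}/blk Smx_mulM.
have -> : blk p (fun j => - - q j) *m Smx = toM (fun x y => sg y.2 * (p x.1 * (x == y)%:R + q x.1 * sg x.2 * (y == cj x)%:R)).
  apply/matrixP => i j; rewrite !mxE (bigD1 j)//= !mxE eqxx big1 ?addr0.
    by rewrite opprK mulr1 mulrC.
  by move=> k kj; rewrite !mxE [idx k == idx j](inj_eq idx_inj) (negbTE kj) !mulr0.
apply: eq_toM => x y _ _.
have [<-|xy] := eqVneq x y.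
  by rewrite (eq_sym x) cj_neq !mulr0.
case: eqP => [->|_]; last by rewrite !mulr0 addr0 !mulr0.
by rewrite /= sgN; ring.
Qed.

End BlockIndices.

Section GramMatrix.
Context {R : realType}.

Definition lapC (b t : R) := b / (b ^+ 2 + t ^+ 2).
Definition lapS (b t : R) := t / (b ^+ 2 + t ^+ 2).

(** The integral over [0, +oo[ of exp (- b u) f (s u) g (t u), where f and g are
    cos (index false) or sin (index true). *)
Definition gam (b s t : R) (f g : bool) : R :=
  match f, g with
  | false, false => (lapC b (s - t) + lapC b (s + t)) / 2
  | true, true => (lapC b (s - t) - lapC b (s + t)) / 2
  | true, false => (lapS b (s + t) + lapS b (s - t)) / 2
  | false, true => (lapS b (s + t) - lapS b (s - t)) / 2
  end.

Lemma gamC b s t f g : gam b s t f g = gam b t s g f.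
Proof.
have e1 : lapC b (t - s) = lapC b (s - t) by rewrite /lapC -(opprB s t) sqrrN.
have e2 : lapS b (t - s) = - lapS b (s - t).
  by rewrite /lapS -(opprB s t) sqrrN mulNr.
by case: f; case: g; rewrite /gam (addrC t s) ?e1 ?e2 ?opprK.
Qed.

(** The left-hand side integrates minus the derivative of the integrand, and the
    right-hand side is the value of f g at 0. *)
Lemma gam_lyapunov (b s t : R) (f g : bool) : 0 < b ->
  b * gam b s t f g + sg f * s * gam b s t (~~ f) g
    + sg g * t * gam b s t f (~~ g) = (~~ f)%:R * (~~ g)%:R.
Proof.
move=> b0.
have h1 : b ^+ 2 + (s - t) ^+ 2 != 0.
  by apply: lt0r_neq0; apply: ltr_pwDl; [exact: exprn_gt0|exact: sqr_ge0].
have h2 : b ^+ 2 + (s + t) ^+ 2 != 0.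
  by apply: lt0r_neq0; apply: ltr_pwDl; [exact: exprn_gt0|exact: sqr_ge0].
by case: f; case: g; rewrite /gam /sg /lapC /lapS /=; field; rewrite ?h1 ?h2.
Qed.

End GramMatrix.

Section Modes.
Context {R : realType} {J : finType}.
Variables (be al : J -> R).
Hypothesis be_gt0 : forall j, 0 < be j.

Local Notation n := (dim al).
Local Notation mode_pred := (mode_pred al).
Local Notation vanishing := (vanishing al).

Definition Kmx : 'M[R]_n := blk al be al.
Definition avec : 'cV[R]_n := toV al (fun x => (~~ x.2)%:R).
Definition Gmx : 'M[R]_n :=
  toM al (fun x y => gam (be x.1 + be y.1) (al x.1) (al y.1) x.2 y.2).

Lemma Gmx_sym : Gmx^T = Gmx.
Proof.
by rewrite /Gmx trmx_toM; apply: eq_toM => x y _ _; rewrite addrC gamC.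
Qed.

Lemma Gmx_lyapunov : Kmx *m Gmx + Gmx *m Kmx^T = avec *m avec^T.
Proof.
have -> : Gmx *m Kmx^T = (Kmx *m Gmx)^T by rewrite trmx_mul Gmx_sym.
rewrite /Kmx /Gmx blk_mulM//; apply/matrixP => i j; rewrite !mxE big_ord1 !mxE.
set x := idx i; set y := idx j.
rewrite -(@gam_lyapunov _ (be x.1 + be y.1) (al x.1) (al y.1)) ?addr_gt0//=.
rewrite (addrC (be y.1)) ![gam _ (al y.1) _ _ _]gamC; ring.
Qed.

(** The exponential of - s K^T. *)
Definition flow (s : R) : 'M[R]_n :=
  blk al (fun j => expR (- (be j * s)) * cos (al j * s))
         (fun j => expR (- (be j * s)) * sin (al j * s)).

Lemma flow0 : flow 0 = 1%:M.
Proof.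
rewrite -(@blk1 _ _ al); apply: eq_blk => j *.
  by rewrite !mulr0 oppr0 expR0 cos0 mulr1.
by rewrite !mulr0 sin0 mulr0.
Qed.

Lemma blk_entry_derive (dp dq : J -> R) (f g : J -> R -> R) (s : R) i k :
  (forall j, is_derive s 1 (f j) (dp j)) -> (forall j, is_derive s 1 (g j) (dq j)) ->
  is_derive s 1 (fun s => blk al (f^~ s) (g^~ s) i k) (blk al dp dq i k).
Proof.
move=> fp gq; rewrite !mxE; apply: isd_ext (fun s => esym (mxE _ _ _ _)) _.
set x := idx i; set y := idx k.
apply: isd_eq (isdD (isdM (fp x.1) (isd_cst (x == y)%:R s))
  (isdM (isdM (gq x.1) (isd_cst (sg x.2) s)) (isd_cst (y == cj x)%:R s))) _.
by ring.
Qed.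

Lemma flow_derive (s : R) i k :
  is_derive s 1 (fun s => flow s i k) ((- (Kmx^T *m flow s)) i k).
Proof.
rewrite /Kmx trmx_blk blk_mul; last by move=> j ->; rewrite oppr0.
rewrite blkN; apply: (@blk_entry_derive _ _
  (fun j s => expR (- (be j * s)) * cos (al j * s))
  (fun j s => expR (- (be j * s)) * sin (al j * s))) => j.
  apply: isd_eq (isdM (isd_expR (isdN (isdZ (be j) (isd_id s))))
                      (isd_cos (isdZ (al j) (isd_id s)))) _; ring.
apply: isd_eq (isdM (isd_expR (isdN (isdZ (be j) (isd_id s))))
                    (isd_sin (isdZ (al j) (isd_id s)))) _; ring.
Qed.

End Modes.

Section MatrixDerivative.
Context {R : realType}.

Lemma isd_mulmx m n p (A : R -> 'M[R]_(m, n)) (B : R -> 'M[R]_(n, p))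
    (dA : 'M[R]_(m, n)) (dB : 'M[R]_(n, p)) (x : R) :
  (forall i j, is_derive x 1 (fun s => A s i j) (dA i j)) ->
  (forall i j, is_derive x 1 (fun s => B s i j) (dB i j)) ->
  forall i j, is_derive x 1 (fun s => (A s *m B s) i j)
    ((dA *m B x + A x *m dB) i j).
Proof.
move=> AdA BdB i j; rewrite addmxE !mxE -big_split/=.
apply: isd_ext (fun s => esym (mxE _ _ _ _)) _.
by apply: isd_sum => k; exact: isdM.
Qed.

Lemma isd_mulmxl m n p (A : 'M[R]_(m, n)) (B : R -> 'M[R]_(n, p))
    (dB : 'M[R]_(n, p)) (x : R) :
  (forall i j, is_derive x 1 (fun s => B s i j) (dB i j)) ->
  forall i j, is_derive x 1 (fun s => (A *m B s) i j) ((A *m dB) i j).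
Proof.
move=> BdB i j; apply: isd_eq (isd_mulmx (A := fun=> A) (dA := 0) _ BdB i j) _.
  by move=> k l; rewrite mxE; exact: isd_cst.
by rewrite mul0mx add0r.
Qed.

Lemma isd_mulmxr m n p (A : R -> 'M[R]_(m, n)) (B : 'M[R]_(n, p))
    (dA : 'M[R]_(m, n)) (x : R) :
  (forall i j, is_derive x 1 (fun s => A s i j) (dA i j)) ->
  forall i j, is_derive x 1 (fun s => (A s *m B) i j) ((dA *m B) i j).
Proof.
move=> AdA i j; apply: isd_eq (isd_mulmx (B := fun=> B) (dB := 0) AdA _ i j) _.
  by move=> k l; rewrite mxE; exact: isd_cst.
by rewrite mulmx0 addr0.
Qed.

Lemma isd_trmx m n (A : R -> 'M[R]_(m, n)) (dA : 'M[R]_(m, n)) (x : R) :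
  (forall i j, is_derive x 1 (fun s => A s i j) (dA i j)) ->
  forall i j, is_derive x 1 (fun s => (A s)^T i j) (dA^T i j).
Proof.
by move=> AdA i j; rewrite mxE; apply: isd_ext (fun s => esym (mxE _ _ _ _)) _.
Qed.

(** In place of a limit at infinity: at the time c / (|r| d) the hypothesis
    contradicts r <> 0. *)
Lemma exp_decay_eq0 (r c d : R) : 0 < d ->
  (forall s, 0 <= s -> `|r| <= c * expR (- (d * s))) -> r = 0.
Proof.
move=> d0 h; apply/eqP; apply: contraT => r0.
have {}r0 : 0 < `|r| by rewrite normr_gt0.
have c0 : 0 <= c by have := h 0 (lexx _); rewrite mulr0 oppr0 expR0 mulr1; exact: le_trans.
have s0 : 0 <= c / (`|r| * d) by rewrite divr_ge0// ltW// mulr_gt0.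
have := h _ s0; rewrite expRN ler_pdivlMr ?expR_gt0// => h1.
have := expR_ge1Dx (d * (c / (`|r| * d))) => h2.
have : `|r| * (1 + d * (c / (`|r| * d))) <= c.
  by apply: le_trans h1; rewrite ler_pM2l.
have -> : `|r| * (1 + d * (c / (`|r| * d))) = `|r| + c.
  by field; rewrite !gt_eqF.
by rewrite gerDr leNgt r0.
Qed.

Lemma finite_min (J : finType) (f : J -> R) : (forall j, 0 < f j) ->
  exists2 d, 0 < d & forall j, d <= f j.
Proof.
move=> f0; pose S := 1 + \sum_j (f j)^-1.
have S0 : 0 < S by rewrite ltr_pwDl// sumr_ge0// => j _; rewrite invr_ge0 ltW.
exists S^-1; first by rewrite invr_gt0.
move=> j; rewrite -[leRHS]invrK lef_pV2 ?posrE ?invr_gt0//.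
rewrite /S (bigD1 j)//= addrCA lerDl addr_ge0// sumr_ge0// => i _.
by rewrite invr_ge0 ltW.
Qed.

Lemma finite_max (J : finType) (f : J -> R) : exists2 d, 0 <= d & forall j, f j <= d.
Proof.
exists (\sum_j `|f j|); first exact: sumr_ge0.
by move=> j; apply: le_trans (ler_norm _) _; rewrite (bigD1 j)//= lerDl sumr_ge0.
Qed.

End MatrixDerivative.

Section Stability.
Context {R : realType} {J : finType}.
Variables (be al : J -> R).
Hypothesis be_gt0 : forall j, 0 < be j.

Local Notation n := (dim al).
Local Notation K := (Kmx be al).
Local Notation flow := (flow be al).

Lemma blk_norm (p q : J -> R) (c : R) :
  (forall j, `|p j| <= c) -> (forall j, `|q j| <= c) ->
  mnrm (blk al p q) <= (n * n)%:R * (2 * c).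
Proof.
move=> pc qc; apply: mnrm_le_entries => i j; rewrite mxE.
have nat1 (b : bool) : `|b%:R : R| <= 1 by case: b; rewrite ?normr0 ?normr1.
rewrite mulrDl mul1r; apply: le_trans (ler_normD _ _) _; apply: lerD.
  by rewrite normrM -[leRHS]mulr1; apply: ler_pM.
rewrite !normrM -[leRHS]mulr1; apply: ler_pM => //.
rewrite -[leRHS]mulr1; apply: ler_pM => //.
by rewrite /sg; case: ifP; rewrite ?normrN normr1.
Qed.

Lemma flow_decay : exists c d : R, [/\ 0 <= c, 0 < d &
  forall s, 0 <= s -> mnrm (flow s) <= c * expR (- (d * s))].
Proof.
have [d d0 dbe] := finite_min be_gt0.
exists ((n * n)%:R * 2), d; split => // s s0; rewrite -mulrA.
have e (j : J) (x : R) : `|x| <= 1 -> `|expR (- (be j * s)) * x| <= expR (- (d * s)).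
  move=> x1; rewrite normrM ger0_norm ?expR_ge0// -[leRHS]mulr1.
  apply: ler_pM; rewrite ?expR_ge0// ler_expR lerN2 ler_wpM2r//.
apply: blk_norm => j; apply: e; [exact: cos_max|exact: sin_max].
Qed.

Lemma flow_cong_derive (X : 'M[R]_n) (s : R) i j :
  is_derive s 1 (fun s => ((flow s)^T *m X *m flow s) i j)
    ((- ((flow s)^T *m (K *m X + X *m K^T) *m flow s)) i j).
Proof.
have dF := @flow_derive _ _ be al s.
apply: isd_eq (isd_mulmx (isd_mulmxr X (isd_trmx dF)) dF i j) _.
have -> : (- (K^T *m flow s))^T = - ((flow s)^T *m K).
  by rewrite linearN/= trmx_mul trmxK.
by congr (fun_of_matrix _ i j); mx_ring.
Qed.

Lemma flow_cong_decay (X : 'M[R]_n) : exists c d : R, 0 < d /\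
  forall s i j, 0 <= s -> `|((flow s)^T *m X *m flow s) i j| <= c * expR (- (d * s)).
Proof.
have [c [d [c0 d0 h]]] := flow_decay.
exists (c * mnrm X * c), (d + d); split; first exact: addr_gt0.
move=> s i j s0; apply: le_trans (le_mnrm _ _ _) _.
have -> : c * mnrm X * c * expR (- ((d + d) * s)) =
   (c * expR (- (d * s))) * mnrm X * (c * expR (- (d * s))).
  by rewrite mulrDl opprD expRD; ring.
apply: mnrmM_le (h s s0); apply: mnrmM_le => //.
by rewrite mnrm_tr; exact: h.
Qed.

(** By the hypothesis X is invariant under congruence by the flow, along which
    everything decays. *)
Lemma stable (X : 'M[R]_n) : K *m X + X *m K^T = 0 -> X = 0.
Proof.
move=> X0; have [c [d [d0 h]]] := flow_cong_decay X.
apply/matrixP => i j; rewrite [RHS]mxE; apply: (exp_decay_eq0 d0) => s s0.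
suff -> : X i j = ((flow s)^T *m X *m flow s) i j by exact: h.
have zero (z : R) : is_derive z 1 (fun s => ((flow s)^T *m X *m flow s) i j) 0.
  apply: isd_eq (flow_cong_derive X z i j) _.
  by rewrite X0 mulmx0 mul0mx oppr0 mxE.
have := bounded_derive_lipschitz (C := 0) s 0 zero (fun _ => _).
rewrite normr0 => /(_ (fun=> lexx _)); rewrite mul0r normr_le0 subr_eq0.
by rewrite /= flow0 trmx1 mul1mx mulmx1 => /eqP.
Qed.

End Stability.

Section Observability.
Context {R : realType} {J : finType}.
Variables (be al : J -> R).
Hypothesis be_gt0 : forall j, 0 < be j.
Hypothesis sep : forall i j, be i = be j -> al i ^+ 2 = al j ^+ 2 -> i = j.

Local Notation n := (dim al).
Local Notation K := (Kmx be al).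
Local Notation a := (avec al).
Implicit Types u : 'cV[R]_n.

Lemma ofV_toV f x : mode_pred al x -> ofV (toV al f) x = f x.
Proof. by move=> /idx_surj [i <-]; rewrite ofV_idx mxE. Qed.

Lemma blk_ofV (p q : J -> R) u x : vanishing al q -> mode_pred al x ->
  ofV (blk al p q *m u) x = p x.1 * ofV u x + q x.1 * sg x.2 * ofV u (cj x).
Proof. by move=> vq mx; rewrite -{1}[u]toV_ofV blk_mulV// ofV_toV. Qed.

Lemma avec_mul u : (a^T *m u) 0 0 = \sum_j ofV u (j, false).
Proof.
rewrite mxE; under eq_bigr do rewrite !mxE -ofV_idx.
rewrite (sum_idx al (fun x => (~~ x.2)%:R * ofV u x)) big_mkcond.
rewrite -(pair_bigA _ (fun j b => if mode_pred al (j, b) then (~~ b)%:R * ofV u (j, b) else 0)).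
apply: eq_bigr => j _; rewrite big_bool /= mul0r if_same add0r.
by rewrite mul1r.
Qed.

(** The observation a^T of the trajectory through u vanishes at time 0 with all
    its derivatives. *)
Definition unobservable u := forall k, (a^T *m iter k (mulmx K^T) u) 0 0 = 0.

Lemma iter_lin k (c : R) u w :
  iter k (mulmx K^T) (c *: u + w) = c *: iter k (mulmx K^T) u + iter k (mulmx K^T) w.
Proof. by elim: k => //= k ->; rewrite mulmxDr -scalemxAr. Qed.

Lemma unobservable_lin c u w : unobservable u -> unobservable w ->
  unobservable (c *: u + w).
Proof.
move=> hu hw k; rewrite iter_lin mulmxDr -scalemxAr addmxE mxE hu hw; ring.
Qed.

Lemma unobservable_Kt u : unobservable u -> unobservable (K^T *m u).
Proof. by move=> hu k; rewrite -iterSr; exact: hu. Qed.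

(** The filter (K^T - be j)^2 + (al j)^2, which annihilates the block j and is
    invertible on every other block. *)
Let Qre j m := (be m - be j) ^+ 2 - al m ^+ 2 + al j ^+ 2.
Let Qim j m := 2 * (be m - be j) * - al m.

Let Qim_vanishing j : vanishing al (Qim j).
Proof. by move=> m am; rewrite /Qim am oppr0 mulr0. Qed.

Lemma trmx_K : K^T = blk al be (fun j => - al j). Proof. exact: trmx_blk. Qed.

Lemma blkZ c (p q : J -> R) : c *: blk al p q = blk al (fun j => c * p j) (fun j => c * q j).
Proof. by apply/matrixP => i j; rewrite !mxE; ring. Qed.

Let vN : vanishing al (fun j => - al j). Proof. by move=> m ->; rewrite oppr0. Qed.

Lemma filter_block j u : blk al (Qre j) (Qim j) *m u =
  1 *: (K^T *m (K^T *m u)) + (- (2 * be j) *: (K^T *m u) + ((be j ^+ 2 + al j ^+ 2) *: u + 0)).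
Proof.
have -> : blk al (Qre j) (Qim j) =
    K^T *m K^T + (- (2 * be j) *: K^T + (be j ^+ 2 + al j ^+ 2) *: 1%:M).
  rewrite trmx_K -(@blk1 _ _ al) blk_mul// !blkZ !blkD.
  by apply: eq_blk => m *; rewrite /Qre /Qim; ring.
by rewrite !mulmxDl -!scalemxAl mul1mx scale1r addr0 mulmxA.
Qed.

Lemma unobservable_filter j u : unobservable u ->
  unobservable (blk al (Qre j) (Qim j) *m u).
Proof.
move=> hu; rewrite filter_block.
have h0 : unobservable 0.
  move=> k; have -> : iter k (mulmx K^T) (0 : 'cV[R]_n) = 0.
    by elim: k => //= k ->; rewrite mulmx0.
  by rewrite mulmx0 mxE.
have hK := unobservable_Kt hu.
exact: (unobservable_lin _ (unobservable_Kt hK)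
  (unobservable_lin _ hK (unobservable_lin _ hu h0))).
Qed.

Lemma filter_separates j m : m != j -> Qre j m ^+ 2 + Qim j m ^+ 2 != 0.
Proof.
move=> mj; rewrite paddr_eq0 ?sqr_ge0// !sqrf_eq0; apply/negP => /andP[/eqP re0 /eqP im0].
move/eqP: mj; apply; move: re0 im0; rewrite /Qre /Qim => re0 /eqP.
rewrite !mulf_eq0 pnatr_eq0/= subr_eq0 oppr_eq0 => /orP[/eqP bb|/eqP am].
  apply: sep => //; move: re0; rewrite bb subrr expr0n/= sub0r addrC => /eqP.
  by rewrite subr_eq0 => /eqP.
move: re0; rewrite am expr0n/= subr0 => /eqP.
rewrite paddr_eq0 ?sqr_ge0// !sqrf_eq0 subr_eq0 => /andP[/eqP bb /eqP aj].
by apply: sep; rewrite // am aj.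
Qed.

(** The unobservable vectors form an invariant subspace. Applying the filters of
    all the objects but one leaves an unobservable vector with a single block,
    which is then read off from two observations. The filters do not kill the
    remaining block, because the objects have distinct parameters. *)
Lemma observability u : unobservable u -> u = 0.
Proof.
move=> hu; apply/matrixP => i k; rewrite [RHS]mxE ord1 {k} -ofV_idx.
case e : (idx i) => [m b]; apply/eqP; apply: contraT => umb.
have [w [hw [b' wmb] wr]] : exists w, [/\ unobservable w, exists b, ofV w (m, b) != 0 &
    forall j, j \in [seq j <- enum J | j != m] -> forall b, ofV w (j, b) = 0].
  elim: (enum J) => [|j r [w [hw [b' wb'] wr]]].
    by exists u; split => //; exists b.
  rewrite /=; case: ifPn => [jm|_]; last by exists w; split => //; exists b'.
  have mj : m != j by rewrite eq_sym.
  exists (blk al (Qre j) (Qim j) *m w); split; first exact: unobservable_filter.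
    have mb' : mode_pred al (m, b').
      by apply: contraNT wb' => nm; rewrite ofV_out.
    have [e0|ne] := eqVneq (ofV (blk al (Qre j) (Qim j) *m w) (m, b')) 0; last by exists b'.
    have amne : al m != 0.
      apply: contraNneq wb' => am; move: e0; rewrite blk_ofV//= Qim_vanishing// !mul0r addr0.
      move=> /eqP; rewrite mulf_eq0 => /orP[/eqP re0|//].
      by have := filter_separates mj; rewrite re0 Qim_vanishing// expr0n addr0 eqxx.
    exists (~~ b'); apply: contraNneq wb' => e1; move: e0 e1.
    have mb2 : mode_pred al (m, ~~ b') by rewrite /mode_pred /= amne orbT.
    rewrite !blk_ofV//= /cj/= negbK sgN.
    set x := ofV w (m, b'); set y := ofV w _; set p := Qre j m; set q := Qim j m.
    move=> e0 e1; have := filter_separates mj; rewrite -/p -/q.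
    have : (p ^+ 2 + q ^+ 2) * x = 0.
      have s2 := @sg2 R b'; set s := sg b' in e0 e1 s2.
      have -> : (p ^+ 2 + q ^+ 2) * x = p * (p * x + q * s * y) - q * s * (p * y + q * - s * x)
         + q ^+ 2 * x * (1 - s * s) by ring.
      by rewrite e0 e1 s2 subrr !mulr0 subrr addr0.
    by move/eqP; rewrite mulf_eq0 => /orP[->|].
  move=> j'; rewrite inE => /orP[/eqP ->|/wr wj'] c; last first.
    have [mc|mc] := boolP (mode_pred al (j', c)); last by rewrite ofV_out.
    by rewrite blk_ofV// /cj/= !wj' !mulr0 addr0.
  have [mc|mc] := boolP (mode_pred al (j, c)); last by rewrite ofV_out.
  by rewrite blk_ofV//= /Qre /Qim subrr; ring.
have wj j : j != m -> forall b, ofV w (j, b) = 0.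
  by move=> jm; apply: wr; rewrite mem_filter jm mem_enum.
have c0 : ofV w (m, false) = 0.
  have := hw 0%N; rewrite /= avec_mul (bigD1 m)//= big1 ?addr0//.
  by move=> j jm; exact: wj.
have s0 : ofV w (m, true) = 0.
  have [am|am] := eqVneq (al m) 0.
    by apply: ofV_out; rewrite /mode_pred /= am eqxx.
  have := hw 1%N; rewrite /= avec_mul (bigD1 m)//= big1 ?addr0; last first.
    by move=> j jm; rewrite trmx_K blk_ofV// /cj/= !wj// !mulr0 addr0.
  rewrite trmx_K blk_ofV// /cj/= c0 mulr0 add0r /sg mulr1 => /eqP.
  by rewrite mulf_eq0 oppr_eq0 (negbTE am) => /eqP.
by move: wmb; case: b'; rewrite ?c0 ?s0 eqxx.
Qed.

Lemma trajectory_derive u (s : R) i :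
  is_derive s 1 (fun s => (flow be al s *m u) i 0) ((- (K^T *m (flow be al s *m u))) i 0).
Proof.
apply: isd_eq (isd_mulmxr u (@flow_derive _ _ be al s) i 0) _.
by rewrite mulNmx mulmxA.
Qed.

Lemma derive_zero_right (f : R -> R) (x c : R) : (forall y, 0 < y -> f y = 0) ->
  0 < x -> is_derive x 1 f c -> c = 0.
Proof.
move=> f0 x0 fc; have cv := isd_quotient fc.
have cv0 : h^-1 * (f (h + x) - f x) @[h --> 0^'] --> (0 : R).
  apply: cvg_near_cst; near=> h.
  have hx : 0 < h + x.
    rewrite -ltrBlDr sub0r; near: h; exists x => //= z /=.
    by rewrite sub0r normrN ltr_norml => /andP[].
  by rewrite !f0// subrr mulr0.
by apply: cvg_unique cv cv0.
Unshelve. all: by end_near. Qed.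

Lemma zero_at_right (f : R -> R) : continuous_at 0 f ->
  (forall y, 0 < y -> f y = 0) -> f 0 = 0.
Proof.
move=> cf f0.
have cv : f y @[y --> 0^'+] --> f 0 by exact: cvg_at_right_filter.
have cv0 : f y @[y --> 0^'+] --> (0 : R).
  by apply: cvg_near_cst; near=> y; apply: f0; near: y; exact: nbhs_right_gt.
by apply: cvg_unique cv cv0.
Unshelve. all: by end_near. Qed.

Lemma le0_derive_nincr (f df : R -> R) (s t : R) :
  (forall z : R, is_derive z 1 f (df z)) -> (forall z, df z <= 0) -> s <= t -> f t <= f s.
Proof.
move=> fdf df0 st; have [|c _ e] := MVT_segment st (fun z _ => fdf z).
  by apply: continuous_subspaceT => z; exact: isd_continuous (fdf z).
by rewrite -subr_le0 e mulr_le0_ge0// subr_ge0.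
Qed.

(** The quadratic form decreases along the flow at the rate of the squared
    observation, and tends to 0. If it is not positive at y, it vanishes along
    the whole trajectory of y, and so does the observation. *)
Lemma Gmx_posdef : posdef (Gmx be al).
Proof.
split; first exact: Gmx_sym.
move=> y y0; pose z s := flow be al s *m y.
pose F s := bform (Gmx be al) (z s) (z s).
pose g k s := (a^T *m iter k (mulmx K^T) (z s)) 0 0.
have FE s : F s = (y^T *m ((flow be al s)^T *m Gmx be al *m flow be al s) *m y) 0 0.
  by rewrite /F /bform /z trmx_mul !mulmxA.
have dF (s : R) : is_derive s 1 F (- (g 0%N s) ^+ 2).
  apply: isd_ext (fun s => esym (FE s)) _.
  have h := isd_mulmxl y^T (flow_cong_derive be (Gmx be al) s).
  apply: isd_eq (isd_mulmxr y h 0 0) _.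
  rewrite Gmx_lyapunov// mulmxN mulNmx mxE; congr (- _).
  have -> : y^T *m ((flow be al s)^T *m (a *m a^T) *m flow be al s) *m y =
     (a^T *m z s)^T *m (a^T *m z s) by rewrite /z !trmx_mul trmxK !mulmxA.
  by rewrite mxE big_ord1 mxE -expr2.
have [c [d [d0 hcd]]] := flow_cong_decay be_gt0 (Gmx be al).
have Fdecay s : 0 <= s ->
    `|F s| <= mnrm y * ((n * n)%:R * c) * mnrm y * expR (- (d * s)).
  move=> s0; rewrite FE; apply: le_trans (le_mnrm _ _ _) _.
  have -> : mnrm y * ((n * n)%:R * c) * mnrm y * expR (- (d * s)) =
    mnrm y^T * ((n * n)%:R * (c * expR (- (d * s)))) * mnrm y by rewrite mnrm_tr; ring.
  apply: mnrmM_le => //; apply: mnrmM_le => //.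
  by apply: mnrm_le_entries => i j; exact: hcd.
have Fdec s t : s <= t -> F t <= F s.
  by apply: (le0_derive_nincr dF) => x; rewrite oppr_le0 sqr_ge0.
have -> : bform (Gmx be al) y y = F 0 by rewrite /F /z flow0 mul1mx.
rewrite ltNge; apply/negP => F0; move/eqP: y0; apply.
have Fz s : 0 <= s -> F s = 0.
  move=> s0; apply: (exp_decay_eq0 d0 (c := mnrm y * ((n * n)%:R * c) * mnrm y)) => t t0.
  have Fs0 : F s <= 0 by apply: le_trans (Fdec _ _ s0) F0.
  have st : s <= s + t by rewrite lerDl.
  have Fst0 := le_trans (Fdec _ _ st) Fs0.
  apply: (@le_trans _ _ `|F (s + t)|).
    by rewrite !ler0_norm// lerN2; exact: Fdec.
  apply: le_trans (Fdecay _ (addr_ge0 s0 t0)) _; apply: ler_wpM2l.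
    by have := Fdecay 0 (lexx _); rewrite mulr0 oppr0 expR0 mulr1; apply: le_trans.
  by rewrite ler_expR lerN2 ler_wpM2l ?(ltW d0)// lerDr.
have dg k (s : R) : is_derive s 1 (g k) (- g k.+1 s).
  have h : forall i j, is_derive s 1 (fun s => z s i j) ((- (K^T *m z s)) i j).
    by move=> i j; rewrite ord1; exact: trajectory_derive.
  have itM w : iter k (mulmx K^T) w = iter k (mulmx K^T) 1%:M *m w.
    by elim: k => [|k IH] /=; rewrite ?mul1mx// IH mulmxA.
  have gE t : (a^T *m (iter k (mulmx K^T) 1%:M *m z t)) 0 0 = g k t.
    by rewrite -itM.
  apply: isd_ext gE _.
  apply: isd_eq (isd_mulmxl a^T (isd_mulmxl _ h) 0 0) _.
  by rewrite !mulmxN mxE -itM -iterSr.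
have gz k s : 0 < s -> g k s = 0.
  elim: k s => [|k IHk] s s0.
    have := derive_zero_right (fun t t0 => Fz t (ltW t0)) s0 (dF s).
    by move/eqP; rewrite oppr_eq0 sqrf_eq0 => /eqP.
  by have := derive_zero_right IHk s0 (dg k s) => /eqP; rewrite oppr_eq0 => /eqP.
apply: observability => k.
have <- : z 0 = y by rewrite /z flow0 mul1mx.
by apply: (zero_at_right (f := g k)); [exact: isd_continuous (dg k 0)|exact: gz].
Qed.

End Observability.

(** * The data of several objects *)

Section DataTransformations.
Context {R : realType} {n : nat}.
Variables (K : 'M[R]_n) (a : 'cV[R]_n) (G : 'M[R]_n) (D : R -> R -> 'M[R]_n).
Hypothesis sd : spectral_data K a G D.

(** Multiplying the norming constants by a matrix in the commutant of K does not
    affect their evolution; this is how phases are shifted. *)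
Lemma data_congruence (M : 'M[R]_n) : K *m M = M *m K ->
  spectral_data K a G (fun t x => M *m D t x *m M^T).
Proof.
move=> KM; have KMt : M^T *m K^T = K^T *m M^T by rewrite -!trmx_mul KM.
split.
- exact: sd_posdef sd.
- exact: sd_lyapunov sd.
- by move=> t x; rewrite !trmx_mul trmxK (sd_sym sd) mulmxA.
- move=> t x; rewrite !mulmxA KM -(mulmxA M) (sd_comm sd).
  by rewrite -!mulmxA KMt.
- move=> t x i j; apply: isd_eq (isd_mulmxr M^T (isd_mulmxl M (sd_dx sd t x)) i j) _.
  by rewrite mulmxN mulNmx !mulmxA KM.
- move=> t x i j; apply: isd_eq (isd_mulmxr M^T (isd_mulmxl M (sd_dt sd t x)) i j) _.
  have c Y : M *m (K *m Y) = K *m (M *m Y) by rewrite !mulmxA KM.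
  by rewrite !c -!mulmxA.
Qed.

Variable P : 'M[R]_n.
Hypothesis hP : is_proj P.
Hypothesis KP : K *m P = P *m K.
Hypothesis DP : forall t x, D t x *m P = P *m D t x.

Let Gr : 'M[R]_n := P *m G *m P + (1%:M - P).

(** Restriction to some of the objects. The size of the matrices is kept, and G
    is completed by the identity on the other components to stay definite. *)
Lemma data_restriction :
  spectral_data (K *m P) (P *m a) Gr (fun t x => D t x *m P).
Proof.
have [Ps PP] := hP; have pG := sd_posdef sd; have Gs := proj1 pG.
have PK : P *m K^T = K^T *m P by rewrite -{1}Ps -trmx_mul KP trmx_mul Ps.
have KPDP Y : Y *m P = P *m Y -> K *m P *m (Y *m P) = K *m Y *m P.
  by move=> YP; rewrite -!mulmxA (mulmxA P Y) -YP -mulmxA PP.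
split.
- exact: proj_posdef.
- rewrite /Gr mulmxDr mulmxDl !trmx_mul Ps mulmxBr mulmx1 -[_ *m P *m P]mulmxA PP subrr addr0.
  rewrite mulmxBl mul1mx !(mulmxA P P) PP subrr addr0.
  rewrite [RHS]mulmxA -(mulmxA P a) -(sd_lyapunov sd) mulmxDr mulmxDl.
  congr (_ + _).
    by rewrite KP !mulmxA -(mulmxA P K P) KP (mulmxA P P) PP.
  by rewrite -!mulmxA (mulmxA P P) PP PK !mulmxA.
- by move=> t x; rewrite trmx_mul Ps (sd_sym sd) DP.
- move=> t x; rewrite trmx_mul Ps; transitivity (K *m (D t x *m P)).
    by rewrite -mulmxA (mulmxA P) -DP -mulmxA PP.
  by rewrite -mulmxA (mulmxA P P) PP PK !mulmxA (sd_comm sd).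
- move=> t x i j; apply: isd_eq (isd_mulmxr P (sd_dx sd t x) i j) _.
  by rewrite mulNmx (KPDP (D t x)) ?DP// mulmxA.
- move=> t x i j; apply: isd_eq (isd_mulmxr P (sd_dt sd t x) i j) _.
  have cK Y : Y *m P = P *m Y -> K *m Y *m P = P *m (K *m Y).
    by move=> YP; rewrite -mulmxA YP !mulmxA KP.
  rewrite (KPDP _ (DP t x)) (KPDP _ (cK _ (DP t x))).
  by rewrite (KPDP _ (cK _ (cK _ (DP t x)))).
Qed.

(** On the complement of the range of P the data vanish and the Gram matrix is
    the identity, so the equations there read xi = 0 and eta = 0. *)
Lemma restriction_support t x :
  let xi := spec_xi (P *m a) Gr (fun t x => D t x *m P) t x in
  let eta := spec_eta (P *m a) Gr (fun t x => D t x *m P) t x in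
  [/\ P *m xi = xi, P *m eta = eta,
      D t x *m P *m xi + P *m G *m eta = P *m a &
      P *m G *m xi = D t x *m P *m eta].
Proof.
move=> xi eta; have [Ps PP] := hP.
have e1 := spec_eq1 data_restriction t x; have e2 := spec_eq2 data_restriction t x.
rewrite -/xi -/eta in e1 e2; clearbody xi eta.
have QP : (1%:M - P) *m P = 0 by rewrite mulmxBl mul1mx PP subrr.
have QQ := proj2 (proj_compl hP).
have QG z : (1%:M - P) *m (Gr *m z) = (1%:M - P) *m z.
  rewrite mulmxA; congr (_ *m z).
  by rewrite /Gr mulmxDr QQ -!mulmxA (mulmxA (1%:M - P) P) QP mul0mx add0r.
have QD z : (1%:M - P) *m (D t x *m P *m z) = 0.
  by rewrite DP !mulmxA QP !mul0mx.
have Px : P *m xi = xi.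
  have := congr1 (mulmx (1%:M - P)) e2; rewrite QG QD mulmxBl mul1mx => /eqP.
  by rewrite subr_eq0 => /eqP.
have Py : P *m eta = eta.
  have := congr1 (mulmx (1%:M - P)) e1; rewrite mulmxDr QG QD add0r mulmxA QP mul0mx.
  by rewrite mulmxBl mul1mx => /eqP; rewrite subr_eq0 => /eqP.
have GP z : P *m z = z -> Gr *m z = P *m G *m z.
  by move=> Pz; rewrite /Gr mulmxDl mulmxBl mul1mx -[P *m G *m P *m z]mulmxA !Pz subrr addr0.
by rewrite -!GP.
Qed.

End DataTransformations.

Section MultiObject.
Context {R : realType} {J : finType}.
Variables (be al x1 x2 p0 q0 : J -> R).
Hypothesis be_gt0 : forall j, 0 < be j.
Hypothesis q0_van : vanishing al q0.
Hypothesis pq0 : forall j, 0 < p0 j ^+ 2 + q0 j ^+ 2.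

Local Notation n := (dim al).
Local Notation K := (Kmx be al).
Local Notation S := (Smx al).

Definition obj_amp j t x := expR (- (be j * (x + (3 * al j ^+ 2 - be j ^+ 2) * t + x2 j))).
Definition obj_arg j t x := al j * (x + (al j ^+ 2 - 3 * be j ^+ 2) * t + x1 j).
(** obj_p + i obj_q = (p0 + i q0) exp (- be y2 + i al y1), where y1 and y2 are
    the phases of the object. *)
Definition obj_p j t x :=
  obj_amp j t x * (p0 j * cos (obj_arg j t x) - q0 j * sin (obj_arg j t x)).
Definition obj_q j t x :=
  obj_amp j t x * (p0 j * sin (obj_arg j t x) + q0 j * cos (obj_arg j t x)).

Definition Dobj t x : 'M[R]_n := S *m blk al (fun j => obj_p j t x) (fun j => obj_q j t x).

Lemma obj_q_van t x : vanishing al (fun j => obj_q j t x).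
Proof.
by move=> j aj; rewrite /obj_q /obj_arg aj mul0r sin0 q0_van// mulr0 mul0r addr0 mulr0.
Qed.

Lemma obj_normE j t x : obj_p j t x ^+ 2 + obj_q j t x ^+ 2 =
  obj_amp j t x ^+ 2 * (p0 j ^+ 2 + q0 j ^+ 2).
Proof.
have cs := cos2Dsin2 (obj_arg j t x); rewrite /obj_p /obj_q.
set c := cos _ in cs *; set s := sin _ in cs *; set e := obj_amp _ _ _.
have -> : (e * (p0 j * c - q0 j * s)) ^+ 2 + (e * (p0 j * s + q0 j * c)) ^+ 2 =
  e ^+ 2 * (p0 j ^+ 2 + q0 j ^+ 2) * (c ^+ 2 + s ^+ 2) by ring.
by rewrite cs mulr1.
Qed.

Lemma obj_norm_gt0 j t x : 0 < obj_p j t x ^+ 2 + obj_q j t x ^+ 2.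
Proof. by rewrite obj_normE mulr_gt0// exprn_gt0// expR_gt0. Qed.

Definition Dobj_inv t x : 'M[R]_n := S *m blk al
  (fun j => obj_p j t x / (obj_p j t x ^+ 2 + obj_q j t x ^+ 2))
  (fun j => obj_q j t x / (obj_p j t x ^+ 2 + obj_q j t x ^+ 2)).

Lemma vanN q : vanishing al q -> vanishing al (fun j => - q j).
Proof. by move=> vq j /vq ->; rewrite oppr0. Qed.

Lemma DobjK t x : Dobj t x *m Dobj_inv t x = 1%:M.
Proof.
have vq := obj_q_van t x.
rewrite /Dobj /Dobj_inv mulmxA -(mulmxA S) blkS mulmxA SmxS mul1mx.
rewrite blk_mul; last exact: vanN.
rewrite -(@blk1 _ _ al); apply: eq_blk => j *; have := obj_norm_gt0 j t x.
  by move=> h; field; rewrite gt_eqF.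
by move=> h; field; rewrite gt_eqF.
Qed.

Lemma Dobj_sym t x : (Dobj t x)^T = Dobj t x.
Proof.
rewrite /Dobj trmx_mul trmx_Smx trmx_blk blkS; congr (_ *m _).
by apply: eq_blk => j *; rewrite ?opprK.
Qed.

Lemma Dobj_blk t x p q : vanishing al q ->
  blk al p q *m Dobj t x = Dobj t x *m (blk al p q)^T.
Proof.
move=> vq; rewrite /Dobj mulmxA blkS trmx_blk -!mulmxA; congr (_ *m _).
by apply: blkC; [exact: vanN|exact: obj_q_van].
Qed.

Lemma Dobj_comm t x : K *m Dobj t x = Dobj t x *m K^T.
Proof. exact: Dobj_blk. Qed.

(** Derivative of the complex exponential (u + i w) exp (ln e + i th), in real
    and imaginary parts. *)
Lemma isd_polar (e th : R -> R) (A B u w s : R) :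
  is_derive s 1 e (e s * A) -> is_derive s 1 th B ->
  let p := fun r => e r * (u * cos (th r) - w * sin (th r)) in
  let q := fun r => e r * (u * sin (th r) + w * cos (th r)) in
  is_derive s 1 p (A * p s - B * q s) /\ is_derive s 1 q (A * q s + B * p s).
Proof.
move=> de dt p q; split.
  by apply: isd_eq (isdM de (isdB (isdZ u (isd_cos dt)) (isdZ w (isd_sin dt)))) _;
    rewrite /p /q; ring.
by apply: isd_eq (isdM de (isdD (isdZ u (isd_sin dt)) (isdZ w (isd_cos dt)))) _;
  rewrite /p /q; ring.
Qed.

Lemma obj_dx j (t x : R) :
  is_derive x 1 (fun y => obj_p j t y) (- be j * obj_p j t x - al j * obj_q j t x) /\
  is_derive x 1 (fun y => obj_q j t y) (- be j * obj_q j t x + al j * obj_p j t x).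
Proof.
apply: isd_polar.
  apply: isd_eq (isd_expR (isdN (isdZ (be j)
    (isdD (isdD (isd_id x) (isd_cst _ x)) (isd_cst _ x))))) _.
  by rewrite /obj_amp; ring.
apply: isd_eq (isdZ (al j) (isdD (isdD (isd_id x) (isd_cst _ x)) (isd_cst _ x))) _.
by ring.
Qed.

Lemma obj_dt j (t x : R) :
  let A := - be j * (3 * al j ^+ 2 - be j ^+ 2) in
  let B := al j * (al j ^+ 2 - 3 * be j ^+ 2) in
  is_derive t 1 (fun s => obj_p j s x) (A * obj_p j t x - B * obj_q j t x) /\
  is_derive t 1 (fun s => obj_q j s x) (A * obj_q j t x + B * obj_p j t x).
Proof.
apply: isd_polar.
  apply: isd_eq (isd_expR (isdN (isdZ (be j)
    (isdD (isdD (isd_cst x t) (isdZ _ (isd_id t))) (isd_cst _ t))))) _.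
  by rewrite /obj_amp; ring.
apply: isd_eq (isdZ (al j) (isdD (isdD (isd_cst x t) (isdZ _ (isd_id t))) (isd_cst _ t))) _.
by ring.
Qed.

Lemma Kmx_S p q : vanishing al q -> K *m (S *m blk al p q) =
  S *m blk al (fun j => be j * p j + al j * q j) (fun j => be j * q j - al j * p j).
Proof.
move=> vq; rewrite mulmxA /Kmx blkS -mulmxA blk_mul; last exact: vanN.
by congr (_ *m _); apply: eq_blk => k *; ring.
Qed.

Lemma Dobj_dx (t x : R) i j :
  is_derive x 1 (fun y => Dobj t y i j) ((- (K *m Dobj t x)) i j).
Proof.
rewrite /Dobj Kmx_S; last exact: obj_q_van.
rewrite -mulmxN blkN; apply: isd_mulmxl => {}i {}j.
apply: (@blk_entry_derive _ _ _ _ _ (fun j y => obj_p j t y) (fun j y => obj_q j t y)) => k.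
- by have [h _] := obj_dx k t x; apply: isd_eq h _; ring.
- by have [_ h] := obj_dx k t x; apply: isd_eq h _; ring.
Qed.

Lemma Dobj_dt (t x : R) i j :
  is_derive t 1 (fun s => Dobj s x i j) ((K *m (K *m (K *m Dobj t x))) i j).
Proof.
have vq := obj_q_van t x; rewrite /Dobj Kmx_S//.
rewrite Kmx_S; last by move=> k ak; rewrite vq// ak mulr0 mul0r subrr.
rewrite Kmx_S; last by move=> k ak; rewrite vq// ak !(mulr0, mul0r, subrr).
apply: isd_mulmxl => {}i {}j.
apply: (@blk_entry_derive _ _ _ _ _ (fun j s => obj_p j s x) (fun j s => obj_q j s x)) => k.
- by have [h _] := obj_dt k t x; apply: isd_eq h _; ring.
- by have [_ h] := obj_dt k t x; apply: isd_eq h _; ring.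
Qed.

Definition proj (A : pred J) : 'M[R]_n := blk al (fun j => (A j)%:R) (fun=> 0).

Lemma proj_is_proj A : is_proj (proj A).
Proof.
split; first by rewrite /proj trmx_blk; apply: eq_blk => *; rewrite ?oppr0.
rewrite /proj blk_mul//; apply: eq_blk => j *; last by rewrite mulr0 mul0r addr0.
by case: (A j); rewrite ?mulr1 ?mulr0 subr0.
Qed.

Lemma proj_blk A p q : vanishing al q ->
  proj A *m blk al p q = blk al p q *m proj A.
Proof. by move=> vq; rewrite /proj blkC. Qed.

Lemma proj_S A : proj A *m S = S *m proj A.
Proof. by rewrite /proj blkS; congr (_ *m _); apply: eq_blk => *; rewrite ?oppr0. Qed.

Lemma projM A p q : proj A *m blk al p q =
  blk al (fun j => (A j)%:R * p j) (fun j => (A j)%:R * q j).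
Proof.
rewrite /proj blk_mul//; apply: eq_blk => j *; first by rewrite mul0r subr0.
by rewrite mul0r addr0.
Qed.

Lemma proj_Dobj A t x : proj A *m Dobj t x = Dobj t x *m proj A.
Proof.
rewrite /Dobj mulmxA proj_S -!mulmxA proj_blk//; exact: obj_q_van.
Qed.

Lemma proj_proj A B : proj A *m proj B = proj (predI A B).
Proof.
rewrite {2}/proj projM; apply: eq_blk => j *; last by rewrite mulr0.
by rewrite /=; case: (A j); case: (B j); rewrite ?mulr0 ?mulr1.
Qed.

Lemma proj_pred0 : proj pred0 = 0.
Proof.
by apply/matrixP => i j; rewrite /proj !mxE /= !mul0r addr0.
Qed.

Lemma proj_predT : proj predT = 1%:M.
Proof. by rewrite -(@blk1 _ _ al); apply: eq_blk. Qed.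

End MultiObject.

Section SmallData.
Context {R : realType} {n : nat}.
Variables (K : 'M[R]_n) (a : 'cV[R]_n) (G : 'M[R]_n) (D : R -> R -> 'M[R]_n).
Hypothesis sd : spectral_data K a G D.

(** Small data: solve G xi = D eta for xi. Large data: solve D xi = a - G eta.
    In both cases the other unknown is bounded. *)
Lemma spec_xi_small : exists2 C : R, 0 <= C & forall t x,
  mnrm (spec_xi a G D t x) <= C * mnrm (D t x) /\
  forall Di, Di *m (D t x *m spec_xi a G D t x) = spec_xi a G D t x ->
    mnrm (spec_xi a G D t x) <= C * mnrm Di.
Proof.
have [C C0 xieta] := spec_bounded sd; have uG := posdef_unit (sd_posdef sd).
pose A := mnrm (invmx G) * C; pose B := mnrm a + mnrm G * C.
have A0 : 0 <= A by rewrite mulr_ge0 ?mnrm_ge0.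
have B0 : 0 <= B by rewrite addr_ge0 ?mulr_ge0 ?mnrm_ge0.
exists (A + B); first exact: addr_ge0.
move=> t x; have [xC yC] := xieta t x; split=> [|Di e].
  apply: (@le_trans _ _ (A * mnrm (D t x))); last by rewrite ler_wpM2r ?mnrm_ge0// lerDl.
  rewrite -[spec_xi a G D t x](mulKmx uG) (spec_eq2 sd) /A mulrAC -mulrA.
  by apply: mnrmM_le => //; apply: mnrmM_le.
apply: (@le_trans _ _ (mnrm Di * B)); last by rewrite mulrC ler_wpM2r ?mnrm_ge0// lerDr.
rewrite -{1}e; apply: mnrmM_le => //.
have -> : D t x *m spec_xi a G D t x = a - G *m spec_eta a G D t x.
  by rewrite -[X in X - _](spec_eq1 sd t x) addrK.
by apply: mnrmB_le => //; apply: mnrmM_le.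
Qed.

Lemma potential_le t x : `|potential a G D t x| <= mnrm a * mnrm (spec_xi a G D t x).
Proof.
by apply: le_trans (le_mnrm _ _ _) _; rewrite -(mnrm_tr a); exact: mnrmM.
Qed.

End SmallData.

Section Localisation.
Context {R : realType} {J : finType}.
Variables (be al x2 : J -> R).
Hypothesis be_gt0 : forall j, 0 < be j.
Let vel j := be j ^+ 2 - 3 * al j ^+ 2.
Hypothesis vel_inj : injective vel.
Local Notation E := (obj_amp be al x2).

Lemma ampE j t x : E j t x = expR (- (be j * (x - vel j * t)) - be j * x2 j).
Proof. by rewrite /obj_amp /vel; congr expR; ring. Qed.

Lemma ampVE j t x : (E j t x)^-1 = expR (be j * (x - vel j * t) + be j * x2 j).
Proof. by rewrite ampE -expRN; congr expR; ring. Qed.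

(** Every amplitude decreases in x, so it is small to the right of the object
    and large to the left; the factor exp (W t) makes up for the distance from
    the object to the origin. *)
Lemma amp_far : exists c W d : R, [/\ 0 <= c, 0 <= W, 0 < d &
  forall j t x, 0 <= t ->
    (0 <= x -> E j t x <= c * expR (W * t - d * `|x|)) /\
    (x <= 0 -> (E j t x)^-1 <= c * expR (W * t - d * `|x|))].
Proof.
have [d d0 dbe] := finite_min be_gt0.
have [W W0 hW] := finite_max (fun j => `|be j * vel j|).
have [c c0 hc] := finite_max (fun j => `|be j * x2 j|).
exists (expR c), W, d; split; [exact: expR_ge0|done|done|].
move=> j t x t0; rewrite (ampVE j t x) (ampE j t x) -expRD.
have vt : `|be j * vel j * t| <= W * t by rewrite normrM (ger0_norm t0) ler_wpM2r.
have := hc j; rewrite ler_norml => /andP[c1 c2].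
move: vt; rewrite ler_norml => /andP[v1 v2].
split=> x0; rewrite ler_expR.
  rewrite (ger0_norm x0); have : d * x <= be j * x by rewrite ler_wpM2r.
  rewrite mulrBr mulrA; lra.
rewrite (ler0_norm x0); have : be j * x <= d * x by rewrite ler_wnM2r.
rewrite mulrBr mulrA; lra.
Qed.

(** When m is the object nearest to x, the distance from x to any other centre
    is at least half the distance between the two centres, hence at least g / 2
    * t, where g is the least gap between velocities. *)
Lemma amp_near : exists c d : R, [/\ 0 <= c, 0 < d &
  forall m t x, 0 < t -> (forall j, `|x - vel m * t| <= `|x - vel j * t|) -> forall j,
    (vel j < vel m -> E j t x <= c * expR (- (d * t))) /\
    (vel m < vel j -> (E j t x)^-1 <= c * expR (- (d * t)))].
Proof.
have [d d0 dbe] := finite_min be_gt0.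
have [g g0 hg] : exists2 g, 0 < g & forall i j, i != j -> g <= `|vel i - vel j|.
  have [|g g0 hg] := @finite_min R (J * J)%type
    (fun ij => if ij.1 == ij.2 then 1 else `|vel ij.1 - vel ij.2|).
    case=> i j /=; case: ifPn => // ij; rewrite normr_gt0 subr_eq0.
    by apply: contra_neq ij; exact: vel_inj.
  by exists g => // i j ij; have := hg (i, j); rewrite /= (negbTE ij).
have [c c0 hc] := finite_max (fun j => `|be j * x2 j|).
exists (expR c), (d * (g / 2)); split; [exact: expR_ge0|by rewrite mulr_gt0 ?divr_gt0|].
move=> m t x t0 near j; rewrite (ampVE j t x) (ampE j t x) -expRD.
have := hc j; rewrite ler_norml => /andP[c1 c2].
have hbe (y : R) : g / 2 * t <= y -> d * (g / 2) * t <= be j * y.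
  move=> hy; rewrite -mulrA; apply: ler_pM => //; first exact: ltW.
  by rewrite !mulr_ge0// ltW.
have nm := near j; split=> jm; rewrite ler_expR.
  have mj : g <= vel m - vel j.
    have := hg m j; rewrite (gtr0_norm (_ : 0 < vel m - vel j)) ?subr_gt0//; apply.
    by apply: contraTneq jm => ->; rewrite ltxx.
  have gt : g * t <= (vel m - vel j) * t by rewrite ler_wpM2r// ltW.
  have gt0 : 0 < g * t by rewrite mulr_gt0.
  have h : g / 2 * t <= x - vel j * t.
    move: nm; rewrite !ler_norml; case: (lerP 0 (x - vel j * t)) => [p|p];
    [rewrite ger0_norm//|rewrite ltr0_norm//] => /andP[]; lra.
  have := hbe _ h; lra.
have mj : g <= vel j - vel m.
  have := hg j m; rewrite (gtr0_norm (_ : 0 < vel j - vel m)) ?subr_gt0//; apply.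
  by apply: contraTneq jm => ->; rewrite ltxx.
have gt : g * t <= (vel j - vel m) * t by rewrite ler_wpM2r// ltW.
have gt0 : 0 < g * t by rewrite mulr_gt0.
have h : g / 2 * t <= - (x - vel j * t).
  move: nm; rewrite !ler_norml; case: (lerP 0 (x - vel j * t)) => [p|p];
  [rewrite ger0_norm//|rewrite ltr0_norm//] => /andP[]; lra.
have := hbe _ h; lra.
Qed.

End Localisation.

Section Objects.
Context {R : realType} {J : finType}.
Variables (be al x1 x2 p0 q0 : J -> R).
Hypothesis be_gt0 : forall j, 0 < be j.
Hypothesis q0_van : vanishing al q0.
Hypothesis pq0 : forall j, 0 < p0 j ^+ 2 + q0 j ^+ 2.
Let vel j := be j ^+ 2 - 3 * al j ^+ 2.
Hypothesis vel_inj : injective vel.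

Local Notation n := (dim al).
Local Notation K := (Kmx be al).
Local Notation a := (avec al).
Local Notation G := (Gmx be al).
Local Notation S := (Smx al).
Local Notation Dobj := (Dobj be al x1 x2 p0 q0).
Local Notation Dobj_inv := (Dobj_inv be al x1 x2 p0 q0).
Local Notation E := (obj_amp be al x2).
Local Notation proj := (@proj R J al).

Lemma sep : forall i j, be i = be j -> al i ^+ 2 = al j ^+ 2 -> i = j.
Proof. by move=> i j bb aa; apply: vel_inj; rewrite /vel bb aa. Qed.

Let pG : posdef G := Gmx_posdef be_gt0 sep.

Lemma obj_data : spectral_data K a G Dobj.
Proof.
split.
- exact: pG.
- exact: Gmx_lyapunov.
- exact: Dobj_sym.
- by move=> t x; exact: Dobj_comm.
- by move=> t x; exact: Dobj_dx.
- by move=> t x; exact: Dobj_dt.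
Qed.

Definition single_a j := proj (pred1 j) *m a.
Definition single_G j := proj (pred1 j) *m G *m proj (pred1 j) + (1%:M - proj (pred1 j)).
Definition single_D j t x := Dobj t x *m proj (pred1 j).

Local Notation single_xi j := (spec_xi (single_a j) (single_G j) (single_D j)).
Local Notation single_eta j := (spec_eta (single_a j) (single_G j) (single_D j)).
Local Notation single_pot j := (potential (single_a j) (single_G j) (single_D j)).

Lemma K_proj A : K *m proj A = proj A *m K.
Proof. by rewrite /Kmx proj_blk. Qed.

Lemma single_data j :
  spectral_data (K *m proj (pred1 j)) (single_a j) (single_G j) (single_D j).
Proof.
apply: (data_restriction obj_data (proj_is_proj al (pred1 j)) (K_proj _)).
by move=> t x; rewrite proj_Dobj.
Qed.

(** Every block of the data is the amplitude obj_amp times a matrix that is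
    bounded together with its inverse. *)
Lemma Dobj_bound : exists2 C : R, 0 <= C & forall (A : pred J) t x e, 0 <= e ->
  ((forall j, A j -> E j t x <= e) -> mnrm (proj A *m Dobj t x) <= C * e) /\
  ((forall j, A j -> (E j t x)^-1 <= e) -> mnrm (proj A *m Dobj_inv t x) <= C * e).
Proof.
pose w j := `|p0 j| + `|q0 j|; pose r j := p0 j ^+ 2 + q0 j ^+ 2.
have [c1 c10 wc] := finite_max w; have [c2 c20 rc] := finite_max (fun j => w j / r j).
pose c := c1 + c2; have c0 : 0 <= c by exact: addr_ge0.
exists (mnrm S * ((n * n)%:R * (2 * c))); first by rewrite !mulr_ge0 ?mnrm_ge0.
move=> A t x e e0.
have E0 j : 0 < E j t x by exact: expR_gt0.
have trig (u v y z : R) : `|y| <= 1 -> `|z| <= 1 -> `|u * y - v * z| <= `|u| + `|v| /\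
    `|u * y + v * z| <= `|u| + `|v|.
  move=> y1 z1; have h1 : `|u * y| <= `|u| by rewrite normrM ler_piMr.
  have h2 : `|v * z| <= `|v| by rewrite normrM ler_piMr.
  by split; [apply: le_trans (ler_normB _ _) _|apply: le_trans (ler_normD _ _) _]; exact: lerD.
have pw j : `|obj_p be al x1 x2 p0 q0 j t x| <= E j t x * w j.
  rewrite /obj_p normrM ger0_norm ?(ltW (E0 j))// ler_wpM2l ?(ltW (E0 j))//.
  by have [] := trig (p0 j) (q0 j) _ _ (cos_max (obj_arg be al x1 j t x)) (sin_max (obj_arg be al x1 j t x)).
have qw j : `|obj_q be al x1 x2 p0 q0 j t x| <= E j t x * w j.
  rewrite /obj_q normrM ger0_norm ?(ltW (E0 j))// ler_wpM2l ?(ltW (E0 j))//.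
  by have [] := trig (p0 j) (q0 j) _ _ (sin_max (obj_arg be al x1 j t x)) (cos_max (obj_arg be al x1 j t x)).
have w0 j : 0 <= w j by rewrite addr_ge0.
have r0 j : 0 < r j := pq0 j.
have bound (f : J -> R) (g : J -> R) : (forall j, A j -> `|f j| <= c * e) ->
    (forall j, A j -> `|g j| <= c * e) ->
    mnrm (proj A *m (S *m blk al f g)) <= mnrm S * ((n * n)%:R * (2 * c)) * e.
  move=> fc gc; rewrite mulmxA proj_S -mulmxA projM.
  have -> : mnrm S * ((n * n)%:R * (2 * c)) * e = mnrm S * ((n * n)%:R * (2 * (c * e))) by ring.
  apply: mnrmM_le => //; apply: blk_norm => j; rewrite normrM.
    have := fc j; case: (A j) => [/(_ isT) h|_]; first by rewrite normr1 mul1r.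
    by rewrite normr0 mul0r mulr_ge0.
  have := gc j; case: (A j) => [/(_ isT) h|_]; first by rewrite normr1 mul1r.
  by rewrite normr0 mul0r mulr_ge0.
have invb j z : (E j t x)^-1 <= e -> `|z| <= E j t x * w j ->
    `|z / (E j t x ^+ 2 * r j)| <= c * e.
  move=> hE zw; have D0 : 0 < E j t x ^+ 2 * r j by rewrite mulr_gt0 ?exprn_gt0.
  rewrite normrM normfV (ger0_norm (ltW D0)) ler_pdivrMr//; apply: le_trans zw _.
  have h : w j <= c * r j.
    by rewrite -ler_pdivrMr//; apply: le_trans (rc j) _; rewrite lerDr.
  have h2 : 1 <= e * E j t x by rewrite -ler_pdivrMr// div1r.
  have -> : c * e * (E j t x ^+ 2 * r j) = E j t x * ((e * E j t x) * (c * r j)) by ring.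
  rewrite ler_wpM2l ?(ltW (E0 j))//; apply: (le_trans h); rewrite ler_peMl//.
  exact: le_trans (w0 j) h.
have dirb j z : E j t x <= e -> `|z| <= E j t x * w j -> `|z| <= c * e.
  move=> hE zw; apply: le_trans zw _; rewrite mulrC; apply: ler_pM => //.
    exact: ltW.
  by apply: le_trans (wc j) _; rewrite lerDl.
split=> hE; apply: bound => j Aj.
- exact: dirb (hE j Aj) (pw j).
- exact: dirb (hE j Aj) (qw j).
- by rewrite obj_normE; exact: invb (hE j Aj) (pw j).
- by rewrite obj_normE; exact: invb (hE j Aj) (qw j).
Qed.

(** * Superposition for large times *)

Definition slower (m : J) : pred J := [pred j | vel j < vel m].
Definition Wmx m : 'M[R]_n := pinv G (proj (slower m)).
(** What remains of a on the block m after elimination of the slower objects. *)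
Definition shift_vec m : 'cV[R]_n := schur_vec a G (proj (pred1 m)) (Wmx m).
(** The complex number shift_re + i shift_im takes a to [shift_vec] on the block
    m; its modulus and argument determine the shifts of the two phases of the
    object m that the slower ones cause. *)
Definition shift_re m := ofV (shift_vec m) (m, false).
Definition shift_im m := - ofV (shift_vec m) (m, true).
Definition Mmx : 'M[R]_n := blk al shift_re shift_im.

Lemma shift_im_van : vanishing al shift_im.
Proof. by move=> m am; rewrite /shift_im ofV_out ?oppr0// /mode_pred /= am eqxx. Qed.

Lemma slower_orth m : proj (slower m) *m proj (pred1 m) = 0.
Proof.
rewrite proj_proj -(@proj_pred0 _ _ al) /proj; apply: eq_blk => j *//=.
by case: eqP => [->|]; rewrite ?andbF // /slower /= ltxx.
Qed.

Lemma proj1_neq0 m : proj (pred1 m) != 0.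
Proof.
have [i im] : exists i : 'I_n, idx i = (m, false) by apply: idx_surj.
apply/eqP => /(congr1 (fun X : 'M[R]_n => X i i)); rewrite !mxE im /= eqxx mul1r eqxx.
by rewrite !mul0r addr0 => /eqP; rewrite oner_eq0.
Qed.

Lemma shift_vec_proj m : proj (pred1 m) *m shift_vec m = shift_vec m.
Proof. by apply: schur_vecPm; exact: proj_is_proj. Qed.

Lemma shift_vec_eq m : Mmx *m proj (pred1 m) *m a = shift_vec m.
Proof.
rewrite /Mmx -proj_blk; last exact: shift_im_van.
rewrite projM /avec blk_mulV; last by move=> j aj; rewrite shift_im_van// mulr0.
rewrite -[RHS]toV_ofV; apply: eq_toV => x mx.
have [xm|xm] := eqVneq x.1 m; last first.
  rewrite /= (negbTE xm) !mul0r addr0 -shift_vec_proj.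
  by rewrite blk_ofV//= (negbTE xm) !mul0r addr0.
case: x mx xm => j b mx /= jm; rewrite {j}jm in mx *; rewrite eqxx !mul1r.
case: b mx => mx /=; rewrite ?mulr0 ?mulr1 ?addr0 ?add0r//.
by rewrite /sg /shift_im mulrN1 opprK.
Qed.

Lemma shift_neq0 m : 0 < shift_re m ^+ 2 + shift_im m ^+ 2.
Proof.
rewrite lt_neqAle addr_ge0 ?sqr_ge0// andbT eq_sym.
apply/negP; rewrite paddr_eq0 ?sqr_ge0// !sqrf_eq0 => /andP[/eqP re0 /eqP im0].
have := schur_vec_neq0 (K := K) (a := a) pG (Gmx_lyapunov al be_gt0) (proj_is_proj al (slower m))
  (proj_is_proj al (pred1 m)) (slower_orth m) (K_proj _) (K_proj _).
have [PW WP PGW WGP Ws] := pinvP pG (proj_is_proj al (slower m)).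
move=> /(_ _ PW WP PGW Ws (stable be_gt0) (proj1_neq0 m)).
rewrite -/(Wmx m) -/(shift_vec m) -shift_vec_eq => /eqP; apply.
rewrite /Mmx -proj_blk; last exact: shift_im_van.
have -> : proj (pred1 m) *m blk al shift_re shift_im = 0; last by rewrite mul0mx.
rewrite projM; apply/matrixP => i j; rewrite !mxE /=.
have [->|_] := eqVneq (idx i).1 m; last by rewrite !mul0r addr0.
by rewrite re0 im0; ring.
Qed.

Definition Nmx : 'M[R]_n := blk al
  (fun m => shift_re m / (shift_re m ^+ 2 + shift_im m ^+ 2))
  (fun m => - shift_im m / (shift_re m ^+ 2 + shift_im m ^+ 2)).

Lemma MN : Mmx *m Nmx = 1%:M.
Proof.
rewrite /Mmx /Nmx blk_mul; last exact: shift_im_van.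
rewrite -(@blk1 _ _ al); apply: eq_blk => m *.
  by field; rewrite gt_eqF// shift_neq0.
by field; rewrite gt_eqF// shift_neq0.
Qed.

(** The prescribed data, advanced by the phase shifts that the interaction takes
    away again. *)
Definition Dtot t x := Mmx *m Dobj t x *m Mmx^T.

Lemma tot_data : spectral_data K a G Dtot.
Proof.
apply: (data_congruence obj_data).
by rewrite /Kmx /Mmx blkC//; exact: shift_im_van.
Qed.

Definition Dtot_inv t x := Nmx^T *m Dobj_inv t x *m Nmx.

Lemma NM : Nmx *m Mmx = 1%:M. Proof. exact: mulmx1C MN. Qed.

Lemma DtotK t x : Dtot t x *m Dtot_inv t x = 1%:M.
Proof.
have MtNt : Mmx^T *m Nmx^T = 1%:M by rewrite -trmx_mul NM trmx1.
have := DobjK be x1 x2 q0_van pq0 t x; rewrite /Dtot /Dtot_inv.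
move: (Dobj t x) (Dobj_inv t x) Mmx Nmx MN MtNt => A B M N MN MtNt AB.
by rewrite -!mulmxA (mulmxA M^T) MtNt mul1mx (mulmxA A) AB mul1mx MN.
Qed.

Lemma M_proj A : proj A *m Mmx = Mmx *m proj A.
Proof. by rewrite /Mmx proj_blk//; exact: shift_im_van. Qed.

Lemma Nim_van : vanishing al (fun m => - shift_im m / (shift_re m ^+ 2 + shift_im m ^+ 2)).
Proof. by move=> m am; rewrite shift_im_van// oppr0 mul0r. Qed.

Lemma N_proj A : proj A *m Nmx = Nmx *m proj A.
Proof. by rewrite /Nmx proj_blk//; exact: Nim_van. Qed.

Lemma tr_proj (A : pred J) (X : 'M[R]_n) : proj A *m X = X *m proj A -> proj A *m X^T = X^T *m proj A.
Proof.
by move=> h; have Ps := proj1 (proj_is_proj al A); rewrite -{1}Ps -trmx_mul -h trmx_mul Ps.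
Qed.

Lemma Dtot_proj A t x : proj A *m Dtot t x = Mmx *m (proj A *m Dobj t x) *m Mmx^T.
Proof.
have := M_proj A; rewrite /Dtot; move: (Dobj t x) Mmx (proj A) => X M P PM.
by rewrite !mulmxA PM.
Qed.

Lemma Dtot_proj_comm A t x : Dtot t x *m proj A = proj A *m Dtot t x.
Proof.
have := tr_proj (M_proj A); have := M_proj A; have := proj_Dobj be x1 x2 p0 q0_van A t x.
rewrite /Dtot; move: (Dobj t x) Mmx (proj A) => X M P PX PM PMt.
by rewrite -!mulmxA -PMt (mulmxA X) -PX (mulmxA P M) PM !mulmxA.
Qed.

Lemma Dtot_inv_proj A t x : proj A *m Dtot_inv t x = Nmx^T *m (proj A *m Dobj_inv t x) *m Nmx.
Proof.
have := tr_proj (N_proj A); rewrite /Dtot_inv; move: (Dobj_inv t x) Nmx (proj A) => X N P PN.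
by rewrite !mulmxA PN.
Qed.

Let tot_data := tot_data.

Lemma single_support j t x :
  [/\ proj (pred1 j) *m single_xi j t x = single_xi j t x,
      proj (pred1 j) *m single_eta j t x = single_eta j t x,
      single_D j t x *m single_xi j t x + proj (pred1 j) *m G *m single_eta j t x
        = proj (pred1 j) *m a &
      proj (pred1 j) *m G *m single_xi j t x = single_D j t x *m single_eta j t x].
Proof.
apply: (restriction_support obj_data (proj_is_proj al (pred1 j)) (K_proj (pred1 j))).
by move=> s y; rewrite proj_Dobj.
Qed.

(** The reduced Gram matrix and the conjugate of G by M solve the same Lyapunov
    equation, so they agree by [stable]; this is the hypothesis gramE of
    [decoupling]. *)
Lemma decoupling_at m : exists2 C : R, 0 <= C & forall t x eps,
  mnrm (proj (slower m) *m Dtot t x) <= eps ->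
  mnrm ((1%:M - proj (slower m) - proj (pred1 m)) *m Dtot_inv t x) <= eps ->
  `|potential a G Dtot t x - single_pot m t x| <= C * eps.
Proof.
have [C1 C10 hC1] := spec_bounded (single_data m).
have hB := proj_is_proj al (slower m); have hm := proj_is_proj al (pred1 m).
have [Ps PP] := hm.
have [PW WP PGW WGP Ws] := pinvP pG hB.
set P := proj (pred1 m) in hm Ps PP *.
have vec_eq : Mmx *m P *m a = schur_vec a G P (Wmx m).
  exact: shift_vec_eq.
have PM : P *m Mmx = Mmx *m P by exact: M_proj.
have PN : P *m Nmx = Nmx *m P by exact: N_proj.
have KP : K *m P = P *m K by exact: K_proj.
have KM : K *m Mmx = Mmx *m K.
  by rewrite /Kmx /Mmx blkC//; exact: shift_im_van.
(* Uniqueness for the Lyapunov equation identifies the two matrices. *)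
have gramE : schur_gram G P (Wmx m) = Mmx *m P *m G *m (Mmx *m P)^T.
  have lyap := schur_lyapunov (K := K) (a := a) pG (sd_lyapunov obj_data) hm
    (K_proj _) KP WP PGW Ws.
  apply/eqP; rewrite -subr_eq0; apply/eqP; apply: (stable be_gt0).
  rewrite mulmxBr mulmxBl addrACA -opprD lyap -vec_eq.
  have KMP : K *m Mmx *m P = Mmx *m P *m K.
    by rewrite KM -mulmxA KP mulmxA.
  have KMPt : (Mmx *m P)^T *m K^T = K^T *m (Mmx *m P)^T.
    by rewrite -!trmx_mul mulmxA KMP.
  have -> : K *m (Mmx *m P *m G *m (Mmx *m P)^T) + Mmx *m P *m G *m (Mmx *m P)^T *m K^T =
     Mmx *m P *m (K *m G + G *m K^T) *m (Mmx *m P)^T.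
    rewrite mulmxDr mulmxDl !mulmxA KMP; congr (_ + _).
    by rewrite -[LHS]mulmxA KMPt !mulmxA.
  by rewrite (sd_lyapunov obj_data) trmx_mul !mulmxA subrr.
have muP : Mmx *m P *m P = Mmx *m P by rewrite -mulmxA PP.
have Pnu : P *m (Nmx *m P)^T = (Nmx *m P)^T by rewrite -{1}Ps -trmx_mul -mulmxA PP.
have numu : (Mmx *m P)^T *m (Nmx *m P)^T = P.
  rewrite -trmx_mul -PN mulmxA -(mulmxA P) NM.
  by rewrite mulmx1 PP Ps.
have [C C0 hC] := @decoupling R n a G (proj (slower m)) P (Wmx m) (Mmx *m P) (Nmx *m P)
  pG hm PW PGW Ws vec_eq gramE muP Pnu numu C1 C10.
exists C => // t x eps h1 h2.
have [s1 s2 s3 s4] := single_support m t x.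
have [b1 b2] := hC1 t x.
have PMt : P *m Mmx^T = Mmx^T *m P by rewrite -{1}Ps -trmx_mul -PM trmx_mul Ps.
have DP : Dtot t x *m P = Mmx *m P *m single_D m t x *m (Mmx *m P)^T.
  have := proj_Dobj be x1 x2 p0 q0_van (pred1 m) t x.
  rewrite /Dtot /single_D -/P trmx_mul Ps => PX.
  move: (Dobj t x) PX => X PX.
  rewrite -!mulmxA (mulmxA P P) PP -PMt; congr (Mmx *m _).
  by rewrite !(mulmxA P) PX -!mulmxA (mulmxA P P) PP.
have compl : Dtot t x *m (1%:M - proj (slower m) - P) =
    (1%:M - proj (slower m) - P) *m Dtot t x.
  rewrite !mulmxBr !mulmxBl mulmx1 mul1mx; congr (_ - _ - _).
    exact: Dtot_proj_comm.
  exact: Dtot_proj_comm.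
have pe : single_pot m t x = (a^T *m single_xi m t x) 0 0.
  by rewrite /potential /single_a trmx_mul -/P Ps -mulmxA s1.
rewrite pe; apply: (hC (Dtot t x) (Dtot_inv t x) (single_D m t x) _ (single_eta m t x)) => //.
- exact: sd_sym tot_data t x.
- exact: DtotK.
- exact: Dtot_proj_comm.
Qed.

Lemma single_small j : exists2 C : R, 0 <= C & forall t x e, 0 <= e ->
  (E j t x <= e \/ (E j t x)^-1 <= e) -> mnrm (single_xi j t x) <= C * e.
Proof.
have [A A0 hA] := spec_xi_small (single_data j).
have [B B0 hB] := Dobj_bound.
exists (A * B); first exact: mulr_ge0.
move=> t x e e0 hE; have [h1 h2] := hA t x; have [b1 b2] := hB (pred1 j) t x e e0.
have [s1 _ _ _] := single_support j t x.
rewrite -mulrA; case: hE => hE.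
  apply: le_trans h1 _; rewrite ler_wpM2l//.
  rewrite /single_D -proj_Dobj//; apply: b1 => i /eqP ->; exact: hE.
apply: le_trans (h2 (proj (pred1 j) *m Dobj_inv t x) _) _; last first.
  by rewrite ler_wpM2l//; apply: b2 => i /eqP ->; exact: hE.
have := mulmx1C (DobjK be x1 x2 q0_van pq0 t x); rewrite /single_D => ID.
by rewrite -(mulmxA (Dobj t x)) s1 -mulmxA (mulmxA _ (Dobj t x)) ID mul1mx s1.
Qed.

Lemma total_bounds : exists2 C : R, 0 <= C & forall (A : pred J) t x e, 0 <= e ->
  ((forall j, A j -> E j t x <= e) -> mnrm (proj A *m Dtot t x) <= C * e) /\
  ((forall j, A j -> (E j t x)^-1 <= e) -> mnrm (proj A *m Dtot_inv t x) <= C * e).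
Proof.
have [B B0 hB] := Dobj_bound.
pose C1 := mnrm Mmx * B * mnrm Mmx; pose C2 := mnrm Nmx * B * mnrm Nmx.
have C10 : 0 <= C1 by rewrite !mulr_ge0 ?mnrm_ge0.
have C20 : 0 <= C2 by rewrite !mulr_ge0 ?mnrm_ge0.
exists (C1 + C2); first exact: addr_ge0.
move=> A t x e e0; have [b1 b2] := hB A t x e e0; split=> hE.
  rewrite Dtot_proj; apply: (@le_trans _ _ (C1 * e)); last by rewrite ler_wpM2r// lerDl.
  have -> : C1 * e = mnrm Mmx * (B * e) * mnrm Mmx^T by rewrite mnrm_tr /C1; ring.
  by apply: mnrmM_le => //; apply: mnrmM_le => //; exact: b1.
rewrite Dtot_inv_proj; apply: (@le_trans _ _ (C2 * e)); last by rewrite ler_wpM2r// lerDr.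
have -> : C2 * e = mnrm Nmx^T * (B * e) * mnrm Nmx by rewrite mnrm_tr /C2; ring.
by apply: mnrmM_le => //; apply: mnrmM_le => //; exact: b2.
Qed.

Lemma total_small : exists2 C : R, 0 <= C & forall t x e, 0 <= e ->
  ((forall j, E j t x <= e) \/ (forall j, (E j t x)^-1 <= e)) ->
  mnrm (spec_xi a G Dtot t x) <= C * e.
Proof.
have [A A0 hA] := spec_xi_small tot_data; have [B B0 hB] := total_bounds.
exists (A * B); first exact: mulr_ge0.
move=> t x e e0 hE; have [h1 h2] := hA t x; have [b1 b2] := hB predT t x e e0.
rewrite proj_predT !mul1mx in b1 b2.
rewrite -mulrA; case: hE => hE.
  by apply: le_trans h1 _; rewrite ler_wpM2l//; apply: b1.
apply: le_trans (h2 (Dtot_inv t x) _) _; last by rewrite ler_wpM2l//; apply: b2.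
have ID : Dtot_inv t x *m Dtot t x = 1%:M by apply: mulmx1C; exact: DtotK.
by rewrite mulmxA ID mul1mx.
Qed.

(** At each point [decoupling_at] is applied to the nearest object; the
    potentials of all the other ones are exponentially small there. *)
Lemma superposition : exists C d : R, [/\ 0 <= C, 0 < d &
  forall t x, 0 < t ->
    `|potential a G Dtot t x - \sum_j single_pot j t x| <= C * expR (- (d * t))].
Proof.
have /choice [fC hC] : forall m, exists C : R, 0 <= C /\ forall t x eps,
    mnrm (proj (slower m) *m Dtot t x) <= eps ->
    mnrm ((1%:M - proj (slower m) - proj (pred1 m)) *m Dtot_inv t x) <= eps ->
    `|potential a G Dtot t x - single_pot m t x| <= C * eps.
  by move=> m; have [C C0 h] := decoupling_at m; exists C.
have /choice [fS hS] : forall j, exists C : R, 0 <= C /\ forall t x e, 0 <= e ->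
    (E j t x <= e \/ (E j t x)^-1 <= e) -> mnrm (single_xi j t x) <= C * e.
  by move=> j; have [C C0 h] := single_small j; exists C.
have [B B0 hB] := total_bounds.
have [c [d [c0 d0 hcd]]] := amp_near x2 be_gt0 vel_inj.
pose C1 := \sum_m fC m * (B * c).
pose C2 := \sum_j mnrm (single_a j) * (fS j * c).
have C10 : 0 <= C1 by apply: sumr_ge0 => m _; rewrite !mulr_ge0//; case: (hC m).
have C20 : 0 <= C2 by apply: sumr_ge0 => m _; rewrite !mulr_ge0 ?mnrm_ge0//; case: (hS m).
exists (C1 + C2), d; split => //; first exact: addr_ge0.
move=> t x t0; set e := expR (- (d * t)).
have e0 : 0 <= e by exact: expR_ge0.
have ce0 : 0 <= c * e by rewrite mulr_ge0.
case: (pickP (fun _ : J => true)) => [j0 _|J0]; last first.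
  rewrite /potential mxE !big1 ?subr0 ?normr0 ?mulr_ge0 ?addr_ge0//.
    by move=> j; have := J0 j.
  by move=> i; have := J0 (idx i).1.
(* m is the object whose centre is nearest to x at time t. *)
case: (@arg_minP _ R J j0 predT (fun j => `|x - vel j * t|)) => // m _ near.
have {}near j : `|x - vel m * t| <= `|x - vel j * t| by exact: near.
have amp j := hcd m t x t0 near j.
have [b1 b2] := hB (slower m) t x _ ce0.
have [_ b3] := hB [pred j | vel m < vel j] t x _ ce0.
have compl : 1%:M - proj (slower m) - proj (pred1 m) = proj [pred j | vel m < vel j].
  rewrite -(@blk1 _ _ al) /proj !blkN !blkD; apply: eq_blk => j *; last by rewrite oppr0 !addr0.
  have -> : slower m j = (vel j < vel m) by [].
  rewrite /=; case: (ltgtP (vel j) (vel m)) => jm.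
  - have [ej|_] := eqVneq j m; last by rewrite subrr subr0.
    by move: jm; rewrite ej ltxx.
  - have [ej|_] := eqVneq j m; last by rewrite !subr0.
    by move: jm; rewrite ej ltxx.
  - by have -> := vel_inj jm; rewrite eqxx subr0 subrr.
have main : `|potential a G Dtot t x - single_pot m t x| <= C1 * e.
  have [fC0 h] := hC m.
  apply: (@le_trans _ _ (fC m * (B * (c * e)))).
    apply: h; first by apply: b1 => j /(proj1 (amp j)).
    by rewrite compl; apply: b3 => j /(proj2 (amp j)).
  have -> : fC m * (B * (c * e)) = fC m * (B * c) * e by ring.
  rewrite ler_wpM2r ?expR_ge0// /C1 (bigD1 m)//= lerDl sumr_ge0// => j _.
  by rewrite !mulr_ge0//; case: (hC j).
rewrite (bigD1 m)//= opprD addrA mulrDl; apply: le_trans (ler_normB _ _) _.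
apply: lerD => //; apply: le_trans (ler_norm_sum _ _ _) _.
rewrite /C2 mulr_suml [leRHS](bigD1 m)//=; apply: ler_wpDl.
  by rewrite !mulr_ge0 ?mnrm_ge0//; case: (hS m).
apply: ler_sum => j jm; apply: le_trans (potential_le _ _ _ _ _) _.
rewrite -!mulrA ler_wpM2l ?mnrm_ge0//; have [_ h] := hS j; apply: h => //.
case: (ltgtP (vel j) (vel m)) => [/(proj1 (amp j))|/(proj2 (amp j))|/vel_inj ej]; [by left|by right|].
by move: jm; rewrite ej eqxx.
Qed.

Lemma spatial_decay : exists C W d : R, [/\ 0 <= C, 0 <= W, 0 < d &
  forall t x, 0 <= t ->
    mnrm (spec_xi a G Dtot t x) <= C * expR (W * t - d * `|x|) /\
    forall j, mnrm (single_xi j t x) <= C * expR (W * t - d * `|x|)].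
Proof.
have /choice [fS hS] : forall j, exists C : R, 0 <= C /\ forall t x e, 0 <= e ->
    (E j t x <= e \/ (E j t x)^-1 <= e) -> mnrm (single_xi j t x) <= C * e.
  by move=> j; have [C C0 h] := single_small j; exists C.
have [B B0 hB] := total_small.
have [c [W [d [c0 W0 d0 hc]]]] := amp_far al x2 be_gt0.
have S0 : 0 <= \sum_j fS j by apply: sumr_ge0 => j _; case: (hS j).
exists ((B + \sum_j fS j) * c), W, d; split => //; first by rewrite mulr_ge0// addr_ge0.
move=> t x t0; set e := expR _; have ce0 : 0 <= c * e by rewrite mulr_ge0 ?expR_ge0.
rewrite -mulrA; split=> [|j].
  apply: (@le_trans _ _ (B * (c * e))); last by rewrite ler_wpM2r// lerDl.
  apply: hB => //; have [x0|x0] := leP 0 x; [left|right] => j; have [h1 h2] := hc j t x t0.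
    exact: h1.
  by apply: h2; exact: ltW.
have [fj0 h] := hS j.
apply: (@le_trans _ _ (fS j * (c * e))); last first.
  rewrite ler_wpM2r// (bigD1 j)//= addrCA lerDl addr_ge0// sumr_ge0// => i _.
  by case: (hS i).
apply: h => //; have [h1 h2] := hc j t x t0.
by have [x0|x0] := leP 0 x; [left; exact: h1|right; apply: h2; exact: ltW].
Qed.

(** * One soliton and one breather *)

Section At.
Variables (m : J) (t x : R).
Let X b := ofV (single_xi m t x) (m, b).
Let Y b := ofV (single_eta m t x) (m, b).
Let p := obj_p be al x1 x2 p0 q0 m t x.
Let q := obj_q be al x1 x2 p0 q0 m t x.
Let g b c := gam (be m + be m) (al m) (al m) b c.

Let supp := single_support m t x.

Lemma ofV_outside (u : 'cV[R]_n) j b : proj (pred1 m) *m u = u -> j != m -> ofV u (j, b) = 0.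
Proof.
move=> <- jm; have [mb|mb] := boolP (mode_pred al (j, b)); last exact: ofV_out.
by rewrite blk_ofV//= (negbTE jm) !mul0r addr0.
Qed.

Lemma sum_block (u : 'cV[R]_n) (F : J * bool -> R) : proj (pred1 m) *m u = u ->
  \sum_(y | mode_pred al y) F y * ofV u y =
  F (m, false) * ofV u (m, false) + F (m, true) * ofV u (m, true).
Proof.
move=> Pu; rewrite big_mkcond.
rewrite (eq_bigr (fun y => F (y.1, y.2) * ofV u (y.1, y.2))); last first.
  by case=> j b _ /=; case: ifPn => // h; rewrite ofV_out// mulr0.
rewrite -(pair_bigA _ (fun j b => F (j, b) * ofV u (j, b)))/= (bigD1 m)//= big_bool big1 ?addr0.
  by rewrite addrC.
by move=> j jm; rewrite big1// => b _; rewrite ofV_outside// mulr0.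
Qed.

Lemma D_entry (u : 'cV[R]_n) b : proj (pred1 m) *m u = u -> mode_pred al (m, b) ->
  ofV (single_D m t x *m u) (m, b) = sg b * (p * ofV u (m, b) + q * sg b * ofV u (m, ~~ b)).
Proof.
move=> Pu mb; rewrite /single_D -mulmxA Pu /Dobj -mulmxA.
have -> (w : 'cV[R]_n) : Smx al *m w = toV al (fun y => sg y.2 * ofV w y).
  rewrite -{1}[w]toV_ofV /Smx toM_mulV; apply: eq_toV => y my.
  rewrite (bigD1 y)//= eqxx mulr1 big1 ?addr0// => z /andP[_ zy].
  by rewrite eq_sym (negbTE zy) mulr0 mul0r.
by rewrite ofV_toV// blk_ofV//; exact: obj_q_van.
Qed.

Lemma G_entry (u : 'cV[R]_n) b : proj (pred1 m) *m u = u -> mode_pred al (m, b) ->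
  ofV (proj (pred1 m) *m G *m u) (m, b) =
  g b false * ofV u (m, false) + g b true * ofV u (m, true).
Proof.
move=> Pu mb; rewrite -mulmxA blk_ofV//= eqxx mul1r !mul0r addr0.
rewrite -{1}[u]toV_ofV /Gmx toM_mulV ofV_toV//.
by rewrite (sum_block (fun y => gam (be m + be y.1) (al m) (al y.1) b y.2)).
Qed.

Lemma a_entry b : mode_pred al (m, b) ->
  ofV (proj (pred1 m) *m avec al) (m, b) = (~~ b)%:R.
Proof. by move=> mb; rewrite blk_ofV//= eqxx mul1r !mul0r addr0 ofV_toV. Qed.

Lemma ofVD (u w : 'cV[R]_n) y : ofV (u + w) y = ofV u y + ofV w y.
Proof. by rewrite /ofV -big_split/=; apply: eq_bigr => i _; rewrite mxE mulrDl. Qed.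

Lemma mode_eq1 b : mode_pred al (m, b) ->
  sg b * (p * X b + q * sg b * X (~~ b)) + (g b false * Y false + g b true * Y true)
  = (~~ b)%:R.
Proof.
move=> mb; have [s1 s2 s3 s4] := supp.
by rewrite -(D_entry s1 mb) -(G_entry s2 mb) -ofVD s3 a_entry.
Qed.

Lemma mode_eq2 b : mode_pred al (m, b) ->
  g b false * X false + g b true * X true = sg b * (p * Y b + q * sg b * Y (~~ b)).
Proof.
move=> mb; have [s1 s2 s3 s4] := supp.
by rewrite -(D_entry s2 mb) -(G_entry s1 mb) s4.
Qed.

Lemma single_potE : single_pot m t x = X false.
Proof.
have [s1 s2 s3 s4] := supp.
rewrite /potential /single_a trmx_mul (proj1 (proj_is_proj al _)) -mulmxA s1 avec_mul.
rewrite (bigD1 m)//= big1 ?addr0// => j jm; exact: ofV_outside.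
Qed.

Lemma soliton_potE : al m = 0 ->
  single_pot m t x = p / (p ^+ 2 + (2 * be m) ^- 2).
Proof.
move=> am; rewrite single_potE.
have out : ~~ mode_pred al (m, true) by rewrite /mode_pred /= am eqxx.
have X0 : X true = 0 by exact: ofV_out.
have Y0 : Y true = 0 by exact: ofV_out.
have b0 := be_gt0 m.
have g0 : g false false = (2 * be m)^-1.
  have bn := lt0r_neq0 b0.
  rewrite /g /gam /lapC am subrr addr0 expr0n/= addr0; field.
  by rewrite bn lt0r_neq0 ?addr_gt0.
have := @mode_eq1 false isT; have := @mode_eq2 false isT.
clearbody g; rewrite /= X0 Y0 g0 /sg !mulr0 !addr0 !mul1r => e2 e1.
have i0 : 0 < (2 * be m)^-1 by rewrite invr_gt0 mulr_gt0.
have d0 : 0 < p ^+ 2 + (2 * be m) ^- 2 by rewrite ltr_wpDl ?sqr_ge0// -exprVn exprn_gt0.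
apply/eqP; rewrite eq_sym -(inj_eq (mulIf (lt0r_neq0 d0))) divfK ?lt0r_neq0//; apply/eqP.
rewrite -exprVn; move: e1 e2; set h := (_)^-1 => e1 e2.
have -> : X false * (p ^+ 2 + h ^+ 2) = p * (p * X false) + h * (h * X false) by ring.
have -> : p * X false = 1 - h * Y false by rewrite -[1]/(1%:R) -e1 addrK.
by rewrite e2; ring.
Qed.

(** The pair solves (D - i G) (xi + i eta) = a, whose determinant is fR - i fI;
    the formula is that of Cramer, multiplied by the squared modulus of the
    determinant. *)
Lemma breather_potE : al m != 0 ->
  forall fR fI, fR = - p ^+ 2 - q ^+ 2 - g false false * g true true + g false true ^+ 2  ->
  fI = p * (g true true - g false false) - 2 * q * g false true ->
  single_pot m t x * (fR ^+ 2 + fI ^+ 2) = - p * fR + g true true * fI.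
Proof.
move=> am fR fI fRE fIE; rewrite single_potE.
have mt : mode_pred al (m, true) by rewrite /mode_pred /= am.
have gs : g true false = g false true by rewrite /g gamC.
have := @mode_eq1 false isT; have := @mode_eq2 false isT.
have := mode_eq1 mt; have := mode_eq2 mt; clearbody g; rewrite /= ?gs /sg.
set u := X false; set u' := X true; set y := Y false; set y' := Y true.
set g1 := g false false; set g2 := g true true; set g3 := g false true.
move=> s2 s1 c2 c1.
pose c1L := 1 * (p * u + q * 1 * u') + (g1 * y + g3 * y').
pose s1L := -1 * (p * u' + q * -1 * u) + (g3 * y + g2 * y').
pose c2L := g1 * u + g3 * u' - 1 * (p * y + q * 1 * y').
pose s2L := g3 * u + g2 * u' - -1 * (p * y' + q * -1 * y).
have {}c1 : c1L = 1 by [].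
have {}s1 : s1L = 0 by [].
have {}c2 : c2L = 0 by rewrite /c2L c2 subrr.
have {}s2 : s2L = 0 by rewrite /s2L s2 subrr.
have -> : u * (fR ^+ 2 + fI ^+ 2) =
    fR * (- p * c1L - g2 * c2L - q * s1L + g3 * s2L) +
    fI * (g2 * c1L - p * c2L - g3 * s1L - q * s2L).
  by rewrite /c1L /c2L /s1L /s2L fRE fIE -/g1 -/g2 -/g3; ring.
by rewrite c1 c2 s1 s2; ring.
Qed.

End At.
End Objects.

Section Profiles.
Context {R : realType}.
Implicit Types t x z : R.

Lemma cosh_gt0 z : 0 < cosh z.
Proof. by rewrite /cosh divr_gt0// addr_gt0// expR_gt0. Qed.

Lemma isd_cosh (f : R -> R) (x a : R) : is_derive x 1 f a ->
  is_derive x 1 (fun y => cosh (f y)) ((expR (f x) - expR (- f x)) / 2 * a).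
Proof.
move=> fa; rewrite /cosh.
apply: isd_eq (isdM (isdD (isd_expR fa) (isd_expR (isdN fa))) (isd_cst 2^-1 x)) _.
ring.
Qed.

Lemma breatherE (al be x1 x2 t x : R) : al != 0 ->
  let th := al * (x + (al ^+ 2 - 3 * be ^+ 2) * t + x1) in
  let z := be * (x + (3 * al ^+ 2 - be ^+ 2) * t + x2) in
  breather al be x1 x2 t x = 2 * Num.sqrt 2 *
    (be / al * (al * cos th * cosh z - be * sin th * ((expR z - expR (- z)) / 2))
     / (cosh z ^+ 2 + (be / al * sin th) ^+ 2)).
Proof.
move=> a0 th z; rewrite /breather; congr (_ * _).
have aff (k b b' : R) : is_derive x 1 (fun y : R => k * (y + b + b')) k.
  apply: isd_eq (isdZ k (isdD (isdD (isd_id x) (isd_cst b x)) (isd_cst b' x))) _.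
  by rewrite !addr0 mulr1.
have H0 := lt0r_neq0 (cosh_gt0 z).
have := isdZ (be / al) (isdM (isd_sin (aff al ((al ^+ 2 - 3 * be ^+ 2) * t) x1))
  (@isdV _ (fun y => cosh (be * (y + (3 * al ^+ 2 - be ^+ 2) * t + x2))) _ _ H0 (isd_cosh (aff be ((3 * al ^+ 2 - be ^+ 2) * t) x2)))).
move=> /(isd_comp (is_derive1_atan _)) /isd_derive1 ->.
rewrite -/th -/z.
have d0 : cosh z ^+ 2 + (be / al * sin th) ^+ 2 != 0.
  by rewrite lt0r_neq0// ltr_wpDr ?sqr_ge0// exprn_gt0// cosh_gt0.
have d1 : 1 + (be / al * (sin th / cosh z)) ^+ 2 != 0.
  by rewrite lt0r_neq0// ltr_wpDr ?sqr_ge0.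
move: d0 d1; set H := cosh z; set S := sin th; set C := cos th; set e := expR z; set e' := expR (- z).
move=> d0 d1.
have -> : 1 + (be / al * (S / H)) ^+ 2 = (H ^+ 2 + (be / al * S) ^+ 2) / H ^+ 2.
  by field; rewrite a0 H0.
move: d0; set q := _ + _ => q0.
by field; rewrite a0 H0 q0.
Qed.

Lemma solitonE (c kappa x0 t x : R) : 0 < c ->
  soliton c kappa x0 t x =
  Num.sqrt 2 * (kappa * Num.sqrt c / cosh (Num.sqrt c * (x - x0 - c * t))).
Proof.
move=> c0; rewrite /soliton /Qprofile.
set H := cosh _; have H0 : 0 < H by exact: cosh_gt0.
clearbody H.
have -> : 2 * c / H ^+ 2 = (Num.sqrt 2 * Num.sqrt c / H) ^+ 2.
  by rewrite !exprMn exprVn (sqr_sqrtr (ltW c0)) (@sqr_sqrtr _ 2).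
rewrite sqrtr_sqr ger0_norm; first by field; rewrite lt0r_neq0.
by rewrite divr_ge0 ?mulr_ge0 ?sqrtr_ge0// ltW.
Qed.

End Profiles.

Section Identify.
Context {R : realType} {J : finType}.
Variables (be al x1 x2 p0 q0 : J -> R).
Hypothesis be_gt0 : forall j, 0 < be j.
Hypothesis q0_van : vanishing al q0.
Let vel j := be j ^+ 2 - 3 * al j ^+ 2.
Hypothesis vel_inj : injective vel.

Local Notation single_pot j :=
  (potential (single_a al j) (single_G be al j) (single_D be al x1 x2 p0 q0 j)).

Lemma single_pot_soliton m (c kappa x0 t x : R) : 0 < c -> kappa = 1 \/ kappa = -1 ->
  al m = 0 -> be m = Num.sqrt c -> x2 m = - x0 ->
  p0 m = kappa / (2 * Num.sqrt c) -> q0 m = 0 ->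
  Num.sqrt 2 * single_pot m t x = soliton c kappa x0 t x.
Proof.
move=> c0 hk am bm x2m p0m q0m.
rewrite solitonE// (soliton_potE x1 x2 p0 be_gt0 q0_van vel_inj)//.
have k2 : kappa ^+ 2 = 1 by case: hk => ->; rewrite ?sqrrN expr1n.
rewrite /obj_p /obj_amp /obj_arg am mul0r cos0 q0m mul0r subr0 mulr1 p0m bm x2m.
rewrite expr0n/= mulr0 sub0r sqr_sqrtr ?ltW//.
have -> : x + - c * t + - x0 = x - x0 - c * t by ring.
have b0 : 0 < Num.sqrt c by rewrite sqrtr_gt0.
move: b0; set b := Num.sqrt c => b0; set z := b * _.
rewrite /cosh expRN; have := expR_gt0 z; set e := expR z => e0.
have en := lt0r_neq0 e0; have bn := lt0r_neq0 b0.
congr (_ * _); rewrite -exprVn.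
have -> : (e^-1 * (kappa / (2 * b))) ^+ 2 + ((2 * b)^-1) ^+ 2 =
          (e ^- 2 + 1) / (2 * b) ^+ 2.
  by rewrite !exprMn k2; field; rewrite en bn.
have d1 : 1 + e ^+ 2 != 0 by rewrite lt0r_neq0// ltr_wpDr ?sqr_ge0.
have -> : e ^- 2 + 1 = (1 + e ^+ 2) / e ^+ 2 by field.
have -> : (e + e^-1) / 2 = (1 + e ^+ 2) / (2 * e) by field.
by field; rewrite d1 en bn.
Qed.

(** The constants p0 and q0 are such that p0^2 + q0^2 equals the determinant of
    the Gram block; this centres the envelope of the breather at y2 = 0, and the
    argument of p0 + i q0 turns the phase into the sine of al y1. *)
Lemma single_pot_breather m t x : al m != 0 ->
  p0 m = al m ^+ 2 / (4 * be m * (al m ^+ 2 + be m ^+ 2)) ->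
  q0 m = - (al m / (4 * (al m ^+ 2 + be m ^+ 2))) ->
  Num.sqrt 2 * single_pot m t x = breather (al m) (be m) (x1 m) (x2 m) t x.
Proof.
move=> a0 p0m q0m; rewrite breatherE// (mulrC 2) -[RHS]mulrA; congr (_ * _).
have := breather_potE (x1:=x1) (x2:=x2) (p0:=p0) be_gt0 q0_van vel_inj
  (t:=t) (x:=x) a0 erefl erefl.
have b0 := be_gt0 m.
rewrite /obj_p /obj_q /obj_amp /obj_arg p0m q0m.
set th := al m * _; set z := be m * _; rewrite expRN /cosh expRN.
have := expR_gt0 z; set e := expR z => e0.
set X := potential _ _ _ _ _.
have := cos2Dsin2 th; move: (cos th) (sin th) X => C S X.
clearbody e; move: (al m) (be m) a0 b0 => a b a0 b0 {th z p0m q0m} CS.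
have en := lt0r_neq0 e0; have bn := lt0r_neq0 b0.
have a2 : 0 < a ^+ 2 by rewrite lt0r sqrf_eq0 a0 sqr_ge0.
have sn : a ^+ 2 + b ^+ 2 != 0 by rewrite lt0r_neq0// addr_gt0// exprn_gt0.
have bb : b + b != 0 by rewrite lt0r_neq0 ?addr_gt0.
have d4 : (b + b) ^+ 2 + (a + a) ^+ 2 != 0.
  by rewrite lt0r_neq0// ltr_wpDr ?sqr_ge0// exprn_gt0// addr_gt0.
pose s := a ^+ 2 + b ^+ 2.
pose p := e^-1 * (a ^+ 2 / (4 * b * s) * C - - (a / (4 * s)) * S).
pose q := e^-1 * (a ^+ 2 / (4 * b * s) * S + - (a / (4 * s)) * C).
(* r2 is both p0^2 + q0^2 and the determinant of the Gram block. *)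
pose r2 := a ^+ 2 / (16 * b ^+ 2 * s).
have gcc : gam (b + b) a a false false = ((2 * b)^-1 + b / (2 * s)) / 2.
  by rewrite /gam /lapC /s subrr expr0n/= addr0; field; rewrite ?sn ?bn ?bb ?d4.
have gss : gam (b + b) a a true true = a ^+ 2 / (4 * b * s).
  by rewrite /gam /lapC /s subrr expr0n/= addr0; field; rewrite ?sn ?bn ?bb ?d4.
have gcs : gam (b + b) a a false true = a / (4 * s).
  by rewrite /gam /lapS /s subrr mul0r subr0; field; rewrite ?sn ?bn ?bb ?d4.
rewrite gcc gss gcs -/s -/p -/q.
have sn' : s != 0 by exact: sn.
have -> : - p ^+ 2 - q ^+ 2 - ((2 * b)^-1 + b / (2 * s)) / 2 * (a ^+ 2 / (4 * b * s))
    + (a / (4 * s)) ^+ 2 = - (r2 * (e ^- 2 + 1)).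
  have -> : ((2 * b)^-1 + b / (2 * s)) / 2 * (a ^+ 2 / (4 * b * s)) =
      r2 + (a / (4 * s)) ^+ 2 by rewrite /r2; field; rewrite bn sn'.
  have pq : p ^+ 2 + q ^+ 2 = ((a ^+ 2 / (4 * b * s)) ^+ 2 + (a / (4 * s)) ^+ 2) * e ^- 2 * (C ^+ 2 + S ^+ 2).
    by rewrite /p /q; field; rewrite en bn sn'.
  have -> : - p ^+ 2 - q ^+ 2 = - (p ^+ 2 + q ^+ 2) by ring.
  by rewrite pq CS /r2 /s; field; rewrite en bn sn.
have -> : p * (a ^+ 2 / (4 * b * s) - ((2 * b)^-1 + b / (2 * s)) / 2)
    - 2 * q * (a / (4 * s)) = - (S * a / (8 * b * s * e)).
  by rewrite /p /q /s; field; rewrite en bn sn.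
pose d := ((e + e^-1) / 2) ^+ 2 + (b / a * S) ^+ 2.
pose N := b / a * (a * C * ((e + e^-1) / 2) - b * S * ((e - e^-1) / 2)).
have d0 : 0 < d by rewrite ltr_wpDr ?sqr_ge0// exprn_gt0// divr_gt0// addr_gt0 ?invr_gt0.
(* k is the common factor of the fraction: fR^2 + fI^2 = k d, and the numerator
   is 2 k N. *)
pose k := a ^+ 4 / (64 * b ^+ 4 * s ^+ 2 * e ^+ 2).
have k0 : k != 0.
  by rewrite mulf_neq0 ?expf_neq0// invr_neq0// !mulf_neq0 ?expf_neq0// pnatr_eq0.
rewrite -/d -/N.
have -> : (- (r2 * (e ^- 2 + 1))) ^+ 2 + (- (S * a / (8 * b * s * e))) ^+ 2 = k * d.
  by rewrite /r2 /k /d; field; rewrite en bn sn' a0.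
have -> : - p * - (r2 * (e ^- 2 + 1)) + a ^+ 2 / (4 * b * s) * - (S * a / (8 * b * s * e))
    = k * (2 * N).
  by rewrite /p /r2 /k /N; field; rewrite en bn sn' a0.
rewrite mulrCA => /(mulfI k0) XN.
by rewrite mulrA -XN mulfK// lt0r_neq0.
Qed.

End Identify.

(** * Sobolev estimates for wave trains *)

Section SmoothCombinations.
Context {R : realType}.
Implicit Types f g : R -> R.

Lemma derive1nD f g n : smooth f -> smooth g ->
  derive1n n (fun x => f x + g x) = (fun x => derive1n n f x + derive1n n g x).
Proof.
move=> sf sg; elim: n => [//|n IH]; rewrite derive1nS IH; apply/funext => x.
by rewrite !derive1nS; apply: isd_derive1; apply: isdD; apply: derivable_isd.
Qed.

Lemma derive1nN f n : smooth f ->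
  derive1n n (fun x => - f x) = (fun x => - derive1n n f x).
Proof.
move=> sf; elim: n => [//|n IH]; rewrite derive1nS IH; apply/funext => x.
by rewrite derive1nS; apply: isd_derive1; apply: isdN; apply: derivable_isd.
Qed.

Lemma smoothD f g : smooth f -> smooth g -> smooth (fun x => f x + g x).
Proof.
move=> sf sg n x; rewrite derive1nD//.
by apply: isd_derivable; apply: isdD; apply: derivable_isd.
Qed.

Lemma smoothN f : smooth f -> smooth (fun x => - f x).
Proof.
move=> sf n x; rewrite derive1nN//.
by apply: isd_derivable; apply: isdN; apply: derivable_isd.
Qed.

Lemma derive1n_cst0 n : derive1n n (fun=> 0 : R) = (fun=> 0).
Proof.
elim: n => [//|n IH]; rewrite derive1nS IH; apply/funext => x.
exact: isd_derive1 (isd_cst 0 x).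
Qed.

Lemma smooth_cst0 : smooth (fun=> 0 : R).
Proof. by move=> n x; rewrite derive1n_cst0; exact: isd_derivable (isd_cst 0 x). Qed.

End SmoothCombinations.

Section Envelopes.
Context {R : realType}.
Variables W d : R.
Implicit Types f g : R -> R -> R.

(** W and d are common to all the derivatives, whereas the constants depend on
    the order: the exponential rates obtained below do not depend on the number
    of derivatives. *)
Definition enveloped f := (forall t, smooth (f t)) /\
  forall j, exists2 C, 0 <= C & forall t x, 0 <= t ->
    `|derive1n j (f t) x| <= C /\ `|derive1n j (f t) x| <= C * expR (W * t - d * `|x|).

Lemma envelopedD f g : enveloped f -> enveloped g -> enveloped (fun t x => f t x + g t x).
Proof.
move=> [sf bf] [sg bg]; split=> [t|j]; first exact: smoothD.
have [C C0 hC] := bf j; have [C' C0' hC'] := bg j.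
exists (C + C'); first exact: addr_ge0.
move=> t x t0; rewrite derive1nD// mulrDl.
have [a1 a2] := hC t x t0; have [b1 b2] := hC' t x t0.
by split; apply: (le_trans (ler_normD _ _)); exact: lerD.
Qed.

Lemma envelopedN f : enveloped f -> enveloped (fun t x => - f t x).
Proof.
move=> [sf bf]; split=> [t|j]; first exact: smoothN.
have [C C0 hC] := bf j; exists C => // t x t0; rewrite derive1nN// normrN; exact: hC.
Qed.

Lemma enveloped_sum (I : Type) (r : seq I) (F : I -> R -> R -> R) :
  (forall i, enveloped (F i)) -> enveloped (fun t x => \sum_(i <- r) F i t x).
Proof.
move=> eF; elim: r => [|i r IH].
  have -> : (fun t x => \sum_(i <- [::]) F i t x) = (fun _ _ => 0).
    by apply/funext => t; apply/funext => x; rewrite big_nil.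
  split=> [t|j]; first exact: smooth_cst0.
  by exists 0 => // t x _; rewrite derive1n_cst0 normr0 mul0r.
have -> : (fun t x => \sum_(i <- i :: r) F i t x) =
          (fun t x => F i t x + \sum_(i <- r) F i t x).
  by apply/funext => t; apply/funext => x; rewrite big_cons.
exact: envelopedD.
Qed.

Lemma enveloped_upto f N : enveloped f -> exists2 C, 0 <= C &
  forall j, (j <= N)%N -> forall t x, 0 <= t ->
    `|derive1n j (f t) x| <= C /\ `|derive1n j (f t) x| <= C * expR (W * t - d * `|x|).
Proof.
move=> [_ bf]; elim: N => [|N [C C0 hC]].
  by have [C C0 hC] := bf 0%N; exists C => // j; rewrite leqn0 => /eqP ->.
have [C' C0' hC'] := bf N.+1; exists (C + C'); first exact: addr_ge0.
move=> j jN t x t0.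
move: jN; rewrite leq_eqVlt => /predU1P[->|jN].
  have [h1 h2] := hC' t x t0; split; first by rewrite (le_trans h1)// lerDr.
  by rewrite (le_trans h2)// ler_wpM2r ?expR_ge0// lerDr.
have [h1 h2] := hC j jN t x t0; split; first by rewrite (le_trans h1)// lerDl.
by rewrite (le_trans h2)// ler_wpM2r ?expR_ge0// lerDl.
Qed.

(** The smaller exponent is below every convex combination of the two. *)
Lemma expR_interpolate (y A u v l : R) : 0 <= A -> 0 <= l <= 1 ->
  y <= A * expR u -> y <= A * expR v -> y <= A * expR ((1 - l) * u + l * v).
Proof.
move=> A0 /andP[l0 l1] yu yv; have [uv|/ltW vu] := leP u v.
  apply: (le_trans yu); rewrite ler_wpM2l// ler_expR; nra.
apply: (le_trans yv); rewrite ler_wpM2l// ler_expR; nra.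
Qed.

(** From 1 + x^2 <= (1 + |x|)^2 and 1 + |x| <= (1 + 4 / b) exp (b |x| / 4). *)
Lemma expR_wt (b : R) : 0 < b ->
  exists2 C, 1 <= C & forall x : R, expR (- (b * `|x|)) <= C * wt x ^+ 2.
Proof.
move=> b0; have b4 : 0 <= 4 / b by rewrite divr_ge0// ltW.
have b4' : 0 <= b / 4 by rewrite divr_ge0// ltW.
exists ((1 + 4 / b) ^+ 4); first by rewrite exprn_ege1// lerDl.
move=> x; set y := `|x|; have y0 : 0 <= y by exact: normr_ge0.
have q0 : 0 < 1 + x ^+ 2 by rewrite ltr_pwDl ?sqr_ge0.
rewrite /wt /oneDsqr exprVn ler_pdivlMr ?exprn_gt0// mulrC.
have e1 : 1 + y <= (1 + 4 / b) * expR (b / 4 * y).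
  have h : 1 + b / 4 * y <= expR (b / 4 * y) by rewrite expR_ge1Dx.
  apply: (@le_trans _ _ ((1 + 4 / b) * (1 + b / 4 * y))); last first.
    by rewrite ler_wpM2l// addr_ge0.
  have -> : (1 + 4 / b) * (1 + b / 4 * y) = 1 + y + (4 / b + b / 4 * y).
    by field; rewrite lt0r_neq0.
  by rewrite lerDl addr_ge0// mulr_ge0.
have e2 : 1 + x ^+ 2 <= (1 + y) ^+ 2.
  by rewrite -(real_normK (num_real x)) -/y; nra.
rewrite expRN -/y ler_pdivrMr ?expR_gt0//.
have -> : (1 + 4 / b) ^+ 4 * expR (b * y) = ((1 + 4 / b) * expR (b / 4 * y)) ^+ 4.
  by rewrite exprMn -expRM_natl; congr (_ * expR _); field.
apply: (@le_trans _ _ ((1 + y) ^+ 4)).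
  by rewrite (exprM _ 2 2) lerXn2r ?nnegrE ?sqr_ge0// ltW.
by rewrite lerXn2r ?nnegrE ?mulr_ge0 ?expR_ge0// addr_ge0.
Qed.

End Envelopes.

Section SobolevEnvelopes.
Context {R : realType}.
Variables W d : R.
Hypotheses (W0 : 0 <= W) (d0 : 0 < d).
Implicit Types f : R -> R -> R.

Lemma Hnorm_ge0 (s : R) (f : R -> R) : (0 <= Hnorm s f)%E.
Proof. by apply: le_ereal_inf_tmp => _ [a [b [_ ->]]]; exact: poweR_ge0. Qed.

(** The uniform estimate is interpolated with the spatial envelope, with so
    little weight l on the latter that its growth exp (l W t) takes away only a
    part of the decay exp (- a t). *)
Lemma Hnorm_exp_decay f (C a : R) : enveloped W d f -> 0 <= C -> 0 < a ->
  (forall t x, 0 < t -> `|f t x| <= C * expR (- (a * t))) ->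
  exists2 th, 0 < th & forall s, exists2 A, 1 <= A & forall t, 1 <= t ->
    (Hnorm s (f t) <= (A * expR (- (th * t)))%:E)%E.
Proof.
move=> ef C0 a0 fC; exists (a / 4) => [|s]; first by rewrite divr_gt0.
have [sf _] := ef.
pose q := a + 2 * W; have q0 : 0 < q by rewrite ltr_pwDl ?mulr_ge0.
pose l := a / (2 * q).
have l0 : 0 < l by rewrite divr_gt0 ?mulr_gt0.
have l1 : l <= 1.
  by rewrite ler_pdivrMr ?mulr_gt0// mul1r /q; move: W0 a0; lra.
(* This choice of l leaves the rate (1 - l) a - 2 l W = a / 2 for the product
   eps * M. *)
have lq : l * (a + 2 * W) = a / 2 by rewrite /l -/q; field; rewrite lt0r_neq0.
have [w w1 hw] := expR_wt (mulr_gt0 l0 d0).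
have w0 : 0 <= w by exact: le_trans w1.
have [N [Cs [Cs0 hN]]] := Hnorm_le s.
have [C1 C10 hC1] := enveloped_upto N ef.
pose B := (C + C1) * w; have CC : 0 <= C + C1 by exact: addr_ge0.
have B0 : 0 <= B by exact: mulr_ge0.
exists (1 + Cs * B); first by rewrite lerDl mulr_ge0.
move=> t t1; have t0 : 0 < t by exact: lt_le_trans t1.
pose u := (1 - l) * - (a * t) + l * (W * t); pose v := l * (W * t).
have weighted (y c x e : R) : 0 <= c -> c <= C + C1 ->
    y <= c * expR (e + l * (W * t) - l * d * `|x|) ->
    y <= B * expR (e + l * (W * t)) * wt x ^+ 2.
  move=> c0 cC /le_trans; apply.
  rewrite expRD mulrA.
  have -> : B * expR (e + l * (W * t)) * wt x ^+ 2 =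
    (C + C1) * expR (e + l * (W * t)) * (w * wt x ^+ 2) by rewrite /B; ring.
  apply: ler_pM; rewrite ?mulr_ge0 ?expR_ge0//.
  by rewrite ler_wpM2r// expR_ge0.
have le_uv : u <= v.
  by rewrite /u /v gerDr mulr_ge0_le0 ?subr_ge0// oppr_le0 mulr_ge0 ?ltW.
apply: (@le_trans _ _ (Cs * Num.sqrt ((B * expR u) * (B * expR v)))%:E).
  apply: hN => //.
  - by rewrite ler_wpM2l// ler_expR.
  - move=> x; apply: (weighted _ (C + C1)) => //.
    have -> : (1 - l) * - (a * t) + l * (W * t) - l * d * `|x| =
      (1 - l) * - (a * t) + l * (W * t - d * `|x|) by ring.
    apply: expR_interpolate => //; first by rewrite ltW.
      by apply: (le_trans (fC t x t0)); rewrite ler_wpM2r ?expR_ge0// lerDl.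
    have [_ h] := hC1 0%N (leq0n N) t x (ltW t0).
    by apply: (le_trans h); rewrite ler_wpM2r ?expR_ge0// lerDr.
  - move=> j jN x; have [h1 h2] := hC1 j jN t x (ltW t0).
    rewrite /v -[l * (W * t)]add0r; apply: (weighted _ C1) => //; first by rewrite lerDr.
    have -> : 0 + l * (W * t) - l * d * `|x| =
      (1 - l) * 0 + l * (W * t - d * `|x|) by ring.
    apply: expR_interpolate => //; first by rewrite ltW.
    by rewrite expR0 mulr1.
rewrite lee_fin.
have -> : B * expR u * (B * expR v) = (B * expR (- (a / 4 * t))) ^+ 2.
  rewrite exprMn -expRM_natl mulrACA -expr2 -expRD; congr (_ * expR _).
  rewrite /u /v; have -> : (1 - l) * - (a * t) + l * (W * t) + l * (W * t) =
    (l * (a + 2 * W) - a) * t by ring.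
  by rewrite lq; field.
rewrite sqrtr_sqr ger0_norm ?mulr_ge0 ?expR_ge0// mulrA.
by rewrite ler_wpM2r ?expR_ge0// lerDr.
Qed.

(** The difference of two values in time is bounded by the time increment and by
    the envelope, hence by the geometric mean of both, which is integrable and
    small. *)
Lemma enveloped_continuous_Hs f (L s : R) : enveloped W d f -> 0 <= L ->
  (forall t r x, `|f t x - f r x| <= L * `|t - r|) ->
  continuous_Hs_on s `[1, +oo[ f.
Proof.
move=> ef L0 fL t; rewrite /= in_itv/= andbT => t1.
have t0 : 0 <= t by exact: le_trans t1.
have d20 : 0 < d / 2 by rewrite divr_gt0.
have [w w1 hw] := expR_wt d20.
have w0 : 0 <= w by exact: le_trans w1.
have hw2 (x : R) : expR (- (d * `|x|)) <= w * wt x ^+ 2.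
  apply: le_trans (hw x); rewrite ler_expR lerN2 ler_wpM2r//.
  by move: d0; lra.
have [N [Cs [Cs0 hN]]] := Hnorm_le s.
have [C C0 hC] := enveloped_upto N ef.
have [sf _] := ef.
split.
  apply: (@le_lt_trans _ _ (Cs * Num.sqrt ((C * expR (W * t) * w) * (C * expR (W * t) * w)))%:E).
    have h j : (j <= N)%N -> forall x, `|derive1n j (f t) x| <= C * expR (W * t) * w * wt x ^+ 2.
      move=> jN x; have [_ h] := hC j jN t x t0; apply: (le_trans h).
      by rewrite expRD -!mulrA !ler_wpM2l ?expR_ge0.
    by apply: hN => //; exact: (h 0%N).
  by rewrite ltry.
pose E := expR (W * (t + 1)).
pose B := L + (C + C) * E.
have E0 : 0 <= E by exact: expR_ge0.
have B0 : 0 <= B by rewrite addr_ge0// mulr_ge0// addr_ge0.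
pose K := Cs * (B * w).
have K0 : 0 <= K by rewrite !mulr_ge0.
have bound (r : R) : 0 <= r -> `|r - t| <= 1 ->
    (Hnorm s (f r \- f t)%R <= (K * Num.sqrt (Num.sqrt `|r - t|))%:E)%E.
  move=> r0 rt; set h : R := Num.sqrt `|r - t|.
  have h0 : 0 <= h by exact: sqrtr_ge0.
  have h1 : h <= 1 by rewrite -[leRHS]sqrtr1 ler_sqrt.
  have hh : h * h = `|r - t| by rewrite -expr2 sqr_sqrtr.
  have rt1 : r <= t + 1 by move: rt; rewrite ler_norml => /andP[]; lra.
  have dj j x : derive1n j (f r \- f t) x = derive1n j (f r) x - derive1n j (f t) x.
    have := derive1nD j (sf r) (smoothN (sf t)); rewrite derive1nN//.
    by move=> /(congr1 (fun g => g x)).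
  have dB j : (j <= N)%N -> forall x,
      `|derive1n j (f r \- f t) x| <= B * expR (- (d * `|x|)).
    move=> jN x; rewrite dj.
    have up z : 0 <= z -> z <= t + 1 -> `|derive1n j (f z) x| <= C * E * expR (- (d * `|x|)).
      move=> z0 zt; have [_ h'] := hC j jN z x z0; apply: (le_trans h').
      rewrite expRD mulrA ler_wpM2r ?expR_ge0// ler_wpM2l//.
      by rewrite ler_expR ler_wpM2l.
    apply: (le_trans (ler_normB _ _)).
    apply: (@le_trans _ _ ((C + C) * E * expR (- (d * `|x|)))).
      by rewrite !mulrDl; apply: lerD; apply: up => //; rewrite lerDl.
    by rewrite ler_wpM2r ?expR_ge0// lerDr.
  have -> : K * Num.sqrt h = Cs * Num.sqrt ((B * w * h) * (B * w)).
    have -> : (B * w * h) * (B * w) = (B * w) ^+ 2 * h by ring.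
    by rewrite sqrtrM ?sqr_ge0// sqrtr_sqr ger0_norm ?mulr_ge0// mulrA.
  apply: hN.
  - exact: smoothD (sf r) (smoothN (sf t)).
  - by apply: ler_piMr => //; exact: mulr_ge0.
  - move=> x; pose e := expR (- (d / 2 * `|x|)).
    have e0 : 0 <= e by exact: expR_ge0.
    have ee : e * e = expR (- (d * `|x|)).
      by rewrite -expRD; congr (expR _); field.
    have y1 : `|f r x - f t x| <= B * (h * h).
      rewrite hh; apply: (le_trans (fL r t x)); rewrite ler_wpM2r// lerDl.
      by rewrite mulr_ge0// addr_ge0.
    have y2 : `|f r x - f t x| <= B * (e * e) by rewrite ee; exact: (dB 0%N).
    apply: (@le_trans _ _ (B * (h * e))).
      have [he|/ltW eh] := leP h e.
        by apply: (le_trans y1); rewrite ler_wpM2l// ler_wpM2l.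
      by apply: (le_trans y2); rewrite ler_wpM2l// ler_wpM2r.
    have -> : B * w * h * wt x ^+ 2 = B * (h * (w * wt x ^+ 2)) by ring.
    by rewrite ler_wpM2l// ler_wpM2l//; exact: hw.
  - move=> j jN x; apply: (le_trans (dB j jN x)).
    by rewrite -mulrA ler_wpM2l.
apply: (@squeeze_cvge _ _ _ _ (fun=> 0%E) _
   (fun r => (K * Num.sqrt (Num.sqrt `|r - t|))%:E)).
- rewrite near_withinE; exists 1 => //= r rt.
  rewrite in_itv/= andbT => r1; rewrite Hnorm_ge0/=.
  by apply: bound; [exact: le_trans r1|rewrite distrC ltW].
- exact: cvg_cst.
- apply: cvg_within_filter.
  have -> : 0%E = (K * Num.sqrt (Num.sqrt `|t - t|))%:E.
    by rewrite subrr normr0 !sqrtr0 mulr0.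
  apply: cvg_EFin; first by near=> r.
  apply: cvgMl_tmp.
  apply: (@continuous_cvg _ _ _ _ _ (fun r => Num.sqrt `|r - t|)); first exact: sqrt_continuous.
  apply: (@continuous_cvg _ _ _ _ _ (fun r => `|r - t|)); first exact: sqrt_continuous.
  by apply: cvg_norm; apply: cvgB; [exact: cvg_id|exact: cvg_cst].
Unshelve. all: by end_near. Qed.

End SobolevEnvelopes.

Section WaveEnvelope.
Context {R : realType} {n : nat}.
Variables (K : 'M[R]_n) (a : 'cV[R]_n) (G : 'M[R]_n) (D : R -> R -> 'M[R]_n).
Hypothesis sd : spectral_data K a G D.

Lemma enveloped_wave (W d C : R) : 0 <= C ->
  (forall t x, 0 <= t -> mnrm (spec_xi a G D t x) <= C * expR (W * t - d * `|x|)) ->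
  enveloped W d (mkdv_wave a G D).
Proof.
move=> C0 hC; split=> [t|j]; first exact: smooth_wave sd t.
have [A A0 hA] := wave_derivs_bound sd j; have [B B0 hB] := spec_bounded sd.
exists (A * B + A * C) => [|t x t0]; first by rewrite addr_ge0 ?mulr_ge0.
have [xiB _] := hB t x; split; apply: (le_trans (hA t x)).
  by rewrite (@le_trans _ _ (A * B))// ?ler_wpM2l// lerDl mulr_ge0.
rewrite (@le_trans _ _ (A * C * expR (W * t - d * `|x|)))//.
  by rewrite -mulrA ler_wpM2l// hC.
by rewrite ler_wpM2r ?expR_ge0// lerDr mulr_ge0.
Qed.

End WaveEnvelope.

Section Resolution.
Context {R : realType} {J : finType}.
Variables (be al x1 x2 p0 q0 : J -> R).
Hypothesis be_gt0 : forall j, 0 < be j.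
Hypothesis q0_van : vanishing al q0.
Hypothesis pq0 : forall j, 0 < p0 j ^+ 2 + q0 j ^+ 2.
Let vel j := be j ^+ 2 - 3 * al j ^+ 2.
Hypothesis vel_inj : injective vel.

Definition single_wave j : R -> R -> R :=
  mkdv_wave (single_a al j) (single_G be al j) (single_D be al x1 x2 p0 q0 j).

(** The statement for objects given by arbitrary nonzero norming constants p0 +
    i q0. *)
Theorem wave_train_exists : exists (theta : R) (A : R -> R) (p : R -> R -> R),
  [/\ 0 < theta, forall s, 1 <= A s, forall I, mKdV_solution_on I p &
    forall s, continuous_Hs_on s `[1, +oo[ p /\ forall t, 1 <= t ->
      (Hnorm s (fun x => p t x - \sum_j single_wave j t x)%R
         <= (A s * expR (- (theta * t)))%:E)%E].
Proof.
pose p : R -> R -> R := mkdv_wave (avec al) (Gmx be al) (Dtot be al x1 x2 p0 q0).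
have td : spectral_data _ _ _ _ := tot_data x1 x2 p0 be_gt0 q0_van vel_inj.
have [C [W [d [C0 W0 d0 hC]]]] := spatial_decay x1 x2 be_gt0 q0_van pq0 vel_inj.
have ep : enveloped W d p.
  by apply: (enveloped_wave td C0) => t x t0; case: (hC t x t0).
have es j : enveloped W d (single_wave j).
  apply: (enveloped_wave (single_data x1 x2 p0 be_gt0 q0_van vel_inj j) C0) => t x t0.
  by case: (hC t x t0).
have eg : enveloped W d (fun t x => p t x - \sum_j single_wave j t x).
  by apply: envelopedD ep (envelopedN _); exact: enveloped_sum.
have [B [b [B0 b0 hB]]] := superposition x1 x2 be_gt0 q0_van pq0 vel_inj.
have r2 : 0 <= Num.sqrt 2 :> R by exact: sqrtr_ge0.
have [|th th0 hth] := Hnorm_exp_decay W0 d0 (C := Num.sqrt 2 * B) eg (mulr_ge0 r2 B0) b0.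
  move=> t x t0; rewrite /p /single_wave /mkdv_wave -mulr_sumr -mulrBr normrM.
  by rewrite ger0_norm// -mulrA ler_wpM2l// hB.
have [L L0 hL] := wave_lipschitz td.
have /choice [A hA] : forall s : R, exists A : R, 1 <= A /\ forall t, 1 <= t ->
    (Hnorm s (fun x => p t x - \sum_j single_wave j t x)%R <= (A * expR (- (th * t)))%:E)%E.
  by move=> s; have [A A1 hA] := hth s; exists A.
exists th, A, p; split => //.
- by move=> s; case: (hA s).
- by move=> I; exact: mkdv_wave_solution td I.
move=> s; split; last by case: (hA s).
exact (enveloped_continuous_Hs W0 d0 s ep L0 hL).
Qed.

End Resolution.

Theorem theorem1p11 (R : realType) (K L : nat)
    (alpha beta x1 x2 : 'I_K -> R) (c kappa x0 : 'I_L -> R)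
    (alpha_gt0 : forall k, 0 < alpha k) (beta_gt0 : forall k, 0 < beta k)
    (c_gt0 : forall l, 0 < c l)
    (kappa_sign : forall l, kappa l = 1 \/ kappa l = -1)
    (velocity_inj : injective (velocity alpha beta c)) :
  let P (t x : R) : R :=
    \sum_(k < K) breather (alpha k) (beta k) (x1 k) (x2 k) t x
    + \sum_(l < L) soliton (c l) (kappa l) (x0 l) t x in
  exists (T theta : R) (A : R -> R) (p : R -> R -> R),
    [/\ 0 < T, 0 < theta,
        forall s : R, 2 <= s -> 1 <= A s,
        mKdV_solution_on `]T, +oo[ p
      & forall s : R, 2 <= s ->
          continuous_Hs_on s `[T, +oo[ p /\
          forall t : R, T <= t ->
            (Hnorm s (p t \- P t)%R <= (A s * expR (- (theta * t)))%:E)%E].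
Proof.
move=> P.
pose J : finType := ('I_K + 'I_L)%type.
pose be (j : J) := match j with inl k => beta k | inr l => Num.sqrt (c l) end.
pose al (j : J) := match j with inl k => alpha k | inr l => 0 end.
pose y1 (j : J) := match j with inl k => x1 k | inr l => 0 end.
pose y2 (j : J) := match j with inl k => x2 k | inr l => - x0 l end.
pose p0 (j : J) := match j with
  | inl k => alpha k ^+ 2 / (4 * beta k * (alpha k ^+ 2 + beta k ^+ 2))
  | inr l => kappa l / (2 * Num.sqrt (c l)) end.
pose q0 (j : J) := match j with
  | inl k => - (alpha k / (4 * (alpha k ^+ 2 + beta k ^+ 2)))
  | inr l => 0 end.
have be_gt0 j : 0 < be j by case: j => [k|l]; rewrite /be ?sqrtr_gt0.
have q0_van : vanishing al q0.
  by case=> [k|l] //= ak; have := alpha_gt0 k; rewrite ak ltxx.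
have pq0 j : 0 < p0 j ^+ 2 + q0 j ^+ 2.
  case: j => [k|l]; rewrite /p0 /q0.
    have ak := alpha_gt0 k; have bk := beta_gt0 k.
    rewrite ltr_wpDr ?sqr_ge0// exprn_gt0// divr_gt0 ?exprn_gt0//.
    by rewrite !mulr_gt0// addr_gt0 ?exprn_gt0.
  rewrite expr0n addr0 lt0r sqr_ge0 sqrf_eq0 andbT mulf_neq0//.
    by case: (kappa_sign l) => ->; rewrite ?oppr_eq0 oner_eq0.
  by rewrite invr_neq0// lt0r_neq0// mulr_gt0// sqrtr_gt0.
(* The soliton has be = sqrt c and al = 0, so be^2 - 3 al^2 is its speed. *)
have velE j : be j ^+ 2 - 3 * al j ^+ 2 = velocity alpha beta c j.
  by case: j => [k|l] //=; rewrite expr0n/= mulr0 subr0 sqr_sqrtr// ltW.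
have vel_inj : injective (fun j => be j ^+ 2 - 3 * al j ^+ 2).
  by move=> i j; rewrite !velE; exact: velocity_inj.
have [th [A [p [th0 A1 psol pH]]]] := wave_train_exists y1 y2 be_gt0 q0_van pq0 vel_inj.
have PE t : p t \- P t = fun x => p t x - \sum_j single_wave be al y1 y2 p0 q0 j t x.
  apply/funext => x; rewrite /= big_sumType/=; congr (_ - (_ + _)); apply: eq_bigr => i _.
    rewrite /single_wave /mkdv_wave (single_pot_breather y1 y2 be_gt0 q0_van vel_inj)//.
    exact: (lt0r_neq0 (alpha_gt0 i)).
  rewrite /single_wave /mkdv_wave.
  by rewrite (single_pot_soliton y1 (x2 := y2) (p0 := p0) be_gt0 q0_van vel_inj (m := inr i) t x
    (c_gt0 i) (kappa_sign i) erefl erefl erefl erefl erefl).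
exists 1, th, A, p; split; [exact: ltr01|exact: th0|by move=> s _; exact: A1|exact: psol|].
move=> s _; have [pc pb] := pH s; split; first exact: pc.
by move=> t t1; rewrite PE; exact: pb.
Qed.
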